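(* Let $\omega$ be a non-quasianalytic weight function. Then the following inclusions are dense: $$\mathcal{D}_{\omega}(\mathbb{R}^N) \subseteq \mathcal{S}_{\omega}(\mathbb{R}^N) \subseteq \mathcal{O}_{C,\omega}(\mathbb{R}^N)\subseteq \mathcal{O}_{M,\omega}(\mathbb{R}^N)\subseteq \mathcal{E}_{\omega}(\mathbb{R}^N).$$ That is, each space is a dense subspace of the next one, with respect to the topology of the larger space.
   Context: A non-quasianalytic weight function is a continuous increasing function $\omega:[0,\infty)\to[0,\infty)$ such that: $(\alpha)$ there is $K\geq 1$ with $\omega(2t)\leq K(1+\omega(t))$ for all $t\geq 0$; $(\beta)$ $\int_1^\infty \frac{\omega(t)}{1+t^2}\,dt<\infty$; $(\gamma)$ there are $a\in\mathbb{R}$, $b>0$ with $\omega(t)\geq a+b\log(1+t)$ for all $t\geq 0$; $(\delta)$ $\varphi_\omega(t)=\omega(e^t)$ is convex. Standing normalization: $\omega$ vanishes on $[0,1]$. For $x\in\mathbb{R}^N$ put $\omega(x):=\omega(|x|)$ with $|\cdot|$ the Euclidean norm. The Young conjugate is $\varphi^*_\omega(s):=\sup_{t\geq 0}\{st-\varphi_\omega(t)\}\ge 0$, $s\geq 0$; the value $+\infty$ is allowed, with $\exp(-\infty)=0$ and $\exp(+\infty)=+\infty$. Functions are complex-valued, $\mathbb{N}=\{1,2,\dots\}$, $\mathbb{N}_0=\mathbb{N}\cup\{0\}$. $\mathcal{E}_\omega(\mathbb{R}^N)$ is the Fréchet space of all $f\in C^\infty(\mathbb{R}^N)$ with $p_{K,m}(f):=\sup_{x\in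 K}\sup_{\alpha\in\mathbb{N}_0^N}|\partial^\alpha f(x)|\exp\left(-m\varphi^*_\omega(|\alpha|/m)\right)<\infty$ for all compact $K\subset\mathbb{R}^N$ and $m\in\mathbb{N}$, with the topology generated by these seminorms. $\mathcal{D}_\omega(\mathbb{R}^N)$ is the space of compactly supported elements of $\mathcal{E}_\omega(\mathbb{R}^N)$. $\mathcal{S}_\omega(\mathbb{R}^N)$ is the set of $f\in L^1(\mathbb{R}^N)$ with $f,\hat f\in C^\infty(\mathbb{R}^N)$ and $\|\exp(\lambda\omega)\partial^\alpha f\|_\infty<\infty$, $\|\exp(\lambda\omega)\partial^\alpha \hat f\|_\infty<\infty$ for all $\lambda>0$, $\alpha\in\mathbb{N}_0^N$. Equivalently (known), it is the set of $f\in C^\infty(\mathbb{R}^N)$ with $q_{\lambda,\mu}(f):=\sup_{\alpha}\sup_{x}\exp\left(-\lambda\varphi^*_\omega(|\alpha|/\lambda)\right)\exp(\mu\omega(x))|\partial^\alpha f(x)|<\infty$ for all $\lambda,\mu>0$. Its Fréchet topology is generated by the norms $q_{m,n}$, $m,n\in\mathbb{N}$. For $m\in\mathbb{N}$, $n\in\mathbb{Z}$, $\mathcal{O}^m_{n,\omega}(\mathbb{R}^N)$ is the space of $f\in C^\infty(\mathbb{R}^N)$ with $r_{m,n}(f):=\sup_{\alpha\in\mathbb{N}_0^N}\sup_{x\in\mathbb{R}^N}|\partial^\alpha f(x)|\exp\left(-n\omega(x)-m\varphi^*_\omega(|\alpha|/m)\right)<\infty$, normed by $r_{m,n}$. $\mathcal{O}_{M,\omega}(\mathbb{R}^N):=\bigcap_{m=1}^\infty\bigcup_{n=1}^\infty\mathcal{O}^m_{n,\omega}(\mathbb{R}^N)$,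 where each $\bigcup_{n=1}^\infty\mathcal{O}^m_{n,\omega}(\mathbb{R}^N)$ carries the locally convex inductive limit topology of the spaces $(\mathcal{O}^m_{n,\omega}(\mathbb{R}^N),r_{m,n})$, $n\in\mathbb{N}$, and $\mathcal{O}_{M,\omega}(\mathbb{R}^N)$ carries the projective limit topology over $m$. $\mathcal{O}_{C,\omega}(\mathbb{R}^N):=\bigcup_{n=1}^\infty\bigcap_{m=1}^\infty\mathcal{O}^m_{n,\omega}(\mathbb{R}^N)$, where each $\bigcap_{m=1}^\infty\mathcal{O}^m_{n,\omega}(\mathbb{R}^N)$ carries the topology generated by the norms $r_{m,n}$, $m\in\mathbb{N}$, and $\mathcal{O}_{C,\omega}(\mathbb{R}^N)$ carries the locally convex inductive limit topology over $n\in\mathbb{N}$. *)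

(* Defs.v *)
From HB Require Import structures.
From mathcomp Require Import all_boot all_order all_algebra.
From mathcomp Require Import all_classical all_reals all_analysis.
From mathcomp Require Import complex.

Set Implicit Arguments.
Unset Strict Implicit.
Unset Printing Implicit Defensive.

Import Order.TTheory GRing.Theory Num.Theory.
Import numFieldNormedType.Exports.

Local Open Scope classical_set_scope.
Local Open Scope ring_scope.

(* A locally convex topology on a linear subspace E of a fixed vector space V,
   given by its filter of 0-neighbourhoods; for U in [nbhs0 E], a set of vectors
   of V, only the trace of U on E matters.  The vector space and local convexity
   axioms are not fields: the topologies used below arise from
   [seminorm_lcs], [ind_lim] and [proj_lim]. *)

Record lcs (K : numDomainType) (V : lmodType K) := Lcs {
  space :> set V ;
  nbhs0 : set_system V ;
  nbhs0_filter : Filter nbhs0 }.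

Definition lcs_type (K : numDomainType) (V : lmodType K) (E : lcs V) : Type :=
  set_type (space E).

HB.instance Definition _ (K : numDomainType) (V : lmodType K) (E : lcs V) :=
  Choice.copy (lcs_type E) (set_type (space E)).

Section lcs_topology.
Context (K : numDomainType) (V : lmodType K) (E : lcs V).

Definition lcs_open (O : set (lcs_type E)) : Prop :=
  forall f, O f -> exists2 U, nbhs0 E U &
    forall g : lcs_type E, U (val g - val f) -> O g.

Lemma lcs_openT : lcs_open setT.
Proof.
move=> f _; exists setT => //; case: E => ? ? F; exact: filterT.
Qed.

Lemma lcs_openI : setI_closed lcs_open.
Proof.
move=> A B oA oB f [Af Bf].
have [U NU UA] := oA f Af; have [W NW WB] := oB f Bf.
exists (U `&` W); last by move=> g [Ug Wg]; split; [exact: UA|exact: WB].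
by have F := nbhs0_filter E; apply: filterI.
Qed.

Lemma lcs_open_bigU (I : Type) (A : I -> set (lcs_type E)) :
  (forall i, lcs_open (A i)) -> lcs_open (\bigcup_i A i).
Proof.
move=> oA f [i _ Aif]; have [U NU UA] := oA i f Aif.
by exists U => // g /UA Aig; exists i.
Qed.

HB.instance Definition _ :=
  isOpenTopological.Build (lcs_type E) lcs_openT lcs_openI lcs_open_bigU.

End lcs_topology.

Definition dense_subspace (K : numDomainType) (V : lmodType K)
    (E : lcs V) (A : set V) : Prop :=
  [/\ submod_closed (mem A), A `<=` E
    & dense [set f : lcs_type E | A (val f)]].

Notation "A '\dense_subspace_of' E" := (dense_subspace E A)
  (at level 70, no associativity).

(* Seminorms take values in the extended reals (suprema that are finite on E);
   the basic 0-neighbourhoods are given by finitely many seminorms. *)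
Section seminorm_topology.
Context (R : realType) (K : numDomainType) (V : lmodType K).
Variables (E : set V) (P : set (V -> \bar R)).

Definition seminorm_nbhs0 : set_system V :=
  [set U | exists (F : set (V -> \bar R)) (e : R),
     [/\ finite_set F, F `<=` P, 0 < e
       & forall f, E f -> (forall p, F p -> (p f < e%:E)%E) -> U f]].

Lemma seminorm_nbhs0_filter : Filter seminorm_nbhs0.
Proof.
split.
- by exists set0, 1; split.
- move=> A B [F [e [finF FP e0 FA]]] [G [d [finG GP d0 GB]]].
  exists (F `|` G), (Num.min e d); split.
  + by rewrite finite_setU.
  + by move=> p [/FP|/GP].
  + by rewrite lt_min e0.
  + move=> f Ef FGf; split.
      apply: FA => // p Fp; apply: lt_le_trans (FGf p (or_introl Fp)) _.
      by rewrite lee_fin ge_min lexx.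
    apply: GB => // p Gp; apply: lt_le_trans (FGf p (or_intror Gp)) _.
    by rewrite lee_fin ge_min lexx orbT.
- move=> A B AB [F [e [finF FP e0 FA]]]; exists F, e; split => // f Ef Ff.
  exact/AB/FA.
Qed.

Definition seminorm_lcs : lcs V := Lcs E seminorm_nbhs0_filter.

End seminorm_topology.

Section limits.
Context (K : numDomainType) (V : lmodType K) (I : Type).
Variables (D : set I) (E : I -> lcs V).

Definition absolutely_convex (W : set V) : Prop :=
  forall (a b : K) (f g : V), `|a| + `|b| <= 1 -> W f -> W g ->
    W (a *: f + b *: g).

(* The finest locally convex topology on the union making all inclusions
   continuous: its 0-neighbourhoods are generated by the absolutely convex sets
   whose trace on each step is a 0-neighbourhood of that step. *)
Definition ind_lim_nbhs0 : set_system V :=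
  [set U | exists W : set V,
     [/\ absolutely_convex W, forall i, D i -> nbhs0 (E i) W
       & (\bigcup_(i in D) space (E i)) `&` W `<=` U]].

Lemma ind_lim_nbhs0_filter : Filter ind_lim_nbhs0.
Proof.
split.
- exists setT; split => // i _; have F := nbhs0_filter (E i); exact: filterT.
- move=> A B [S [cS NS SA]] [T [cT NT TB]]; exists (S `&` T); split.
  + by move=> a b f g ab [Sf Tf] [Sg Tg]; split; [exact: cS|exact: cT].
  + move=> i Di; have F := nbhs0_filter (E i).
    by apply: filterI; [exact: NS|exact: NT].
  + by move=> f [Ef [Sf Tf]]; split; [exact: SA|exact: TB].
- by move=> A B AB [S [cS NS SA]]; exists S; split => // f /SA/AB.
Qed.

Definition ind_lim : lcs V :=
  Lcs (\bigcup_(i in D) space (E i)) ind_lim_nbhs0_filter.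

(* The coarsest topology on the intersection making all inclusions
   continuous. *)
Definition proj_lim_nbhs0 : set_system V :=
  [set U | exists (F : set I) (W : I -> set V),
     [/\ finite_set F, F `<=` D, forall i, F i -> nbhs0 (E i) (W i)
       & (\bigcap_(i in D) space (E i)) `&` (\bigcap_(i in F) W i) `<=` U]].

Lemma proj_lim_nbhs0_filter : Filter proj_lim_nbhs0.
Proof.
split.
- by exists set0, (fun=> setT); split.
- move=> A B [F [S [finF FD NS SA]]] [G [T [finG GD NT TB]]].
  exists (F `|` G), (fun i =>
    [set f | (F i -> S i f) /\ (G i -> T i f)]); split.
  + by rewrite finite_setU.
  + by move=> i [/FD|/GD].
  + move=> i FGi; have N := nbhs0_filter (E i).
    apply: (@filterI _ _ _ [set f | F i -> S i f] [set f | G i -> T i f]).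
      have [Fi|nFi] := pselect (F i); first by apply: filterS (NS i Fi) => f Sf _.
      by apply: (filterS _ filterT) => f _ ?.
    have [Gi|nGi] := pselect (G i); first by apply: filterS (NT i Gi) => f Tf _.
    by apply: (filterS _ filterT) => f _ ?.
  + move=> f [Ef STf]; split.
      apply: SA; split => // i Fi; exact: (STf i (or_introl Fi)).1.
    apply: TB; split => // i Gi; exact: (STf i (or_intror Gi)).2.
- move=> A B AB [F [S [finF FD NS SA]]]; exists F, S; split => // f /SA.
  exact: AB.
Qed.

Definition proj_lim : lcs V :=
  Lcs (\bigcap_(i in D) space (E i)) proj_lim_nbhs0_filter.

End limits.

Section tuple_measure.
Context d (T : measurableType d) (R : realType).
Local Open Scope ereal_scope.

Definition tcons n (p : T * n.-tuple T) : n.+1.-tuple T :=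
  [the n.+1.-tuple T of p.1 :: p.2].

Lemma measurable_tcons n : measurable_fun [set: T * n.-tuple T] (@tcons n).
Proof. exact: measurable_cons. Qed.

Section step.
Context n (m : {sigma_finite_measure set T -> \bar R})
  (mu : {sigma_finite_measure set (n.-tuple T) -> \bar R}).

Definition cons_measure : set (n.+1.-tuple T) -> \bar R :=
  pushforward (m \x mu) (@tcons n).

Let cons_measure0 : cons_measure set0 = 0.
Proof. by rewrite /cons_measure /pushforward preimage_set0 measure0. Qed.

Let cons_measure_ge0 A : 0 <= cons_measure A.
Proof. by rewrite /cons_measure /pushforward; apply: measure_ge0. Qed.

Let mpre (A : set (n.+1.-tuple T)) : measurable A ->
  measurable (@tcons n @^-1` A).
Proof. by move=> mA; rewrite -[X in measurable X]setTI; exact: measurable_tcons. Qed.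

Let cons_measure_sigma_additive : semi_sigma_additive cons_measure.
Proof.
move=> F mF tF mUF; rewrite /cons_measure /pushforward preimage_bigcup.
apply: measure_semi_sigma_additive.
- by move=> i; exact: mpre.
- apply/trivIsetP => /= i j _ _ ij; rewrite -preimage_setI.
  by move/trivIsetP : tF => /(_ _ _ _ _ ij) ->//; rewrite preimage_set0.
- by rewrite -preimage_bigcup; exact: mpre.
Qed.

HB.instance Definition _ := isMeasure.Build _ _ _ cons_measure
  cons_measure0 cons_measure_ge0 cons_measure_sigma_additive.

Let cons_measure_sigma_finite : sigma_finite setT cons_measure.
Proof.
have /sigma_finiteP[F [TF ndF Foo]] := sigma_finiteT m.
have /sigma_finiteP[G [TG ndG Goo]] := sigma_finiteT mu.
pose u (t : n.+1.-tuple T) := (thead t, [tuple of behead t]).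
have uK p : u (tcons p) = p.
  by case: p => x t; rewrite /u /tcons; congr pair; apply/val_inj.
have mu' : measurable_fun setT u.
  apply/measurable_fun_pairP; split; first exact: measurable_tnth.
  exact: measurable_behead.
exists (fun i => u @^-1` (F i `*` G i)).
  rewrite -preimage_bigcup (_ : \bigcup_i _ = setT) ?preimage_setT//.
  rewrite -subTset => -[x y] _.
  have [i _ Fix] : (\bigcup_i F i) x by rewrite -TF.
  have [k _ Gky] : (\bigcup_i G i) y by rewrite -TG.
  exists (maxn i k) => //; split.
    by move: x Fix; exact/subsetPset/ndF/leq_maxl.
  by move: y Gky; exact/subsetPset/ndG/leq_maxr.
move=> i; have [mF Fi] := Foo i; have [mG Gi] := Goo i; split.
  by rewrite -[X in measurable X]setTI; apply: mu' => //; exact: measurableX.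
rewrite /cons_measure /pushforward -comp_preimage.
rewrite (_ : u \o _ = id) ?preimage_id; last by apply/funext => p; exact: uK.
by rewrite product_measure1E// lte_mul_pinfty// ge0_fin_numE.
Qed.

HB.instance Definition _ := Measure_isSigmaFinite.Build _ _ _ cons_measure
  cons_measure_sigma_finite.

End step.

Fixpoint tuple_measure (m : {sigma_finite_measure set T -> \bar R}) n :
    {sigma_finite_measure set (n.-tuple T) -> \bar R} :=
  match n with
  | 0 => \d_[tuple]
  | n'.+1 => cons_measure m (tuple_measure m n')
  end.

End tuple_measure.

(* The (completion-free, Borel) n-dimensional Lebesgue measure, as an n-fold
   product measure. *)
Definition lebesgue_measure_tuple (R : realType) (n : nat) :=
  tuple_measure (@lebesgue_measure R) n.

Section weights.
Context (R : realType).

Record nonquasianalytic_weight (w : R -> R) : Prop := NonquasianalyticWeight {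
  weight_continuous : {within [set` `[0, +oo[], continuous w} ;
  weight_increasing : {in `[0, +oo[ &, {homo w : s t / s <= t}} ;
  weight_ge0 : forall t : R, 0 <= t -> 0 <= w t ;
  weight_alpha : exists2 K : R, 1 <= K &
    forall t : R, 0 <= t -> w (2 * t) <= K * (1 + w t) ;
  weight_beta :
    (\int[lebesgue_measure]_(t in [set` `[1%R, +oo[])
       (w t / (1 + t ^+ 2))%R%:E < +oo)%E ;
  weight_gamma : exists (a b : R), 0 < b /\
    forall t : R, 0 <= t -> a + b * ln (1 + t) <= w t ;
  weight_delta : convex_function setT (fun t : R => w (expR t)) ;
  weight_normalized : forall t : R, 0 <= t <= 1 -> w t = 0 }.

(* The value +oo is possible; [expeR] below maps -oo to 0. *)
Definition young_conj (w : R -> R) (s : R) : \bar R :=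
  ereal_sup [set (s * t - w (expR t))%:E | t in [set t | 0 <= t]].

End weights.

Section smooth_functions.
Context (R : realType) (N : nat).

(* [^o] provides the structure of complex vector space. *)
Definition cfun := 'rV[R]_N -> R[i]^o.

(* The library norm on row vectors is the maximum norm. *)
Definition enorm (x : 'rV[R]_N) : R := Num.sqrt (\sum_i x 0 i ^+ 2).

Definition dot (x y : 'rV[R]_N) : R := \sum_i x 0 i * y 0 i.

Definition unit_vec (i : 'I_N) : 'rV[R]_N := delta_mx 0 i.

Fixpoint Ck (k : nat) (g : 'rV[R]_N -> R) : Prop :=
  match k with
  | 0 => continuous g
  | k'.+1 => continuous g /\ forall i,
      (forall x, derivable g x (unit_vec i)) /\ Ck k' ('D_(unit_vec i) g)
  end.

Definition smooth (f : cfun) : Prop :=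
  forall k, Ck k (fun x => complex.Re (f x)) /\ Ck k (fun x => complex.Im (f x)).

(* The derivatives of the library are over one scalar field, hence the
   derivatives of a complex-valued function of real variables are taken on the
   real and imaginary parts. *)
Definition partial (i : 'I_N) (f : cfun) : cfun := fun x =>
  ('D_(unit_vec i) (fun y => complex.Re (f y)) x +i*
   'D_(unit_vec i) (fun y => complex.Im (f y)) x)%C.

Definition multi_index := {ffun 'I_N -> nat}.

Definition mdeg (a : multi_index) : nat := (\sum_i a i)%N.

Definition mpartial (a : multi_index) (f : cfun) : cfun :=
  foldr (fun i => iter (a i) (partial i)) f (enum 'I_N).

(* The library has measurable spaces of tuples, but not of row vectors. *)
Definition row_of_tuple (t : N.-tuple (measurableTypeR R)) : 'rV[R]_N :=
  \row_i tnth t i.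

Definition integrable_cfun (f : cfun) : Prop :=
  (lebesgue_measure_tuple R N).-integrable setT
    (fun t => (complex.Re (f (row_of_tuple t)))%:E) /\
  (lebesgue_measure_tuple R N).-integrable setT
    (fun t => (complex.Im (f (row_of_tuple t)))%:E).

Definition cintegral (f : cfun) : R[i] :=
  (\int[lebesgue_measure_tuple R N]_t complex.Re (f (row_of_tuple t)) +i*
   \int[lebesgue_measure_tuple R N]_t complex.Im (f (row_of_tuple t)))%C.

Definition cis (t : R) : R[i] := (cos t +i* sin t)%C.

(* xi |-> \int f(x) exp(-i<x, xi>) dx *)
Definition fourier (f : cfun) : cfun := fun xi =>
  cintegral (fun x => f x * cis (- dot x xi)).

End smooth_functions.

Section ultradifferentiable.
Context (R : realType) (w : R -> R) (N : nat).
Local Notation cfun := (cfun R N).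
Local Notation V := cfun.
Local Notation normc := ComplexField.Normc.normc.
Implicit Types (f : cfun).

(* [l * young_conj w (|a| / l)] *)
Definition scaled_conj (l : R) (a : multi_index N) : \bar R :=
  (l%:E * young_conj w ((mdeg a)%:R / l))%E.

Definition seminorm_p (K : set 'rV[R]_N) (m : nat) (f : V) : \bar R :=
  ereal_sup [set ((normc (mpartial a f x))%:E * expeR (- scaled_conj m%:R a))%E
            | x in K & a in [set: multi_index N]].

Definition seminorm_q (l u : R) (f : V) : \bar R :=
  ereal_sup [set (expeR (- scaled_conj l a) *
                  (expR (u * w (enorm x)) * normc (mpartial a f x))%:E)%E
            | a in [set: multi_index N] & x in [set: 'rV[R]_N]].

Definition seminorm_r (m : nat) (n : int) (f : V) : \bar R :=
  ereal_sup [set ((normc (mpartial a f x))%:E *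
                  expeR (- (n%:~R * w (enorm x))%:E - scaled_conj m%:R a))%E
            | a in [set: multi_index N] & x in [set: 'rV[R]_N]].

Definition E_space : lcs V :=
  seminorm_lcs
    [set f | smooth f /\ forall K m, compact K -> (0 < m)%N ->
                         (seminorm_p K m f < +oo)%E]
    [set seminorm_p Km.1 Km.2 | Km in
       [set Km : set 'rV[R]_N * nat | compact Km.1 /\ (0 < Km.2)%N]].

Definition D_space : set V :=
  [set f | space E_space f /\ compact (closure [set x | f x != 0])].

Definition weighted_sup (l : R) (a : multi_index N) (f : V) : \bar R :=
  ereal_sup [set (expR (l * w (enorm x)) * normc (mpartial a f x))%:E
            | x in [set: 'rV[R]_N]].

(* An element of L^1 with a smooth representative is identified with that
   representative, for which the L^oo norms are suprema.  The seminorms [seminorm_q]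
   are known to be finite on this space. *)
Definition S_space : lcs V :=
  seminorm_lcs
    [set f | [/\ integrable_cfun f, smooth f, smooth (fourier f)
      & forall (l : R) (a : multi_index N), 0 < l ->
          (weighted_sup l a f < +oo)%E /\
          (weighted_sup l a (fourier f) < +oo)%E]]
    [set seminorm_q mn.1%:R mn.2%:R | mn in
       [set mn : nat * nat | (0 < mn.1)%N /\ (0 < mn.2)%N]].

Definition O_set (m : nat) (n : int) : set V :=
  [set f | smooth f /\ (seminorm_r m n f < +oo)%E].

Definition O_normed (m : nat) (n : int) : lcs V :=
  seminorm_lcs (O_set m n) [set seminorm_r m n].

Definition OM_space : lcs V :=
  proj_lim [set m | (0 < m)%N] (fun m =>
    ind_lim [set n | (0 < n)%N] (fun n => O_normed m n%:Z)).

Definition OC_space : lcs V :=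
  ind_lim [set n | (0 < n)%N] (fun n =>
    seminorm_lcs (\bigcap_(m in [set m | (0 < m)%N]) O_set m n%:Z)
                 [set seminorm_r m n%:Z | m in [set m | (0 < m)%N]]).

End ultradifferentiable.

Arguments E_space {R} w N.
Arguments D_space {R} w N _.
Arguments S_space {R} w N.
Arguments OM_space {R} w N.
Arguments OC_space {R} w N.

(* Main.v *)
(* The weight [exp (- m phi^*(k / m))] is the infimum over [t >= 1] of
   [exp (m w t) / t ^ k].  Hence bounds with these weights on all derivatives are
   stable under products, up to a change of [m], and correspond to a decay of the
   Fourier transform like [exp (- l w)], for all [l].  Non-quasianalyticity provides
   cut-off functions with such bounds, as infinite convolutions of uniform densities
   on intervals of summable lengths.  For [f] in S and a cut-off [chi] around [x0],
   the transform of [chi f] at [xi] is bounded by multiples of [exp (- 2 l w xi)] and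
   of [exp (- 2 n w x0)], hence by their geometric mean; by Fourier inversion the
   seminorms [q_{m,n}] are finite on S.  All the spaces are thus described by weighted
   bounds on derivatives, which gives the inclusions.  The truncations of [f] at
   radius [k] converge to [f] in each of the topologies: outside of the ball of radius
   [k] there is a factor [exp (- w k)] to spare, and on a fixed compact set they
   eventually coincide with [f]. *)

Require Import Defs.
From mathcomp Require Import all_boot all_order all_algebra.
From mathcomp Require Import all_classical all_reals all_analysis.
From mathcomp Require Import measurable_realfun complex ring lra.

Set Implicit Arguments.
Unset Strict Implicit.
Unset Printing Implicit Defensive.

Import Order.TTheory GRing.Theory Num.Theory.
Import numFieldNormedType.Exports.

Local Open Scope classical_set_scope.
Local Open Scope ring_scope.

(** * Weighted infima *)

(** The hard point is the description of S. Its definition controls each derivative of [f] and of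
    its transform separately, without uniformity in the order. Decay of the transform restores this
    uniformity, but only for bounds without decay in [x]; decay in [x] is known only for each
    derivative alone. Both are combined after localizing at a moving centre [c], so cut-offs and
    transform estimates need constants independent of [c]; the majorants [wt c], whose integral does
    not depend on [c], serve this purpose. Inversion enters only as an inequality,
    [trigint_sup_bound]. It comes from damping by exp (- e |x|), whose transform is the Poisson
    kernel; the one-dimensional integrals involved have elementary antiderivatives, so the
    fundamental theorem for nonnegative integrands computes them. Each product estimate costs a
    change of [m], harmless since the spaces ask for all [m]. For the density, one sequence of
    truncations serves all four inclusions; in the inductive limits the spare factor is won by
    passing from step [n] to step [n + 1]. *)

Section weight.
Context (R : realType) (w : R -> R) (hw : nonquasianalytic_weight w).

Lemma weight_le s t : 0 <= s -> s <= t -> w s <= w t.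
Proof.
move=> s0 st; apply: (weight_increasing hw) => //; rewrite in_itv /= andbT //.
exact: le_trans st.
Qed.

Lemma weight_pow2_dilate (n : nat) : exists L C : R,
  [/\ 0 <= L, 0 <= C & forall t, 0 <= t -> w (2 ^+ n * t) <= L * w t + C].
Proof.
have [K K1 hK] := weight_alpha hw; have K0 : 0 <= K := le_trans ler01 K1.
elim: n => [|n [L [C [L0 C0 h]]]].
  by exists 1, 0; split=> // t t0; rewrite expr0 !mul1r addr0.
exists (K * L), (K * (1 + C)); split.
- exact: mulr_ge0.
- by rewrite mulr_ge0// addr_ge0.
move=> t t0; rewrite exprS -mulrA; apply: le_trans (hK _ _) _.
  by rewrite mulr_ge0// exprn_ge0.
by rewrite -mulrA -mulrDr ler_wpM2l//; have := h t t0; lra.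
Qed.

(** Iterating condition (alpha) absorbs any linear change of variable. [L] is a natural number so
    that it can be multiplied into the integer indices of the seminorms. *)
Lemma weight_dilate (A : R) : exists L : nat, exists C : R,
  0 <= C /\ forall t s, 0 <= t -> 0 <= s -> s <= A * t -> w s <= L%:R * w t + C.
Proof.
have [n hn] : exists n : nat, A <= 2 ^+ n.
  exists (Num.bound A); apply: le_trans (ler_norm _) _.
  rewrite (le_trans (ltW (archi_boundP (normr_ge0 A))))// -natrX ler_nat.
  have -> : Num.bound `|A| = Num.bound A by rewrite /Num.bound normr_id.
  exact/ltnW/ltn_expl.
have [L [C [L0 C0 h]]] := weight_pow2_dilate n.
exists (Num.bound L), C; split=> // t s t0 s0 st.
apply: le_trans (weight_le s0 (le_trans st (ler_wpM2r t0 hn))) _.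
apply: le_trans (h _ t0) _; rewrite lerD2r ler_wpM2r//.
  exact: (weight_ge0 hw).
exact: ltW (archi_boundP L0).
Qed.

(** Condition (gamma), exponentiated. It lets polynomial factors be paid for by powers of exp
    (w). *)
Lemma weight_log : exists p : nat, exists C : R,
  0 < C /\ forall t, 0 <= t -> 1 + t <= C * expR (p%:R * w t).
Proof.
have [a [b [b0 h]]] := weight_gamma hw.
exists (Num.bound b^-1), (expR (- a / b)); split; first exact: expR_gt0.
move=> t t0; have t1 : 0 < 1 + t by lra.
rewrite -[leLHS](@lnK R) ?posrE// -expRD ler_expR.
have wt := weight_ge0 hw t0.
apply: (@le_trans _ _ ((w t - a) / b)).
  by rewrite ler_pdivlMr//; have := h t t0; lra.
rewrite mulrDl addrC lerD2l mulrC ler_wpM2r//.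
by apply/ltW/archi_boundP; rewrite invr_ge0 ltW.
Qed.

(* [exp (- m phi^*(k / m))], with value [0] where the Young conjugate is infinite. *)
Definition gam (m k : nat) : R :=
  fine (expeR (- (m%:R%:E * young_conj w (k%:R / m%:R)))%E).

Lemma young_conj_ge0 s : (0 <= young_conj w s)%E.
Proof.
apply: ereal_sup_ubound; exists 0 => //=.
by rewrite mulr0 expR0 (weight_normalized hw) ?subr0// ler01 lexx.
Qed.

Lemma gam_EFin m k :
  (gam m k)%:E = expeR (- (m%:R%:E * young_conj w (k%:R / m%:R)))%E.
Proof.
rewrite /gam fineK// fin_real//; apply/andP; split.
  by apply: (@lt_le_trans _ _ 0%E); rewrite ?expeR_ge0.
apply: (@le_lt_trans _ _ 1%E); rewrite ?ltry// -expeR0 lee_expeR.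
by rewrite oppe_le0 mule_ge0// ?young_conj_ge0.
Qed.

Lemma expeR_scaled_conj N (m : nat) (a : multi_index N) :
  expeR (- scaled_conj w m%:R a)%E = (gam m (mdeg a))%:E.
Proof. by rewrite gam_EFin. Qed.

Lemma gam_ge0 m k : 0 <= gam m k.
Proof. by rewrite -lee_fin gam_EFin expeR_ge0. Qed.

Lemma gam_bound m k t : (0 < m)%N -> 1 <= t ->
  gam m k * t ^+ k <= expR (m%:R * w t).
Proof.
move=> m0 t1; have t0 : 0 < t by lra.
have m0' : 0 < m%:R :> R by rewrite ltr0n.
have h : gam m k <= expR (m%:R * w t - k%:R * ln t).
  rewrite -lee_fin gam_EFin -[leRHS]/(expeR (m%:R * w t - k%:R * ln t)%:E).
  rewrite lee_expeR leeNl -EFinN opprB.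
  have -> : k%:R * ln t - m%:R * w t = m%:R * (k%:R / m%:R * ln t - w t).
    by field; rewrite gt_eqF.
  rewrite EFinM lee_pmul2l//; apply: ereal_sup_ubound; exists (ln t) => /=.
    exact: ln_ge0.
  by rewrite lnK.
apply: le_trans (ler_wpM2r _ h) _; first by rewrite exprn_ge0// ltW.
by rewrite -[in t ^+ k](@lnK R t)// -expRM_natl -expRD subrK.
Qed.

(** With [gam_bound] this characterizes [gam m k] as an infimum over [1 <= t], where [t] is the
    exponential of the variable of the conjugate. After this the Young conjugate is not unfolded
    again. *)
Lemma gam_glb m k x : (0 < m)%N -> 0 <= x ->
  (forall t, 1 <= t -> x * t ^+ k <= expR (m%:R * w t)) -> x <= gam m k.
Proof.
move=> m0; rewrite le_eqVlt => /predU1P[<- _|x0 h]; first exact: gam_ge0.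
have m0' : 0 < m%:R :> R by rewrite ltr0n.
rewrite -lee_fin gam_EFin -[x](@lnK R)// -[leLHS]/(expeR (ln x)%:E) lee_expeR.
rewrite leeNr -EFinN.
have -> : - ln x = m%:R * (- ln x / m%:R) by field; rewrite gt_eqF.
rewrite EFinM lee_pmul2l//; apply: ge_ereal_sup => _ [u /= u0 <-].
rewrite lee_fin ler_pdivlMr// mulrBl mulrAC divfK ?gt_eqF// lerBlDl.
have := h (expR u); rewrite -{1}expR0 ler_expR => /(_ u0).
rewrite -expRM_natl -[x in x * _](@lnK R)// -expRD ler_expR; lra.
Qed.

Lemma gam_le1 m k : (0 < m)%N -> gam m k <= 1.
Proof.
move=> m0; have := gam_bound k m0 (lexx 1).
by rewrite expr1n mulr1 (weight_normalized hw) ?ler01 ?lexx// mulr0 expR0.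
Qed.

Lemma gam0 m : (0 < m)%N -> gam m 0 = 1.
Proof.
move=> m0; apply/eqP; rewrite eq_le gam_le1//=; apply: gam_glb => // t t1.
rewrite expr0 mulr1 -expR0 ler_expR mulr_ge0// (weight_ge0 hw)//; lra.
Qed.

(** Apply the bound of order [j + k] at the larger of two points [t] and [u]: the powers only grow,
    and the exponential there is at most the product of both exponentials because [w] is
    nonnegative. Then take the infimum over [u] and over [t]. *)
Lemma gamD m j k : (0 < m)%N -> gam m (j + k) <= gam m j * gam m k.
Proof.
move=> m0.
have step t u : 1 <= t -> 1 <= u ->
    gam m (j + k) * t ^+ j * u ^+ k <= expR (m%:R * w t) * expR (m%:R * w u).
  move=> t1 u1; set v := Num.max t u.
  have tv : t <= v by rewrite le_max lexx.
  have uv : u <= v by rewrite le_max lexx orbT.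
  apply: (@le_trans _ _ (expR (m%:R * w v))).
    apply: le_trans (gam_bound (j + k) m0 (le_trans t1 tv)).
    rewrite -mulrA ler_wpM2l ?gam_ge0// exprD ler_pM ?exprn_ge0//; try lra.
      by rewrite lerXn2r// ?nnegrE; lra.
    by rewrite lerXn2r// ?nnegrE; lra.
  have e x : 1 <= x -> 1 <= expR (m%:R * w x).
    by move=> x1; rewrite -expR0 ler_expR mulr_ge0// (weight_ge0 hw)//; lra.
  rewrite /v /Num.max; case: ifP => _.
    by rewrite ler_peMl ?expR_ge0 ?e.
  by rewrite ler_peMr ?expR_ge0 ?e.
have step2 t : 1 <= t -> gam m (j + k) / (expR (m%:R * w t) / t ^+ j) <= gam m k.
  move=> t1; have t0 : 0 < t by lra.
  apply: gam_glb => //.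
    by rewrite !mulr_ge0 ?gam_ge0// invr_ge0 mulr_ge0 ?expR_ge0// invr_ge0 exprn_ge0// ltW.
  move=> u u1; rewrite mulrAC ler_pdivrMr; last first.
    by rewrite mulr_gt0 ?expR_gt0// invr_gt0 exprn_gt0.
  rewrite mulrA ler_pdivlMr ?exprn_gt0//.
  by rewrite mulrAC [leRHS]mulrC step.
(* [gam m k] vanishes where the conjugate is infinite; [step2] at 1 then forces [gam m (j + k)] to
   vanish too. *)
have [g0|g0] := eqVneq (gam m k) 0.
  rewrite g0 mulr0 -(mul0r (expR (m%:R * w 1) / 1 ^+ j)) -ler_pdivrMr -?g0 ?step2//.
  by rewrite g0 expr1n divr1 expR_gt0.
have gk : 0 < gam m k by rewrite lt_neqAle eq_sym g0 gam_ge0.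
rewrite -ler_pdivrMr//; apply: gam_glb => //; first by rewrite divr_ge0 ?gam_ge0.
move=> t t1; have t0 : 0 < t by lra.
have := step2 t t1; rewrite ler_pdivrMr; last first.
  by rewrite mulr_gt0 ?expR_gt0// invr_gt0 exprn_gt0.
rewrite mulrA ler_pdivlMr ?exprn_gt0// => h.
by rewrite mulrAC ler_pdivrMr// mulrC [leRHS]mulrC mulrC.
Qed.

(** Evaluating the infimum at a dilated point turns [A ^+ k] into a dilation of [w], which
    [weight_dilate] absorbs into the index. The maximum with 1 keeps the dilated point at least
    1. *)
Lemma gam_pow (A : R) (m : nat) : 0 <= A -> (0 < m)%N ->
  exists l : nat, exists C : R, [/\ (0 < l)%N, 0 <= C &
    forall k, A ^+ k * gam m k <= C * gam l k].
Proof.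
move=> A0 m0; have [L [c [c0 h]]] := weight_dilate (Num.max 1 A).
pose C := expR (m%:R * c).
have C0 : 0 < C := expR_gt0 _.
exists (m * L.+1)%N, C; split => //; rewrite ?muln_gt0 ?m0 ?ltW//.
move=> k; rewrite mulrC -ler_pdivrMl// mulrC.
have l0 : (0 < m * L.+1)%N by rewrite muln_gt0 m0.
apply: gam_glb => //.
  by rewrite mulr_ge0 ?invr_ge0 ?(ltW C0)// mulr_ge0 ?gam_ge0 ?exprn_ge0.
move=> t t1; rewrite -mulrA ler_pdivrMl// mulrAC mulrC.
apply: (@le_trans _ _ (gam m k * (Num.max 1 A * t) ^+ k)).
  rewrite ler_wpM2l ?gam_ge0// exprMn ler_wpM2r ?exprn_ge0//; first lra.
  by rewrite lerXn2r ?nnegrE ?le_max ?A0 ?lexx ?orbT// ler01.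
have t1' : 1 <= Num.max 1 A * t.
  by rewrite -[1 in leLHS]mulr1 ler_pM ?le_max ?lexx.
apply: le_trans (gam_bound k m0 t1') _.
rewrite -expRD ler_expR natrM -mulrA -mulrDr ler_wpM2l//.
have wt : 0 <= w t by apply: (weight_ge0 hw); lra.
apply: (@le_trans _ _ (L%:R * w t + c)); last by rewrite addrC lerD2l ler_wpM2r// ler_nat.
by apply: h => //; lra.
Qed.

Lemma gam_le m l k : (0 < m)%N -> (m <= l)%N -> gam m k <= gam l k.
Proof.
move=> m0 ml; apply: gam_glb (leq_trans m0 ml) (gam_ge0 _ _) _ => t t1.
apply: le_trans (gam_bound k m0 t1) _; rewrite ler_expR ler_wpM2r ?ler_nat//.
by apply: (weight_ge0 hw); lra.
Qed.

Let phi u := w (expR u).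

Let phi_convex u v1 v2 : v1 < u -> u < v2 ->
  (phi u - phi v1) * (v2 - u) <= (phi v2 - phi u) * (u - v1).
Proof.
move=> v1u uv2; have d0 : 0 < v2 - v1 by lra.
have th0 : 0 <= (v2 - u) / (v2 - v1) by rewrite divr_ge0//; lra.
have th1 : (v2 - u) / (v2 - v1) <= 1 by rewrite ler_pdivrMr// ; lra.
have := @weight_delta _ _ hw (Itv01 th0 th1) v1 v2 (in_setT _) (in_setT _).
set th := (v2 - u) / (v2 - v1).
change (w (expR (th * v1 + (1 - th) * v2)) <= th * phi v1 + (1 - th) * phi v2
  -> (phi u - phi v1) * (v2 - u) <= (phi v2 - phi u) * (u - v1)).
rewrite /th.
have -> : (v2 - u) / (v2 - v1) * v1 + (1 - (v2 - u) / (v2 - v1)) * v2 = u.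
  by field; rewrite gt_eqF.
rewrite -/(phi u) -(ler_pM2r d0).
have -> : ((v2 - u) / (v2 - v1) * phi v1 + (1 - (v2 - u) / (v2 - v1)) * phi v2) * (v2 - v1) = (v2 - u) * phi v1 + (u - v1) * phi v2.
  by field; rewrite gt_eqF.
lra.
Qed.

(** The slope is the supremum of the left chord slopes at [u], which the right chord slopes bound by
    convexity. It is nonnegative by comparison with the chord from 0, as [w] increases. *)
Let phi_subgradient u : 0 < u ->
  exists2 s, 0 <= s & forall v, 0 <= v -> phi u + s * (v - u) <= phi v.
Proof.
move=> u0; pose S := [set (phi u - phi v) / (u - v) | v in [set v | v < u]].
have S0 : S ((phi u - phi 0) / (u - 0)) by exists 0.
have ubS v2 : u < v2 -> ubound S ((phi v2 - phi u) / (v2 - u)).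
  move=> uv2 _ [v1 /= v1u <-]; rewrite ler_pdivrMr ?subr_gt0// mulrAC.
  by rewrite ler_pdivlMr ?subr_gt0// phi_convex.
have hS : has_sup S.
  split; first by exists ((phi u - phi 0) / (u - 0)).
  by exists ((phi (u + 1) - phi u) / ((u + 1) - u)); apply: ubS; lra.
exists (sup S).
  apply: le_trans (ub_le_sup hS.2 S0); rewrite subr0 divr_ge0 ?(ltW u0)//.
  by rewrite subr_ge0; apply: weight_le; rewrite ?expR_ge0// ler_expR ltW.
move=> v v0; have [vu|uv|->] := ltgtP v u; last by rewrite subrr mulr0 addr0.
  have := ub_le_sup hS.2 (ex_intro2 _ _ v vu erefl : S _).
  rewrite ler_pdivrMr ?subr_gt0//; lra.
have := ge_sup hS.1 (ubS v uv).
by rewrite ler_pdivlMr ?subr_gt0//; lra.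
Qed.

(* Fenchel-Moreau: a subgradient [s] of [phi] at [ln t], rounded down to
   [k / m], attains the supremum in the biconjugate up to the factor [t]. *)
Lemma gam_dual (l : nat) : exists m : nat, exists C : R,
  [/\ (0 < m)%N, 0 < C & forall t, 1 <= t ->
    exists k, expR (l%:R * w t) <= C * (t ^+ k * gam m k)].
Proof.
have [p [C [C0 hC]]] := weight_log.
(* The extra [p] pays, through [weight_log], for the factor [t] lost by rounding the slope. *)
exists (l + p).+1, C; split => // t; rewrite le_eqVlt => /predU1P[<-|t1].
  exists 0%N; rewrite gam0// expr0 !mulr1 (weight_normalized hw) ?ler01 ?lexx//.
  rewrite mulr0 expR0.
  have := hC 0 (lexx 0); rewrite (weight_normalized hw) ?ler01 ?lexx//.
  by rewrite mulr0 expR0; lra.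
have t0 : 0 < t by lra.
have u0 : 0 < ln t by exact: ln_gt0.
have [s s0 hs] := phi_subgradient u0.
set m := (l + p).+1; exists (Num.truncn (m%:R * s)); set k := Num.truncn _.
have := truncn_itv (mulr_ge0 (ler0n R m) s0); rewrite -/k => /andP[k1].
rewrite -natr1 => k2.
have key : expR (m%:R * w t - ln t - k%:R * ln t) <= gam m k.
  apply: gam_glb; rewrite ?expR_ge0// => x x1; have x0 : 0 < x by lra.
  rewrite -[in x ^+ k](@lnK R x)// -expRM_natl -expRD ler_expR.
  have lx := ln_ge0 x1; have := hs _ lx; rewrite /phi !lnK//.
  move=> h; have m0 : 0 <= m%:R :> R by [].
  have {}h := ler_wpM2l m0 h; apply: le_trans h.
  (* Since [k] is the integer part of [m * s], both [m * s - k] and [1 - (m * s - k)] are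
     nonnegative; the term [- ln t] in the exponent provides the 1 in the second. *)
  have : 0 <= (m%:R * s - k%:R) * ln x by rewrite mulr_ge0// subr_ge0.
  have : 0 <= (1 - (m%:R * s - k%:R)) * ln t by rewrite mulr_ge0// ?ltW//; lra.
  lra.
apply: (@le_trans _ _ (C * (t ^+ k * expR (m%:R * w t - ln t - k%:R * ln t)))).
  rewrite -[in t ^+ k](@lnK R t)// -expRM_natl -expRD.
  have -> : k%:R * ln t + (m%:R * w t - ln t - k%:R * ln t) = m%:R * w t - ln t by ring.
  rewrite expRB lnK// mulrA ler_pdivlMr//.
  have wt : 0 <= w t by apply: (weight_ge0 hw); lra.
  apply: (@le_trans _ _ (expR (l%:R * w t) * (C * expR (p%:R * w t)))).
    by rewrite ler_wpM2l ?expR_ge0//; have := hC t (ltW t0); lra.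
  rewrite mulrCA -expRD ler_wpM2l ?(ltW C0)// ler_expR -mulrDl -natrD.
  by rewrite ler_wpM2r// ler_nat.
by rewrite ler_wpM2l ?(ltW C0)// ler_wpM2l ?exprn_ge0 ?(ltW t0).
Qed.

End weight.

(** * Cut-off functions *)

Section weighted_summability.
Context (R : realType).
Implicit Types b c : nat -> R.

(** With [T n] the tail of the series, take [c n] as the inverse square root of [T n]. As [b n] is
    the difference of two consecutive tails, [c n * b n] is at most twice the difference of their
    square roots, which telescopes. *)
Lemma slowly_diverging_weights b (B : R) : (forall n, 0 < b n) ->
  (forall n, \sum_(0 <= i < n) b i <= B) ->
  exists c : nat -> R, exists C : R, [/\ forall n, 0 < c n,
    forall M, exists J, forall j, (J <= j)%N -> M <= c j &
    forall n, \sum_(0 <= i < n) c i * b i <= C].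
Proof.
move=> b0 bB; pose S n := \sum_(0 <= i < n) b i.
have Sinc : {homo S : n m / (n <= m)%N >-> n <= m}.
  apply: homo_leq => [//|y x z|n]; first exact: le_trans.
  by rewrite /S big_nat_recr//= lerDl ltW.
have cS : cvgn S.
  apply: nondecreasing_is_cvgn; first exact: Sinc.
  by exists B => _ [n _ <-]; exact: bB.
pose T n := limn S - S n.
have TS n : T n = T n.+1 + b n by rewrite /T /S big_nat_recr//=; ring.
have T0 n : 0 < T n.
  by rewrite TS ltr_wpDl// subr_ge0; exact: nondecreasing_cvgn_le.
exists (fun n => (Num.sqrt (T n))^-1), (2 * Num.sqrt (T 0)); split.
- by move=> n; rewrite invr_gt0 sqrtr_gt0.
- move=> M; pose M' := Num.max 1 M; have M'0 : 0 < M' by rewrite lt_max ltr01.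
  have e0 : 0 < (M'^-1) ^+ 2 by rewrite exprn_gt0// invr_gt0.
  have /cvgrPdist_lt /(_ _ e0) [J _ hJ] : S @ \oo --> limn S by [].
  exists J => j /hJ /=; rewrite ger0_norm ?(ltW (T0 j))// -/(T j) => h.
  apply: (@le_trans _ _ M'); first by rewrite le_max lexx orbT.
  rewrite -[M']invrK lef_pV2 ?posrE ?invr_gt0 ?sqrtr_gt0//.
  rewrite -(@ler_pXn2r _ 2)// ?nnegrE ?sqrtr_ge0 ?invr_ge0 ?(ltW M'0)//.
  by rewrite sqr_sqrtr ?(ltW (T0 _))// ltW.
- move=> n; apply: (@le_trans _ _ (2 * (Num.sqrt (T 0) - Num.sqrt (T n)))); last first.
    by rewrite ler_wpM2l// gerBl sqrtr_ge0.
  elim: n => [|n IH]; first by rewrite big_geq// subrr mulr0.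
  rewrite big_nat_recr//=; apply: le_trans (lerD IH (lexx _)) _.
  set x := Num.sqrt (T n); set y := Num.sqrt (T n.+1).
  have x0 : 0 < x by rewrite sqrtr_gt0.
  have y0 : 0 < y by rewrite sqrtr_gt0.
  have bn : b n = x ^+ 2 - y ^+ 2.
    by rewrite !sqr_sqrtr ?(ltW (T0 _))// TS; ring.
  have xy : y <= x by rewrite ler_wsqrtr// (TS n) lerDl ltW.
  suff : x^-1 * b n <= 2 * (x - y) by lra.
  rewrite ler_pdivrMl// bn.
  have : 0 <= (x - y) ^+ 2 by exact: sqr_ge0.
  lra.
Qed.

End weighted_summability.

(** * Non-quasianalyticity along powers of two *)

Section weight_sequence.
Context (R : realType) (w : R -> R) (hw : nonquasianalytic_weight w).
Local Notation mu := (@lebesgue_measure R).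

Let f (t : R) : R := w t / (1 + t ^+ 2).

Let mf : measurable_fun ([set` `[1, +oo[] : set R) f.
Proof.
apply: measurable_funM.
  apply: (@measurable_funS _ _ _ _ ([set` `[0, +oo[] : set R)) => //.
    by move=> x /=; rewrite !in_itv/= !andbT; exact: le_trans.
  by apply: subspace_continuous_measurable_fun => //; exact: weight_continuous hw.
apply: measurable_funTS; apply: continuous_measurable_fun => x.
apply: cvgV; first by rewrite gt_eqF// ltr_pwDl// sqr_ge0.
by apply: cvgD; [exact: cvg_cst|exact: exprn_continuous].
Qed.

Let f_ge0 t : 1 <= t -> 0 <= f t.
Proof.
move=> t1; rewrite divr_ge0 ?(weight_ge0 hw)//; first lra.
by rewrite addr_ge0// sqr_ge0.
Qed.

Let dyadic_le J : ((\sum_(0 <= j < J) w (2 ^+ j) / 2 ^+ j / 5)%:E <=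
  \int[mu]_(t in [set` `[1%R, (2 ^+ J)%R[]) (f t)%:E)%E.
Proof.
have p1 n : 1 <= 2 ^+ n :> R by rewrite exprn_ege1// ler1n.
have p0 n : 0 < 2 ^+ n :> R by rewrite exprn_gt0.
have m_f (D : set R) : measurable D -> D `<=` ([set` `[1%R, +oo[] : set R) ->
    measurable_fun D (EFin \o f : R -> \bar R).
  by move=> mD DD; apply/measurable_EFinP; exact: measurable_funS mf.
elim: J => [|J IH].
  rewrite big_geq//; apply: integral_ge0 => x /=.
  by rewrite in_itv /= => /andP[x1 _]; rewrite lee_fin f_ge0.
rewrite big_nat_recr//= EFinD.
rewrite (@itv_bndbnd_setU _ _ _ (BLeft (2 ^+ J : R))) ?bnd_simp//; last first.
  by rewrite ler_eXn2l// ltr1n.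
rewrite ge0_integral_setU//=; first last.
- apply/disj_setPS => x [] /=; rewrite !in_itv/= => /andP[_ h] /andP[h' _].
  by have := lt_le_trans h h'; rewrite ltxx.
- move=> x [] /=; rewrite in_itv/= => /andP[h _]; rewrite lee_fin f_ge0//.
  exact: le_trans (p1 J) h.
- apply: m_f; first by apply: measurableU.
  by move=> x [] /=; rewrite !in_itv/= => /andP[h _]; rewrite andbT// (le_trans (p1 J)).
apply: leeD => //.
(* On this dyadic interval [1 + t ^+ 2] is at most [1 + 4 * 4 ^+ J], hence at most [5 * 4 ^+ J]; its
   length [2 ^+ J] leaves the factor [1 / 5]. *)
set D := [set` _]; pose c : R := w (2 ^+ J) / (5 * 4 ^+ J).
apply: (@le_trans _ _ (\int[mu]_(t in D) (cst c%:E t))%E).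
  rewrite integral_cst /D//= lebesgue_measure_itv/= lte_fin ltr_eXn2l ?ltr1n// ltnS leqnn.
  rewrite lee_fin /c exprS (_ : 4 = 2 * 2) -?natrM// natrM exprMn.
  by rewrite le_eqVlt; apply/orP; left; apply/eqP; field; rewrite gt_eqF.
have c0 : 0 <= c.
  by rewrite divr_ge0 ?(weight_ge0 hw) ?(ltW (p0 _))// mulr_ge0// exprn_ge0.
apply: ge0_le_integral => //=.
- exact: measurable_itv.
- by apply: m_f; [exact: measurable_itv|move=> x /=; rewrite !in_itv/= => /andP[h _]; rewrite andbT (le_trans (p1 J))].
move=> x; rewrite /D/= in_itv/= => /andP[h1 h2]; rewrite lee_fin /c /f.
have x1 : 1 <= x := le_trans (p1 J) h1.
apply: ler_pM; rewrite ?(weight_ge0 hw) ?(ltW (p0 _)) ?invr_ge0 ?mulr_ge0 ?exprn_ge0//.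
  by apply: (weight_le hw) => //; exact: ltW.
have x20 : 0 <= x ^+ 2 by exact: sqr_ge0.
rewrite lef_pV2 ?posrE ?mulr_gt0 ?exprn_gt0//; last lra.
have : x ^+ 2 <= (2 ^+ J.+1) ^+ 2 by rewrite lerXn2r// ?nnegrE; lra.
have : 1 <= 4 ^+ J :> R by rewrite exprn_ege1// ler1n.
rewrite -exprM mulnC exprM (_ : 2 ^+ 2 = 4) ?exprS; last by ring.
lra.
Qed.

Lemma weight_dyadic_sum : exists B : R, forall n,
  \sum_(0 <= j < n) w (2 ^+ j) / 2 ^+ j <= B.
Proof.
have hb := weight_beta hw; set I := (\int[_]_(_ in _) _)%E in hb.
have I0 : (0 <= I)%E.
  by apply: integral_ge0 => x /=; rewrite in_itv /= andbT => x1; rewrite lee_fin f_ge0.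
have Ifin : I \is a fin_num by rewrite ge0_fin_numE.
exists (fine I * 5) => n; rewrite -ler_pdivrMr// mulr_suml -lee_fin fineK//.
apply: le_trans (dyadic_le n) _; apply: ge0_subset_integral => //=.
- exact/measurable_EFinP.
- by move=> x; rewrite in_itv /= andbT => x1; rewrite lee_fin f_ge0.
- by move=> x /=; rewrite !in_itv /= => /andP[->].
Qed.

(* [t] takes the value [2 ^ j] about [c_j * w (2 ^ j)] times, where the [c_j]
   tend to infinity so slowly that the sum of [1 / t] still converges. *)
Lemma weight_sequence : exists (t : nat -> R) (B : R),
  [/\ forall k, 1 <= t k, forall k l, (k <= l)%N -> t k <= t l,
    forall n, \sum_(0 <= k < n) (t k)^-1 <= B &
    forall m : nat, exists C, forall k, m%:R * w (t k) <= k%:R + C].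
Proof.
have p1 n : 1 <= 2 ^+ n :> R by rewrite exprn_ege1// ler1n.
have p0 n : 0 < 2 ^+ n :> R by rewrite exprn_gt0.
have wp n : 0 <= w (2 ^+ n) by rewrite (weight_ge0 hw)// ltW.
have [B0 hB0] := weight_dyadic_sum.
have geo n : \sum_(0 <= j < n) (2 ^+ j : R)^-1 <= 2.
  apply: (@le_trans _ _ (2 - 2 * (2 ^+ n)^-1)); last first.
    by rewrite gerBl mulr_ge0// invr_ge0 ltW.
  elim: n => [|n IH]; first by rewrite big_geq// expr0 invr1 mulr1 subrr.
  rewrite big_nat_recr//=; apply: le_trans (lerD IH (lexx _)) _.
  rewrite exprS invfM; have : 0 < (2 ^+ n : R)^-1 by rewrite invr_gt0.
  lra.
(* The added 1 makes [b] positive although [w 1 = 0]; it costs a geometric series, at most 2. *)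
pose b j := (w (2 ^+ j) + 1) / 2 ^+ j.
have b0 n : 0 < b n by rewrite divr_gt0// ltr_wpDl.
have [|c [C [c0 cM cb]]] := @slowly_diverging_weights _ b (B0 + 2) b0.
  move=> n; apply: le_trans (lerD (hB0 n) (geo n)).
  by rewrite -big_split/=; apply: ler_sum => i _; rewrite /b mulrDl mul1r.
(* The number of indices [k] at which the sequence takes the value [2 ^+ j]; the successor makes
   every block nonempty. *)
pose q j := (Num.truncn (c j * (w (2 ^+ j) + 1))).+1.
have q1 j : c j * (w (2 ^+ j) + 1) <= (q j)%:R.
  have h : 0 <= c j * (w (2 ^+ j) + 1) by rewrite mulr_ge0 ?(ltW (c0 j))// addr_ge0.
  by have /andP[_ /ltW] := truncn_itv h.
have q2 j : (q j)%:R <= c j * (w (2 ^+ j) + 1) + 1.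
  have h : 0 <= c j * (w (2 ^+ j) + 1) by rewrite mulr_ge0 ?(ltW (c0 j))// addr_ge0.
  by have /andP[h1 _] := truncn_itv h; rewrite /q -natr1 lerD2r.
(* The first index of block [j]. Below, [jj k] is the block that contains [k]. *)
pose Q j := (\sum_(0 <= i < j) q i)%N.
have QS j : Q j.+1 = (Q j + q j)%N by rewrite /Q big_nat_recr.
have Qinc : {homo Q : i j / (i <= j)%N}.
  apply: homo_leq => [//|y x z|n]; first exact: leq_trans.
  by rewrite QS leq_addr.
have Qj j : (j <= Q j)%N by elim: j => // j IH; rewrite QS -addn1 leq_add.
have exj k : exists j, (k < Q j.+1)%N by exists k; exact: Qj.
pose jj k := ex_minn (exj k).
have jj1 k : (k < Q (jj k).+1)%N by rewrite /jj; case: ex_minnP.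
have jj2 k j : (k < Q j.+1)%N -> (jj k <= j)%N.
  by rewrite /jj; case: ex_minnP => m _ h /h.
have jj3 k : (Q (jj k) <= k)%N.
  have [->|j0] := posnP (jj k); first by rewrite /Q big_geq.
  rewrite leqNgt; apply/negP => h.
  by have := @jj2 k (jj k).-1; rewrite prednK// => /(_ h); rewrite -ltnS prednK// ltnn.
exists (fun k => 2 ^+ jj k), (C + 2); split.
- by move=> k; exact: p1.
- move=> k l kl; rewrite ler_weXn2l ?ler1n//; apply: jj2.
  exact: leq_ltn_trans kl (jj1 l).
(* Since [n <= Q n], the sum may be completed to whole blocks; block [j] contributes [q j / 2 ^+ j],
   at most [c j * b j] plus a geometric term. *)
- move=> n; apply: (@le_trans _ _ (\sum_(0 <= k < Q n) (2 ^+ jj k : R)^-1)).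
    rewrite (big_cat_nat (leq0n n) (Qj n))/= lerDl sumr_ge0// => i _.
  apply: le_trans (lerD (cb n) (geo n)); rewrite -big_split/=.
  elim: n => [|n IH]; first by rewrite /Q big_geq// big_geq.
  rewrite (big_cat_nat (leq0n (Q n)) (Qinc _ _ (leqnSn n)))/= big_nat_recr//=.
  apply: lerD => //.
  have -> : \sum_(Q n <= i < Q n.+1) (2 ^+ jj i : R)^-1 = \sum_(Q n <= i < Q n.+1) (2 ^+ n : R)^-1.
    apply: eq_big_nat => i /andP[i1 i2]; congr (_ ^+ _)^-1; apply/eqP.
    rewrite eqn_leq jj2//= leqNgt; apply/negP => h.
    have := leq_trans (jj1 i) (Qinc _ _ h); rewrite ltnNge i1//.
  rewrite big_const_nat iter_addr_0 QS addKn -[X in X <= _]mulr_natl.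
  apply: (@le_trans _ _ ((c n * (w (2 ^+ n) + 1) + 1) / 2 ^+ n)); last first.
    by rewrite /b le_eqVlt; apply/orP; left; apply/eqP; ring.
  by rewrite ler_wpM2r ?invr_ge0 ?(ltW (p0 _)).
(* Beyond block [J], the index [k] is at least the length of the preceding block, hence at least
   [m * K] times [w] at the preceding power of two; condition (alpha) passes to the current power.
   The blocks up to [J] only add a constant. *)
- move=> m; have [K K1 hK] := weight_alpha hw.
  have K0 : 0 < K by apply: lt_le_trans K1.
  have [J hJ] := cM (m%:R * K).
  exists (m%:R * K + m%:R * w (2 ^+ J)) => k.
  have [jJ|Jj] := leqP (jj k) J.
    apply: (@le_trans _ _ (m%:R * w (2 ^+ J))).
      rewrite ler_wpM2l// (weight_le hw) ?(ltW (p0 _))// ler_weXn2l ?ler1n//.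
    by rewrite addrA lerDr addr_ge0// mulr_ge0// ltW.
  have j0 : (0 < jj k)%N by exact: leq_ltn_trans Jj.
  have k1 : c (jj k).-1 * w (2 ^+ (jj k).-1) <= k%:R.
    apply: (@le_trans _ _ (Q (jj k))%:R); last by rewrite ler_nat.
    rewrite -[in Q _](prednK j0) QS natrD; apply: le_trans (_ : (q (jj k).-1)%:R <= _).
      apply: le_trans (q1 _); rewrite ler_wpM2l ?(ltW (c0 _))// lerDl//.
    by rewrite lerDr.
  have wk : w (2 ^+ jj k) <= K * (1 + w (2 ^+ (jj k).-1)).
    by rewrite -[in w _](prednK j0) exprS; apply: hK; exact: ltW.
  have cJ : m%:R * K <= c (jj k).-1 by apply: hJ; rewrite -ltnS prednK.
  have h1 := ler_wpM2l (ler0n R m) wk.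
  have h2 := ler_wpM2r (wp (jj k).-1) cJ.
  have h3 : 0 <= m%:R * w (2 ^+ J) by rewrite mulr_ge0.
  by apply: le_trans h1 _; move: h2 k1 h3; rewrite mulrDr mulr1 mulrDr mulrA; lra.
Qed.

End weight_sequence.

(** * Infinite convolution of uniform densities *)

Section smooth_cutoff.
Context (R : realType).
Local Notation mu := (@lebesgue_measure R).
Implicit Types (g h : R -> R) (a x y : R).

(** A class stable under averaging over [[x - a, x]]: the Lipschitz constant survives, and so does
    the left edge -3, because such averages look only to the left. The vanishing makes the primitive
    from -oo meaningful. *)
Definition shift_class g :=
  (forall x y, `|g x - g y| <= `|x - y|) /\ (forall x, x < -3 -> g x = 0).

Let prim g x : R := (\int[mu]_(t in [set` `]-oo, x]]) g t)%R.

Lemma shift_class_continuous g : shift_class g -> continuous g.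
Proof.
move=> [gL _] x; apply/cvgrPdist_le => e e0; near=> y.
by apply: le_trans (gL x y) _; near: y; apply: cvgr_dist_le.
Unshelve. all: by end_near. Qed.

Let prim_derive g x : shift_class g -> is_derive x 1 (prim g) (g x).
Proof.
move=> gS; have cg := shift_class_continuous gS.
have ig : mu.-integrable ([set` `]-oo, x + 1]] : set R) (EFin \o g).
  pose D : set R := [set` `[- 3, x + 1]].
  have mD : measurable D by exact: measurable_itv.
  apply: (@eq_integrable _ _ _ mu _ _ ((EFin \o g) \_ D)) => //.
    move=> y; rewrite inE/= in_itv/= => yx; rewrite patchE.
    case: ifPn => // /negP yD; rewrite gS.2//.
    by rewrite ltNge; apply/negP => h; apply: yD; rewrite inE /D/= in_itv/= h.
  apply/integrable_restrict => //=.
  apply: (@integrableS _ _ _ mu D) => //; first exact: measurableI.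
  apply: continuous_compact_integrable; first exact: segment_compact.
  exact: continuous_subspaceT.
have [d1 d2] := @continuous_FTC1 R g -oo%O x (x + 1) ltac:(by rewrite ltrDl) ig ltac:(by rewrite ltNyr) (cg x).
by apply: DeriveDef; [exact: d1|rewrite -derive1E].
Qed.

(** The convolution of [g] with the uniform density on [[0, a]]. *)
Definition avg a g x := (prim g x - prim g (x - a)) / a.

Let is_derive_shift (F : R -> R) c x l : is_derive (x + c) 1 F l ->
  is_derive x 1 (fun s => F (s + c)) l.
Proof.
move=> dF; rewrite -[l]mulr1 -[l * 1]/(l *: 1).
have := @is_derive1_comp _ F (fun s => s + c) x l 1.
rewrite /comp; apply => //.
have h : is_derive x (1 : R) (id + cst c) (1 + 0) :=
  is_deriveD (is_derive_id _ _) (is_derive_cst _ _ _).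
by rewrite addr0 in h.
Qed.

Lemma avg_derive a g x : shift_class g ->
  is_derive x 1 (avg a g) ((g x - g (x - a)) / a).
Proof.
move=> gS; have d1 := prim_derive x gS.
have d2 := is_derive_shift (prim_derive (x - a) gS).
rewrite /avg mulrC.
have -> : (fun x => (prim g x - prim g (x - a)) / a) =
  a^-1 \*: (prim g - (fun s => prim g (s + - a))).
  by apply/funext => s; rewrite /= mulrC.
exact: is_deriveZ.
Qed.

(** The mean value theorem is applied to the difference of two primitives, so that one [c] serves
    both functions. With [h = 0] it locates values of an average, with [g = h] it preserves the
    Lipschitz constant, with [x = y] it shows that averaging is nonexpansive. *)
Lemma avg_mean_value a g h x y : 0 < a -> shift_class g -> shift_class h ->
  exists2 c, 0 < c < a & avg a g x - avg a h y = g (x - c) - h (y - c).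
Proof.
move=> a0 gS hS.
pose G s := prim g (s + (x - a)) - prim h (s + (y - a)).
have dG (s : R) : is_derive s (1 : R) G (g (s + (x - a)) - h (s + (y - a))).
  by apply: is_deriveB; apply: is_derive_shift; exact: prim_derive.
have [|c cI Gc] := MVT a0 (fun s _ => dG s).
  by apply: derivable_within_continuous => s _; case: (dG s).
exists (a - c); first by move: cI; rewrite in_itv/=; lra.
have an : a != 0 by rewrite gt_eqF.
rewrite /avg -mulrBl; apply: (mulIf an); rewrite divfK//.
have -> : x - (a - c) = c + (x - a) by ring.
have -> : y - (a - c) = c + (y - a) by ring.
rewrite subr0 in Gc; rewrite -Gc /G !add0r (addrC a) subrK (addrC a) subrK; ring.
Qed.

Let prim0 x : prim (fun=> 0) x = 0.
Proof. by rewrite /prim /Rintegral integral0. Qed.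

Lemma shift_class0 : shift_class (fun=> 0).
Proof. by split=> // x y; rewrite subrr normr0. Qed.

Lemma avg_value a g x : 0 < a -> shift_class g ->
  exists2 c, 0 < c < a & avg a g x = g (x - c).
Proof.
move=> a0 gS; have [c c0] := avg_mean_value x x a0 gS shift_class0.
by rewrite /avg !prim0 subrr mul0r !subr0; exists c.
Qed.

Lemma shift_class_avg a g : 0 < a -> shift_class g -> shift_class (avg a g).
Proof.
move=> a0 gS; split=> [x y|x x3].
  have [c _ ->] := avg_mean_value x y a0 gS gS.
  by apply: le_trans (gS.1 _ _) _; rewrite opprB addrA subrK.
have [c /andP[c0 _] ->] := avg_value x a0 gS; apply: gS.2; lra.
Qed.

Let trap x : R := Num.max 0 (Num.min 1 (3 - `|x|)).

Let clamp_lipschitz (u v : R) :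
  `|Num.max 0 (Num.min 1 u) - Num.max 0 (Num.min 1 v)| <= `|u - v|.
Proof.
have [u1 u2] : u - v <= `|u - v| /\ v - u <= `|u - v|.
  by split; rewrite ?ler_norm// -normrN opprB ler_norm.
have n0 : 0 <= `|u - v| by [].
set d := `|u - v| in u1 u2 n0 *.
have [a1|a1] := leP 1 u; have [a2|a2] := leP 1 v; rewrite ?(max_r ler01) ?subrr ?normr0//;
  have [a3|a3] := leP 0 u; have [a4|a4] := leP 0 v; rewrite ?subrr ?normr0// ler_norml; lra.
Qed.

Let shift_class_trap : shift_class trap.
Proof.
split=> [x y|x x3].
  apply: le_trans (clamp_lipschitz _ _) _.
  by rewrite opprB addrC addrA subrK distrC; exact: ler_dist_dist.
by rewrite /trap ltr0_norm; [rewrite max_l// ge_min; apply/orP; right; lra|lra].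
Qed.

Context (a : nat -> R) (a0 : forall n, 0 < a n)
  (a1 : forall n, \sum_(0 <= i < n) a i <= 1).

(* The limit [L n] of [iter_avg n k] in [k] is the convolution of [trap] with the
   uniform densities on the intervals [[0, a i]], [n <= i].  Its derivative is a
   difference quotient of [L n.+1]. *)
Fixpoint iter_avg (n k : nat) : R -> R :=
  if k is k'.+1 then avg (a n) (iter_avg n.+1 k') else trap.

Let S n := \sum_(0 <= i < n) a i.

Let S_le m n : (m <= n)%N -> S m <= S n.
Proof.
move=> mn; rewrite /S (big_cat_nat (leq0n m) mn)/= lerDl sumr_ge0// => i _.
exact: ltW.
Qed.

Let S_ge0 n : 0 <= S n.
Proof. by apply: sumr_ge0 => i _; exact: ltW. Qed.

Let cS : cvgn S.
Proof.
apply: nondecreasing_is_cvgn; first exact: S_le.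
by exists 1 => _ [n _ <-]; exact: a1.
Qed.

Let tau n := limn S - S n.

Let cvg_tau : tau @ \oo --> 0.
Proof. by rewrite -(subrr (limn S)); apply: cvgB => //; exact: cvg_cst. Qed.

Let iter_avg_class n k : shift_class (iter_avg n k).
Proof.
by elim: k n => [|k IH] n /=; [exact: shift_class_trap|exact: shift_class_avg].
Qed.

(** The new average is the innermost one. It moves the Lipschitz function [trap] by at most its
    width, and the outer averages are nonexpansive. *)
Let iter_avg_step n k x : `|iter_avg n k.+1 x - iter_avg n k x| <= a (n + k)%N.
Proof.
elim: k n x => [|k IH] n x.
  have [c /andP[c0 ca] /= ->] := avg_value x (a0 n) shift_class_trap.
  apply: le_trans (shift_class_trap.1 _ _) _.
  by rewrite addn0 addrAC subrr add0r normrN gtr0_norm// ltW.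
have [c _ ->] := avg_mean_value x x (a0 n) (iter_avg_class n.+1 k.+1) (iter_avg_class n.+1 k).
by rewrite -addSnnS; exact: IH.
Qed.

Let iter_avg_dist n k j x :
  `|iter_avg n (k + j) x - iter_avg n k x| <= S (n + k + j)%N - S (n + k)%N.
Proof.
elim: j => [|j IH]; first by rewrite !addn0 !subrr normr0.
rewrite !addnS; apply: le_trans (ler_distD (iter_avg n (k + j) x) _ _) _.
apply: le_trans (lerD (iter_avg_step _ _ _) IH) _.
by rewrite /S big_nat_recr//= addnA; lra.
Qed.

Let trap01 x : 0 <= trap x <= 1.
Proof. by rewrite /trap le_max lexx/= ge_max ler01 ge_min lexx. Qed.

Let iter_avg01 n k x : 0 <= iter_avg n k x <= 1.
Proof.
elim: k n x => [|k IH] n x /=; first exact: trap01.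
by have [c _ ->] := avg_value x (a0 n) (iter_avg_class n.+1 k).
Qed.

(** By [iter_avg_step], adding the convergent [S (n + k)] makes the sequence nondecreasing, and it
    stays below 2. *)
Let cvg_iter_avg n x : cvgn (fun k => iter_avg n k x).
Proof.
have -> : (fun k => iter_avg n k x) =
    (fun k => (iter_avg n k x + S (n + k)%N) - S (n + k)%N).
  by apply/funext => k; rewrite addrK.
apply: is_cvgB; last first.
  under eq_fun do rewrite addnC; apply/cvg_ex; exists (limn S).
  by rewrite cvg_shiftn; exact: cS.
apply: nondecreasing_is_cvgn.
  apply/nondecreasing_seqP => k.
  have := iter_avg_step n k x; rewrite ler_norml addnS /S big_nat_recr//= => /andP[].
  lra.
exists 2 => _ [k _ <-]; have /andP[_ h] := iter_avg01 n k x.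
by have := a1 (n + k)%N; rewrite /S; lra.
Qed.

Let L n x := limn (fun k => iter_avg n k x).

Let L_dist n k x : `|L n x - iter_avg n k x| <= tau (n + k)%N.
Proof.
have h : (fun j => `|iter_avg n j x - iter_avg n k x|) @ \oo -->
    `|L n x - iter_avg n k x|.
  by apply: cvg_norm; apply: cvgB; [exact: cvg_iter_avg|exact: cvg_cst].
rewrite -(cvg_lim _ h)//; apply: limr_le; first by apply/cvg_ex; eexists; exact: h.
exists k => // j /= kj; rewrite -(subnKC kj).
apply: le_trans (iter_avg_dist _ _ _ _) _; rewrite /tau lerD2r.
by apply: nondecreasing_cvgn_le => //; exact: S_le.
Qed.

Let L_class n : shift_class (L n).
Proof.
split=> [x y|x x3].
  have h : (fun j => `|iter_avg n j x - iter_avg n j y|) @ \oo --> `|L n x - L n y|.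
    by apply: cvg_norm; apply: cvgB; exact: cvg_iter_avg.
  rewrite -(cvg_lim _ h)//; apply: limr_le; first by apply/cvg_ex; eexists; exact: h.
  by near=> j; exact: (iter_avg_class n j).1.
rewrite /L (_ : (fun k => _) = fun=> 0) ?lim_cst//.
by apply/funext => k; exact: (iter_avg_class n k).2.
Unshelve. all: by end_near. Qed.

(** The bound [L_dist] is uniform in [x], so both sides are close to [iter_avg n k.+1] for large
    [k]. The identity makes the limit differentiable without any convergence of derivatives. *)
Let avg_L n x : avg (a n) (L n.+1) x = L n x.
Proof.
apply/eqP; rewrite -subr_eq0 -normr_le0; apply/ler_addgt0Pl => e e0.
have e2 : 0 < e / 2 by rewrite divr_gt0.
have /cvgrPdist_lt /(_ _ e2) [k _ /(_ (n.+1 + k)%N (leq_addl _ _))/=] := cvg_tau.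
rewrite sub0r normrN => /(le_lt_trans (ler_norm _)) tk.
apply: le_trans (ler_distD (iter_avg n k.+1 x) _ _) _.
rewrite addr0 (splitr e); apply: lerD.
  have [c _ /= ->] := avg_mean_value x x (a0 n) (L_class n.+1) (iter_avg_class n.+1 k).
  by apply: le_trans (L_dist _ _ _) _; exact: ltW.
rewrite distrC; apply: le_trans (L_dist _ _ _) _.
by rewrite addnS -addSn ltW.
Qed.

Let delta k g x := (g x - g (x - a k)) / a k.

Let L_derive n x : is_derive x 1 (L n) (delta n (L n.+1) x).
Proof.
have -> : L n = avg (a n) (L n.+1) by apply/funext => y; rewrite avg_L.
exact: avg_derive.
Qed.

(** The newest quotient is applied innermost: differentiating [L k] inside [iter_delta k] then gives
    exactly [iter_delta k.+1 (L k.+1)]. *)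
Fixpoint iter_delta k g : R -> R :=
  if k is k'.+1 then iter_delta k' (delta k' g) else g.

Let iter_delta_derive k g h : (forall x, is_derive x 1 g (h x)) ->
  forall x, is_derive x 1 (iter_delta k g) (iter_delta k h x).
Proof.
elim: k g h => [|k IH] g h dg x; first exact: dg.
change (is_derive x 1 (iter_delta k (delta k g)) (iter_delta k (delta k h) x)).
apply: IH => y.
have d2 := is_derive_shift (dg (y - a k)).
have -> : delta k g = (a k)^-1 \*: (g - (fun s => g (s + - a k))).
  by apply/funext => s; rewrite /delta /= mulrC.
rewrite /delta mulrC; exact: is_deriveZ.
Qed.

Let iter_delta_bound k g (M : R) : 0 <= M -> (forall x, `|g x| <= M) ->
  forall x, `|iter_delta k g x| <= (\prod_(0 <= i < k) (2 / a i)) * M.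
Proof.
elim: k g M => [|k IH] g M M0 gM x /=; first by rewrite big_geq// mul1r.
rewrite big_nat_recr//= -mulrA; apply: IH.
  by rewrite mulr_ge0// divr_ge0// ltW.
move=> y; rewrite /delta normrM normfV (gtr0_norm (a0 k)) mulrAC ler_pM2r ?invr_gt0//.
apply: le_trans (ler_normB _ _) _; have := gM y; have := gM (y - a k); lra.
Qed.

(** An average over [[x - a, x]] keeps the right end of the plateau and moves its left end by at
    most the width [a]. *)
Let iter_avg_plateau n k x : -2 + (S (n + k)%N - S n) <= x <= 2 -> iter_avg n k x = 1.
Proof.
elim: k n x => [|k IH] n x.
  rewrite addn0 subrr addr0 => h /=.
  have : `|x| <= 2 by rewrite ler_norml.
  by move=> h'; rewrite /trap min_l ?max_r//; lra.
have [c /andP[c0 ca] /= ->] := avg_value x (a0 n) (iter_avg_class n.+1 k).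
move=> h; apply: IH; move: h.
rewrite addSnnS (_ : S n.+1 = S n + a n); first lra.
by rewrite /S big_nat_recr.
Qed.

Let iter_avg_right n k x : 3 + (S (n + k)%N - S n) <= x -> iter_avg n k x = 0.
Proof.
elim: k n x => [|k IH] n x.
  rewrite addn0 subrr addr0 => h /=.
  by rewrite /trap gtr0_norm; [rewrite max_l// ge_min; apply/orP; right; lra|lra].
have [c /andP[c0 ca] /= ->] := avg_value x (a0 n) (iter_avg_class n.+1 k).
move=> h; apply: IH; move: h.
rewrite addSnnS (_ : S n.+1 = S n + a n); first lra.
by rewrite /S big_nat_recr.
Qed.

(** [theta k] is the [k]-th derivative of the infinite convolution [L 0]: a composition of [k]
    difference quotients, each of norm at most [2 / a i], applied to [L k], which takes values in
    [[0, 1]]. The total shift is at most 1, so the plateau still contains [[-1, 1]] and the support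
    lies in [[-3, 4]]. *)
Lemma smooth_cutoff_exists : exists theta : nat -> R -> R,
  [/\ forall k x, is_derive x 1 (theta k) (theta k.+1 x),
     forall k x, `|theta k x| <= \prod_(0 <= i < k) (2 / a i),
     forall x, `|x| <= 1 -> theta 0 x = 1 &
     forall x, 5 <= `|x| -> theta 0 x = 0].
Proof.
exists (fun k => iter_delta k (L k)); split.
- by move=> k x; apply: (@iter_delta_derive k (L k) (delta k (L k.+1))) => y; exact: L_derive.
- move=> k x; rewrite -[leRHS]mulr1; apply: iter_delta_bound => // y.
  have cn : (fun j => `|iter_avg k j y|) @ \oo --> `|L k y|.
    by apply: cvg_norm; exact: cvg_iter_avg.
  rewrite -(cvg_lim _ cn)//; apply: limr_le; first by apply/cvg_ex; eexists; exact: cn.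
  by near=> j; have /andP[h1 h2] := iter_avg01 k j y; rewrite ger0_norm.
- move=> x; rewrite ler_norml => /andP[x1 x2] /=; rewrite /L.
  rewrite (_ : (fun k => _) = fun=> 1) ?lim_cst//.
  apply/funext => k; apply: iter_avg_plateau; have := a1 k; rewrite -/(S k) add0n.
  by have := S_ge0 0; lra.
- move=> x; rewrite ler_normr => /orP[x5|x5] /=; last first.
    by apply: (L_class 0).2; lra.
  rewrite /L (_ : (fun k => _) = fun=> 0) ?lim_cst//.
  apply/funext => k; apply: iter_avg_right; have := a1 k; rewrite -/(S k) add0n.
  by have := S_ge0 0; lra.
Unshelve. all: by end_near. Qed.

End smooth_cutoff.

Section weight_cutoff.
Context (R : realType) (w : R -> R) (hw : nonquasianalytic_weight w).

(** The widths are inversely proportional to the sequence of [weight_sequence], scaled to total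
    length at most 1. The derivative bounds [M] are products of increasing factors, which gives the
    supermultiplicativity. *)
Lemma weight_cutoff : exists (theta : nat -> R -> R) (M : nat -> R),
  [/\ forall k (x : R), is_derive x (1 : R) (theta k) (theta k.+1 x),
     forall x, `|x| <= 1 -> theta 0 x = 1,
     forall x, 5 <= `|x| -> theta 0 x = 0,
     forall k x, `|theta k x| <= M k &
     [/\ M 0 = 1, forall k, 0 < M k, forall j k, M j * M k <= M (j + k)%N &
       forall m, (0 < m)%N -> exists C, forall k, M k * gam w m k <= C]].
Proof.
have [t [B [t1 tinc tB tw]]] := weight_sequence hw.
pose B' := Num.max 1 B; have B'0 : 0 < B' by rewrite lt_max ltr01.
have t0 k : 0 < t k by apply: lt_le_trans (t1 k).
pose a k := (B' * t k)^-1; have a0 k : 0 < a k by rewrite invr_gt0 mulr_gt0.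
have a1 n : \sum_(0 <= i < n) a i <= 1.
  under eq_bigr do rewrite /a invfM.
  rewrite -mulr_sumr ler_pdivrMl// mulr1; apply: le_trans (tB n) _.
  by rewrite le_max lexx orbT.
have [theta [th1 th2 th3 th4]] := smooth_cutoff_exists a0 a1.
pose M k := \prod_(0 <= i < k) (2 / a i).
have f0 i : 0 < 2 / a i by rewrite divr_gt0.
have MS k : M k.+1 = M k * (2 / a k) by rewrite /M big_nat_recr.
have M0 k : 0 < M k by rewrite /M prodr_gt0.
exists theta, M; split => //; split => //; first by rewrite /M big_geq.
  move=> j k; elim: k => [|k IH]; first by rewrite addn0 /M [X in _ * X]big_geq// mulr1.
  have ak : 2 / a k <= 2 / a (j + k)%N.
    by rewrite /a !invrK ler_pM2l// ler_pM2l// tinc// leq_addl.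
  rewrite addnS !MS [M j * _]mulrA; apply: ler_pM.
  - exact: mulr_ge0 (ltW (M0 _)) (ltW (M0 _)).
  - exact: ltW (f0 k).
  - exact: IH.
  - exact: ak.
(* [2 * B'] comes from the factors of [M k], and [expR 1] from the bound of [l * w (t k)] by [k]
   plus a constant; [gam_pow] absorbs both powers. *)
move=> m m0; pose A := 2 * B' * expR 1.
have A0 : 0 < A by rewrite !mulr_gt0 ?expR_gt0.
have [l [C [l0 C0 hl]]] := gam_pow hw (ltW A0) m0.
have [D hD] := tw l; exists (C * expR D) => k.
have Ak : 0 < A ^+ k by rewrite exprn_gt0.
have tk : 0 < t k ^+ k by rewrite exprn_gt0.
have Mk : M k <= (2 * B') ^+ k * t k ^+ k.
  rewrite -exprMn /M -[k in _ ^+ k]subn0 -prodr_const_nat big_seq_cond [leRHS]big_seq_cond.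
  apply: ler_prod => i; rewrite andbT mem_index_iota => /andP[_ ik].
  by rewrite (ltW (f0 i))/= /a invrK mulrA ler_pM2l ?mulr_gt0// tinc// ltnW.
have gl : gam w l k * t k ^+ k <= expR 1 ^+ k * expR D.
  apply: le_trans (gam_bound hw k l0 (t1 k)) _.
  by rewrite -expRM_natl -expRD ler_expR mulr1.
have {}hl : gam w m k <= C * gam w l k / A ^+ k by rewrite ler_pdivlMr// mulrC.
apply: (@le_trans _ _ ((2 * B') ^+ k * t k ^+ k * (C * gam w l k / A ^+ k))).
  by rewrite ler_pM ?gam_ge0// ltW.
rewrite mulrA ler_pdivrMr//.
have -> : (2 * B') ^+ k * t k ^+ k * (C * gam w l k) =
  C * ((2 * B') ^+ k * (gam w l k * t k ^+ k)) by ring.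
have -> : C * expR D * A ^+ k = C * ((2 * B') ^+ k * (expR 1 ^+ k * expR D)).
  by rewrite /A exprMn; ring.
apply: ler_wpM2l => //; apply: ler_wpM2l gl.
by apply/exprn_ge0/mulr_ge0 => //; exact: ltW.
Qed.

End weight_cutoff.

(** * Iterated derivatives *)

Section calculus.
Context (R : realType) (N : nat).
Local Notation V := 'rV[R]_N.
Implicit Types (f g : V -> R) (i : 'I_N) (s : seq 'I_N) (x : V).
Local Notation "''d_' i f" := ('D_(unit_vec R i) f) (at level 10, i at level 2, f at level 9).

Lemma CkW k f : Ck k.+1 f -> Ck k f.
Proof.
elim: k f => [|k IH] f; first by case.
by case=> cf h; split=> // i; have [h1 h2] := h i; split=> //; exact: IH.
Qed.

Lemma partialD i f g : (forall x, derivable f x (unit_vec R i)) ->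
  (forall x, derivable g x (unit_vec R i)) ->
  'd_i (fun x => f x + g x) = (fun x => 'd_i f x + 'd_i g x).
Proof. by move=> df dg; apply/funext => x; exact: deriveD. Qed.

Lemma partialM i f g : (forall x, derivable f x (unit_vec R i)) ->
  (forall x, derivable g x (unit_vec R i)) ->
  'd_i (fun x => f x * g x) = (fun x => 'd_i f x * g x + f x * 'd_i g x).
Proof.
move=> df dg; apply/funext => x.
by rewrite (@deriveM _ _ f g x)// addrC mulrC.
Qed.

Lemma Ck_cst k (c : R) : Ck k (fun _ : V => c).
Proof.
elim: k c => [|k IH] c /=; first exact: cst_continuous.
split; first exact: cst_continuous.
move=> i; split=> [x|]; first exact: derivable_cst.
rewrite (_ : 'd_i (fun=> c) = fun=> 0); first exact: IH.
by apply/funext => x; exact: derive_cst.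
Qed.

Lemma CkD k f g : Ck k f -> Ck k g -> Ck k (fun x => f x + g x).
Proof.
elim: k f g => [|k IH] f g.
  by rewrite /= => cf cg x; exact: cvgD (cf x) (cg x).
case=> cf df [cg dg]; split; first by move=> x; exact: cvgD (cf x) (cg x).
move=> i; have [df1 df2] := df i; have [dg1 dg2] := dg i.
split=> [x|]; first exact: derivableD.
by rewrite partialD//; exact: IH.
Qed.

Lemma CkM k f g : Ck k f -> Ck k g -> Ck k (fun x => f x * g x).
Proof.
elim: k f g => [|k IH] f g.
  by rewrite /= => cf cg x; exact: cvgM (cf x) (cg x).
move=> Hf Hg; have Hf' := CkW Hf; have Hg' := CkW Hg.
case: Hf Hg => cf df [cg dg].
split; first by move=> x; exact: cvgM (cf x) (cg x).
move=> i; have [df1 df2] := df i; have [dg1 dg2] := dg i.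
split=> [x|]; first exact: derivableM.
by rewrite partialM//; apply: CkD; exact: IH.
Qed.

Lemma is_derive_coord i j x :
  is_derive x (unit_vec R i) (fun x : V => x 0 j) (i == j)%:R.
Proof.
have h (t : R) : t != 0 -> t^-1 * ((t *: unit_vec R i + x) 0 j - x 0 j) = (i == j)%:R.
  by move=> t0; rewrite !mxE addrK mulrA mulVf// mul1r eqxx/= eq_sym.
have c : (fun t : R => t^-1 *: ((fun x : V => x 0 j) (t *: unit_vec R i + x) - x 0 j)) @ 0^' -->
    ((i == j)%:R : R^o).
  apply: cvg_near_cst.
  near=> t; rewrite -[LHS]/(_ * _) h//; near: t; exact: nbhs_dnbhs_neq.
by apply: DeriveDef; [apply/cvg_ex; exists (i == j)%:R|exact/cvg_lim].
Unshelve. all: by end_near. Qed.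

Definition rsmooth f := forall k, Ck k f.

Lemma rsmooth_continuous f : rsmooth f -> continuous f.
Proof. by move=> /(_ 0). Qed.

Lemma rsmooth_derivable f i x : rsmooth f -> derivable f x (unit_vec R i).
Proof. by move=> /(_ 1)[_ /(_ i)[]]. Qed.

Lemma rsmooth_partial f i : rsmooth f -> rsmooth ('d_i f).
Proof. by move=> fs k; have [_ /(_ i)[]] := fs k.+1. Qed.

Lemma rsmoothD f g : rsmooth f -> rsmooth g -> rsmooth (fun x => f x + g x).
Proof. by move=> fs gs k; apply: CkD. Qed.

Lemma rsmoothM f g : rsmooth f -> rsmooth g -> rsmooth (fun x => f x * g x).
Proof. by move=> fs gs k; apply: CkM. Qed.

Lemma rsmooth_cst (c : R) : rsmooth (fun=> c).
Proof. by move=> k; exact: Ck_cst. Qed.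

Lemma rsmoothN f : rsmooth f -> rsmooth (fun x => - f x).
Proof.
move=> fs; rewrite (_ : (fun x => - f x) = fun x => -1 * f x).
  by apply: rsmoothM => //; exact: rsmooth_cst.
by apply/funext => x; rewrite mulN1r.
Qed.

Lemma rsmoothP f : continuous f -> (forall i x, derivable f x (unit_vec R i)) ->
  (forall i, rsmooth ('d_i f)) -> rsmooth f.
Proof.
by move=> cf df sf [|k] //; split=> // i; split=> //; exact: sf.
Qed.

Lemma partial_coord i j : 'd_i (fun x : V => x 0 j) = fun=> (i == j)%:R.
Proof. by apply/funext => x; have [_ ->] := is_derive_coord i j x. Qed.

Lemma rsmooth_coord j : rsmooth (fun x => x 0 j).
Proof.
apply: rsmoothP.
- exact: coord_continuous.
- by move=> i x; have [] := is_derive_coord i j x.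
- by move=> i; rewrite partial_coord; exact: rsmooth_cst.
Qed.

Definition rderw s f : V -> R := foldr (fun i g => 'd_i g) f s.

Lemma rsmooth_rderw s f : rsmooth f -> rsmooth (rderw s f).
Proof. by move=> fs; elim: s => //= i s IH; exact: rsmooth_partial. Qed.

Lemma rderw_cat s1 s2 f : rderw (s1 ++ s2) f = rderw s1 (rderw s2 f).
Proof. by rewrite /rderw foldr_cat. Qed.

Lemma rderwD s f g : rsmooth f -> rsmooth g ->
  rderw s (fun x => f x + g x) = fun x => rderw s f x + rderw s g x.
Proof.
move=> fs gs; elim: s => //= i s ->.
by rewrite partialD// => x; apply/rsmooth_derivable/rsmooth_rderw.
Qed.

Lemma rderwZ s (c : R) f : rsmooth f ->
  rderw s (fun x => c * f x) = fun x => c * rderw s f x.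
Proof.
move=> fs; elim: s => //= i s ->; apply/funext => x.
by rewrite -deriveMl//; apply/rsmooth_derivable/rsmooth_rderw.
Qed.

Lemma rderwN s f : rsmooth f -> rderw s (fun x => - f x) = fun x => - rderw s f x.
Proof.
move=> fs; rewrite (_ : (fun x => - f x) = fun x => -1 * f x).
  by rewrite rderwZ//; apply/funext => x; rewrite mulN1r.
by apply/funext => x; rewrite mulN1r.
Qed.

Lemma rderw_cst s (c : R) x : `|rderw s (fun=> c) x| <= `|c|.
Proof.
suff [->|->] : rderw s (fun=> c) = (fun=> c) \/ rderw s (fun=> c) = (fun=> 0) by [|rewrite normr0].
elim: s => [|i s IH] /=; first by left.
by right; case: IH => ->; apply/funext => y; exact: derive_cst.
Qed.

Lemma rderw_local (U : set V) s f g : open U ->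
  (forall x, U x -> f x = g x) -> forall x, U x -> rderw s f x = rderw s g x.
Proof.
move=> oU fg; elim: s => [|i s IH] x Ux /=; first exact: fg.
by apply: near_eq_derive; near=> y; apply: IH; near: y; exact: open_nbhs_nbhs.
Unshelve. all: by end_near. Qed.

(** The Leibniz rule with its letters distributed one by one, hence without binomial coefficients:
    there are [2 ^ size s] terms, a factor that [gam_pow] absorbs. Both parts are subsequences, so
    they stay sorted when [s] is. *)
Fixpoint splits s : seq (seq 'I_N * seq 'I_N) :=
  if s is i :: s' then
    [seq (i :: p.1, p.2) | p <- splits s'] ++ [seq (p.1, i :: p.2) | p <- splits s']
  else [:: ([::], [::])].

Lemma size_splits s : size (splits s) = (2 ^ size s)%N.
Proof.
by elim: s => //= i s IH; rewrite size_cat !size_map IH expnS mul2n addnn.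
Qed.

Lemma splitsP s p : p \in splits s ->
  [/\ subseq p.1 s, subseq p.2 s & (size p.1 + size p.2)%N = size s].
Proof.
elim: s p => [|i s IH] p /=; first by rewrite inE => /eqP ->.
rewrite mem_cat => /orP[] /mapP[q /IH [q1 q2 q3] ->]; split.
- by rewrite /= eqxx.
- exact: subseq_trans q2 (subseq_cons s i).
- by rewrite addSn q3.
- exact: subseq_trans q1 (subseq_cons s i).
- by rewrite /= eqxx.
- by rewrite addnS q3.
Qed.

Lemma rderwM s f g : rsmooth f -> rsmooth g ->
  rderw s (fun x => f x * g x) =
  fun x => \sum_(p <- splits s) rderw p.1 f x * rderw p.2 g x.
Proof.
move=> fs gs; elim: s => [|i s IH] /=.
  by apply/funext => x; rewrite big_seq1.
have H r : rsmooth (fun x => \sum_(p <- r) rderw p.1 f x * rderw p.2 g x) /\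
    'd_i (fun x => \sum_(p <- r) rderw p.1 f x * rderw p.2 g x) =
    fun x => \sum_(p <- r) ('d_i (rderw p.1 f) x * rderw p.2 g x +
                            rderw p.1 f x * 'd_i (rderw p.2 g) x).
  elim: r => [|p r [h1 h2]].
    under eq_fun do rewrite big_nil; split; first exact: rsmooth_cst.
    by apply/funext => x; rewrite big_nil; exact: derive_cst.
  have sp : rsmooth (fun x => rderw p.1 f x * rderw p.2 g x).
    by apply: rsmoothM; exact: rsmooth_rderw.
  rewrite (_ : (fun x => \sum_(q <- p :: r) _) = fun x =>
     rderw p.1 f x * rderw p.2 g x + \sum_(q <- r) rderw q.1 f x * rderw q.2 g x); last first.
    by apply/funext => x; rewrite big_cons.
  split; first exact: rsmoothD.
  rewrite partialD; [|by move=> x; exact: rsmooth_derivable..].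
  apply/funext => x; rewrite big_cons; congr (_ + _).
    apply: (congr1 (@^~ x) (@partialM i (rderw p.1 f) (rderw p.2 g) _ _)) => y;
      exact/rsmooth_derivable/rsmooth_rderw.
  exact: (congr1 (@^~ x) h2).
rewrite IH (H _).2; apply/funext => x.
by rewrite big_cat !big_map /= -big_split.
Qed.

End calculus.

Section words.
Context (R : realType) (N : nat).
Implicit Types (a : multi_index N) (s : seq 'I_N) (f : cfun R N).

(* A multi-index is represented by the sorted word of the coordinates along which one
   differentiates. *)
Definition sortedw s := sorted (fun i j : 'I_N => (i <= j)%N) s.

Definition word a : seq 'I_N := flatten [seq nseq (a i) i | i <- enum 'I_N].

Lemma mpartial_word a f : mpartial a f = foldr (@partial R N) f (word a).
Proof.
rewrite /mpartial /word; elim: (enum 'I_N) => //= i e ->.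
by rewrite foldr_cat; elim: (a i) => //= n ->.
Qed.

Lemma Re_mpartial a f :
  (fun x => complex.Re (mpartial a f x)) = rderw (word a) (fun x => complex.Re (f x)).
Proof. by rewrite mpartial_word; elim: (word a) => //= i s ->. Qed.

Lemma Im_mpartial a f :
  (fun x => complex.Im (mpartial a f x)) = rderw (word a) (fun x => complex.Im (f x)).
Proof. by rewrite mpartial_word; elim: (word a) => //= i s ->. Qed.

Lemma size_word a : size (word a) = mdeg a.
Proof.
rewrite /word size_flatten /shape -map_comp sumnE big_map /mdeg big_enum.
by apply: eq_bigr => i _ /=; rewrite size_nseq.
Qed.

Lemma sorted_word a : sortedw (word a).
Proof.
have tr : transitive (fun i j : 'I_N => (i <= j)%N).
  by move=> y x z; exact: leq_trans.
rewrite /sortedw (sorted_pairwise tr) /word.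
have : pairwise (fun i j : 'I_N => (i <= j)%N) (enum 'I_N).
  rewrite -(sorted_pairwise tr) -[sorted _ _]/(sorted (relpre val leq) _).
  by rewrite -sorted_map val_enum_ord iota_sorted.
elim: (enum 'I_N) => //= i e IH /andP[/allP ie /IH {}IH].
rewrite pairwise_cat IH andbT; apply/andP; split.
  apply/allrelP => x y; rewrite mem_nseq => /andP[_ /eqP ->].
  by case/flattenP => _ /mapP[k ke ->]; rewrite mem_nseq => /andP[_ /eqP ->]; exact: ie.
elim: (a i) => //= n ->; rewrite andbT.
by apply/allP => x; rewrite mem_nseq => /andP[_ /eqP ->].
Qed.

Lemma word_count s : sortedw s -> word [ffun i => count_mem i s] = s.
Proof.
move=> ss; apply: (@sorted_eq _ (fun i j : 'I_N => (i <= j)%N)) => //.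
- by move=> y x z; exact: leq_trans.
- by move=> x y xy; apply/val_inj/anti_leq.
- exact: sorted_word.
apply/allP => j _; apply/eqP.
rewrite /word count_flatten -map_comp sumnE big_map big_enum/= (bigD1 j)//=.
rewrite count_nseq/= eqxx mul1n ffunE big1 ?addn0// => i ij.
by rewrite count_nseq/= (negPf ij).
Qed.

End words.

(** * Weighted bounds of all derivatives at a point *)

Section jets.
Context (R : realType) (w : R -> R) (hw : nonquasianalytic_weight w) (N : nat).
Local Notation V := 'rV[R]_N.
Local Notation normc := ComplexField.Normc.normc.
Implicit Types (u v : V -> R) (f : cfun R N) (x : V) (s : seq 'I_N).

(** The bound is taken at a single point: letting [B] depend on [x] yields the bounds behind
    [seminorm_p], [seminorm_q] and [seminorm_r], and products and localizations are treated once for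
    all of them. *)
Definition jetb (m : nat) u x (B : R) :=
  forall s, sortedw s -> `|rderw s u x| * gam w m (size s) <= B.

Lemma jetb_ge0 m u x B : jetb m u x B -> 0 <= B.
Proof. by move=> /(_ [::] isT); apply: le_trans; rewrite mulr_ge0 ?gam_ge0. Qed.

Lemma jetbW m l u x A B : (0 < m)%N -> (m <= l)%N -> A <= B ->
  jetb l u x A -> jetb m u x B.
Proof.
move=> m0 ml AB h s ss; apply: le_trans AB; apply: le_trans (h s ss).
by rewrite ler_wpM2l// gam_le.
Qed.

Lemma jetbD m u v x A B : rsmooth u -> rsmooth v ->
  jetb m u x A -> jetb m v x B -> jetb m (fun x => u x + v x) x (A + B).
Proof.
move=> us vs hu hv s ss; rewrite rderwD//.
apply: le_trans (lerD (hu s ss) (hv s ss)); rewrite -mulrDl.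
by rewrite ler_wpM2r ?gam_ge0// ler_normD.
Qed.

Lemma jetbZ m u (c : R) x A : rsmooth u -> jetb m u x A ->
  jetb m (fun x => c * u x) x (`|c| * A).
Proof.
by move=> us hu s ss; rewrite rderwZ// normrM -mulrA ler_wpM2l//; exact: hu.
Qed.

Lemma jetbN m u x A : rsmooth u -> jetb m u x A -> jetb m (fun x => - u x) x A.
Proof. by move=> us hu s ss; rewrite rderwN// normrN; exact: hu. Qed.

Lemma jetb_cst m (c : R) x : (0 < m)%N -> jetb m (fun=> c) x `|c|.
Proof.
move=> m0 s ss; rewrite -[leRHS]mulr1.
by rewrite ler_pM ?gam_ge0 ?gam_le1 ?rderw_cst.
Qed.

(** [gamD] splits the weight between the two factors of each Leibniz term, and [gam_pow] with base 2
    pays for the number of terms. *)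
Lemma jetb_mul m : (0 < m)%N -> exists (l : nat) (C : R),
  [/\ (0 < l)%N, 0 <= C & forall u v x A B, rsmooth u -> rsmooth v ->
    jetb l u x A -> jetb l v x B -> jetb m (fun x => u x * v x) x (C * A * B)].
Proof.
move=> m0; have [l [C [l0 C0 h]]] := gam_pow hw (ler0n R 2) m0.
exists l, C; split=> // u v x A B us vs hA hB s ss.
rewrite rderwM//.
have A0 := jetb_ge0 hA; have B0 := jetb_ge0 hB.
have p2 : 0 < 2 ^+ size s :> R by rewrite exprn_gt0.
have step p : p \in splits s ->
    `|rderw p.1 u x * rderw p.2 v x| * gam w m (size s) <= C * A * B / 2 ^+ size s.
  move=> /splitsP[s1 s2 s3]; rewrite ler_pdivlMr// normrM.
  have tr : transitive (fun i j : 'I_N => (i <= j)%N).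
    by move=> y z t; exact: leq_trans.
  have h1 := hA _ (subseq_sorted tr s1 ss); have h2 := hB _ (subseq_sorted tr s2 ss).
  apply: (@le_trans _ _ (`|rderw p.1 u x| * `|rderw p.2 v x| *
      (C * (gam w l (size p.1) * gam w l (size p.2))))).
    rewrite -[leLHS]mulrA; apply: ler_wpM2l; first by [].
    rewrite mulrC; apply: le_trans (h _) _; apply: ler_wpM2l => //.
    by rewrite -s3 gamD.
  apply: (@le_trans _ _ (C * ((`|rderw p.1 u x| * gam w l (size p.1)) *
     (`|rderw p.2 v x| * gam w l (size p.2))))).
    by rewrite le_eqVlt; apply/orP; left; apply/eqP; ring.
  rewrite -[leRHS]mulrA; apply: ler_wpM2l => //.
  by apply: ler_pM => //; apply: mulr_ge0 => //; exact: gam_ge0.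
apply: (@le_trans _ _ (\sum_(p <- splits s)
    `|rderw p.1 u x * rderw p.2 v x| * gam w m (size s))).
  by rewrite -mulr_suml ler_wpM2r ?gam_ge0// ler_norm_sum.
apply: (@le_trans _ _ (\sum_(p <- splits s) C * A * B / 2 ^+ size s)).
  by rewrite big_seq [leRHS]big_seq; apply: ler_sum => p /step.
rewrite big_const_seq count_predT size_splits iter_addr_0.
by rewrite -[X in X <= _]mulr_natr natrX divfK ?gt_eqF.
Qed.

Definition cjet m f x B :=
  jetb m (fun x => complex.Re (f x)) x B /\ jetb m (fun x => complex.Im (f x)) x B.

Lemma normc_le (z : R[i]) : normc z <= `|complex.Re z| + `|complex.Im z|.
Proof.
case: z => a b /=; rewrite -(@ler_pXn2r _ 2)// ?nnegrE ?sqrtr_ge0 ?addr_ge0//.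
rewrite sqr_sqrtr ?addr_ge0 ?sqr_ge0// sqrrD !real_normK ?num_real//.
by have : 0 <= `|a| * `|b| by []; lra.
Qed.

Lemma normRe_le (z : R[i]) : `|complex.Re z| <= normc z.
Proof.
by case: z => a b /=; rewrite -sqrtr_sqr ler_wsqrtr// lerDl sqr_ge0.
Qed.

Lemma normIm_le (z : R[i]) : `|complex.Im z| <= normc z.
Proof.
by case: z => a b /=; rewrite -sqrtr_sqr ler_wsqrtr// lerDr sqr_ge0.
Qed.

Lemma cjet_normc m f x B : cjet m f x B ->
  forall a, normc (mpartial a f x) * gam w m (mdeg a) <= 2 * B.
Proof.
move=> [h1 h2] a; apply: le_trans (ler_wpM2r (gam_ge0 _ _ _) (normc_le _)) _ => //.
have := h1 _ (sorted_word a); have := h2 _ (sorted_word a).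
by rewrite -Re_mpartial -Im_mpartial size_word; lra.
Qed.

Lemma normc_cjet m f x B :
  (forall a, normc (mpartial a f x) * gam w m (mdeg a) <= B) -> cjet m f x B.
Proof.
move=> h; split=> s ss; have := h [ffun i => count_mem i s];
  rewrite -size_word word_count//; apply: le_trans; rewrite ler_wpM2r ?gam_ge0//.
  by rewrite -[s in leLHS]word_count// -Re_mpartial normRe_le.
by rewrite -[s in leLHS]word_count// -Im_mpartial normIm_le.
Qed.

Lemma seminorm_r_le m n f (C : R) : (0 < m)%N ->
  (forall x, cjet m f x (C * expR (n%:R * w (enorm x)))) ->
  (seminorm_r w m n%:Z f <= (2 * C)%:E)%E.
Proof.
move=> m0 h; apply: ge_ereal_sup => _ [a _ [x _ <-]].
rewrite expeRD expeR_scaled_conj//= -!EFinM lee_fin.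
have := cjet_normc (h x) a; rewrite mulrA -ler_pdivrMr ?expR_gt0// expRN.
by apply: le_trans; rewrite -pmulrn le_eqVlt; apply/orP; left; apply/eqP; ring.
Qed.

Lemma seminorm_r_lty m n f : (0 < m)%N -> (seminorm_r w m n%:Z f < +oo)%E ->
  exists2 C, 0 <= C & forall x, cjet m f x (C * expR (n%:R * w (enorm x))).
Proof.
move=> m0 h; exists `|fine (seminorm_r w m n%:Z f)| => // x.
apply: normc_cjet => a; rewrite -ler_pdivrMr ?expR_gt0// -lee_fin.
apply: (@le_trans _ _ (seminorm_r w m n%:Z f)).
  apply: ereal_sup_ubound; exists a => //; exists x => //.
  by rewrite expeRD expeR_scaled_conj//= -!EFinM expRN -pmulrn mulrA mulrAC.
case: (seminorm_r w m n%:Z f) h => [r _|//|_]; last by rewrite leNye.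
by rewrite lee_fin ler_norm.
Qed.

Lemma seminorm_q_le m n f (C : R) : (0 < m)%N ->
  (forall x, cjet m f x (C * expR (- (n%:R * w (enorm x))))) ->
  (seminorm_q w m%:R n%:R f <= (2 * C)%:E)%E.
Proof.
move=> m0 h; apply: ge_ereal_sup => _ [a _ [x _ <-]].
rewrite expeR_scaled_conj//= -EFinM lee_fin.
have := cjet_normc (h x) a; rewrite mulrA expRN ler_pdivlMr ?expR_gt0//.
by apply: le_trans; rewrite le_eqVlt; apply/orP; left; apply/eqP; ring.
Qed.

Lemma seminorm_p_le (K : set V) m f (C : R) : (0 < m)%N ->
  (forall x, K x -> cjet m f x C) -> (seminorm_p w K m f <= (2 * C)%:E)%E.
Proof.
move=> m0 h; apply: ge_ereal_sup => _ [x Kx [a _ <-]].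
by rewrite expeR_scaled_conj//= -EFinM lee_fin; exact: cjet_normc (h x Kx) a.
Qed.

Lemma seminorm_p_lty (K : set V) m f : (0 < m)%N -> (seminorm_p w K m f < +oo)%E ->
  exists2 C, 0 <= C & forall x, K x -> cjet m f x C.
Proof.
move=> m0 h; exists `|fine (seminorm_p w K m f)| => // x Kx.
apply: normc_cjet => a; rewrite -lee_fin.
apply: (@le_trans _ _ (seminorm_p w K m f)).
  apply: ereal_sup_ubound; exists x => //; exists a => //.
  by rewrite expeR_scaled_conj//= -EFinM.
case: (seminorm_p w K m f) h => [r _|//|_]; last by rewrite leNye.
by rewrite lee_fin ler_norm.
Qed.

End jets.

(** * Cut-off functions of several variables *)

Section product_cutoff.
Context (R : realType) (w : R -> R) (hw : nonquasianalytic_weight w) (N : nat).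
Local Notation V := 'rV[R]_N.
Implicit Types (x c : V) (r : R).

(** Moving along the [j]-th unit vector changes one factor only, so the difference quotient is that
    of [F j] times a constant. *)
Lemma is_derive_prod_coord (F : 'I_N -> R -> R) (l : R) j x :
  is_derive (x 0 j) (1 : R) (F j) l ->
  is_derive x (unit_vec R j) (fun y => \prod_i F i (y 0 i))
    (l * \prod_(i | i != j) F i (x 0 i)).
Proof.
move=> [dF lE]; set P := \prod_(i | i != j) _.
have q : (fun t : R => t^-1 *: ((fun y : V => \prod_i F i (y 0 i)) (t *: unit_vec R j + x) -
      \prod_i F i (x 0 i))) @ 0^' --> (l * P : R^o).
  rewrite (_ : (fun t : R => _) = fun t : R =>
      (t^-1 *: (F j (t *: 1 + x 0 j) - F j (x 0 j))) * P).
    by apply: cvgM; [rewrite -lE; exact: dF|exact: cvg_cst].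
  apply/funext => t; rewrite -[LHS]/(_ * _) -[X in X * P]/(_ * _).
  rewrite (bigD1 j)//= [in X in _ - X](bigD1 j)//= !mxE eqxx eqxx/=.
  rewrite (eq_bigr (fun i => F i (x 0 i))); last first.
    by move=> i ij; rewrite !mxE (negPf ij) andbF mulr0 add0r.
  by rewrite -/P -mulrBl mulrA.
by apply: DeriveDef; [apply/cvg_ex; exists (l * P)|exact/cvg_lim].
Qed.

Lemma continuous_prod_coord (F : 'I_N -> R -> R) : (forall i, continuous (F i)) ->
  continuous (fun y : V => \prod_i F i (y 0 i)).
Proof.
move=> cF; elim: (index_enum _) => [|i e IH].
  by under eq_fun do rewrite big_nil; exact: cst_continuous.
under eq_fun do rewrite big_cons.
move=> x; have h : {for x, continuous (fun y : V => F i (y 0 i))}.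
  apply: (@continuous_comp _ _ _ (fun y : V => y 0 i) (F i) x); last exact: cF.
  exact: coord_continuous.
exact: cvgM h (IH x).
Qed.

(** Products of translated and dilated copies of the cut-off of one variable. Since [1 <= r],
    dilation only shrinks derivatives, which makes the bounds uniform in [c] and [r];
    supermultiplicativity of [M] merges the orders of the single coordinates into the total
    order. *)
Lemma cutoff_exists : exists chi : V -> R -> V -> R,
  [/\ forall c r, 1 <= r -> rsmooth (chi c r),
    forall c r x, 1 <= r -> (forall i, `|x 0 i - c 0 i| <= r) -> chi c r x = 1,
    forall c r x i, 1 <= r -> 5 * r <= `|x 0 i - c 0 i| -> chi c r x = 0 &
    forall m, (0 < m)%N -> exists C, forall c r x, 1 <= r -> jetb w m (chi c r) x C].
Proof.
have [th [M [dth th1 th0 thM [M0 Mp MM Mg]]]] := weight_cutoff hw.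
pose F c r (n : nat) (i : 'I_N) (t : R) : R := r ^- n * th n ((t - c 0 i) / r).
(* The mixed derivative with orders [n i]. The family is closed under differentiation, so iterated
   derivatives reduce to counting letters. *)
pose P c r (n : 'I_N -> nat) x := \prod_i F c r (n i) i (x 0 i).
have dF c r n i t : 1 <= r -> is_derive t (1 : R) (F c r n i) (F c r n.+1 i t).
  move=> r1; have r0 : r != 0 by rewrite gt_eqF//; lra.
  have d1 : is_derive t (1 : R) (fun t => (t - c 0 i) / r) r^-1.
    have d0 : is_derive t (1 : R) (id - cst (c 0 i)) (1 - 0) :=
      is_deriveB (is_derive_id _ _) (is_derive_cst _ _ _).
    have := @is_deriveZ _ _ _ _ r^-1 t 1 _ d0.
    rewrite (_ : r^-1 \*: (id - cst (c 0 i)) = fun t => (t - c 0 i) / r).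
      by move=> /is_derive_eq; apply; rewrite subr0 -[LHS]/(_ * _) mulr1.
    by apply/funext => s; rewrite -[LHS]/(_ * (_ - _)) mulrC.
  have d2 := @is_derive1_comp _ (th n) (fun t => (t - c 0 i) / r) t _ _ (dth n _) d1.
  have := @is_deriveZ _ _ _ _ (r ^- n) t 1 _ d2.
  rewrite /F exprS invfM => /is_derive_eq; apply.
  by rewrite -[LHS]/(_ * (_ * _)); ring.
have contF c r n i : 1 <= r -> continuous (F c r n i).
  move=> r1 t; apply: differentiable_continuous; apply/derivable1_diffP.
  by case: (dF c r n i t r1).
have dP c r n j : 1 <= r -> forall x,
    is_derive x (unit_vec R j) (P c r n) (P c r (fun i => (n i + (i == j))%N) x).
  move=> r1 x.
  have := @is_derive_prod_coord (fun i => F c r (n i) i) _ j x (dF c r (n j) j (x 0 j) r1).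
  move=> /is_derive_eq; apply; rewrite /P [RHS](bigD1 j)//= eqxx addn1; congr (_ * _).
  by apply: eq_bigr => i ij; rewrite (negPf ij) addn0.
have dPE c r n j : 1 <= r ->
    'D_(unit_vec R j) (P c r n) = P c r (fun i => (n i + (i == j))%N).
  by move=> r1; apply/funext => x; have [_ ->] := dP c r n j r1 x.
have sP c r n : 1 <= r -> rsmooth (P c r n).
  move=> r1 k; elim: k n => [|k IH] n /=.
    by apply: (@continuous_prod_coord (fun i => F c r (n i) i)) => i; exact: contF.
  split; first by apply: (@continuous_prod_coord (fun i => F c r (n i) i)) => i; exact: contF.
  by move=> j; rewrite dPE//; split=> // x; case: (dP c r n j r1 x).
have rP c r n s : 1 <= r ->
    rderw s (P c r n) = P c r (fun i => (n i + count_mem i s)%N).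
  move=> r1; elim: s => [|j s IH] /=.
    by congr P; apply/funext => i; rewrite addn0.
  rewrite IH dPE//; congr P; apply/funext => i.
  by rewrite (eq_sym j) -addnA; congr addn; rewrite addnC.
exists (fun c r => P c r (fun=> 0%N)); split.
- by move=> c r r1; exact: sP.
- move=> c r x r1 h; rewrite /P big1// => i _; rewrite /F expr0 invr1 mul1r th1//.
  by rewrite normrM normfV (@gtr0_norm _ r) ?ler_pdivrMr ?mul1r//; lra.
- move=> c r x i r1 h; rewrite /P (bigD1 i)//= /F expr0 invr1 mul1r th0 ?mul0r//.
  by rewrite normrM normfV (@gtr0_norm _ r) ?ler_pdivlMr//; lra.
move=> m m0; have [C hC] := Mg m m0; exists C => c r x r1 s ss.
apply: le_trans (hC (size s)); rewrite ler_wpM2r ?gam_ge0//.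
have -> : size s = (\sum_i count_mem i s)%N.
  elim: s {ss} => [|j s IH] /=; first by rewrite big1.
  rewrite big_split/= -IH (bigD1 j)//= eqxx big1 ?addn0// => i ij.
  by rewrite eq_sym (negPf ij).
rewrite rP// /P normr_prod.
apply: (@le_trans _ _ (\prod_i M (count_mem i s))).
  apply: ler_prod => i _; rewrite normr_ge0/= add0n /F normrM -[leRHS]mul1r ler_pM//.
  rewrite normfV normrX (@gtr0_norm _ r); last lra.
  by rewrite invf_le1 ?exprn_ege1 ?exprn_gt0//; lra.
elim: (index_enum _) => [|i e IH]; first by rewrite !big_nil M0.
rewrite !big_cons; apply: le_trans (MM _ _); rewrite ler_wpM2l//; exact: ltW.
Qed.

End product_cutoff.

(** * Poisson kernels *)

Section line_integrals.
Context (R : realType).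
Local Notation mu := (@lebesgue_measure R).
Implicit Types (f F : R -> R) (s x e : R).

Let measurable_EFin_continuous f : continuous f ->
  measurable_fun [set: measurableTypeR R] (EFin \o f).
Proof.
by move=> cf; apply/measurable_EFinP; exact: continuous_measurable_fun.
Qed.

Lemma ge0_integral_line_split f : (forall x, 0 <= f x) -> continuous f ->
  (\int[mu]_x (f x)%:E = \int[mu]_(x in [set` `[0%R, +oo[]) (f x)%:E +
     \int[mu]_(x in [set` `[0%R, +oo[]) (f (- x))%:E)%E.
Proof.
move=> f0 cf.
have mf : measurable_fun [set: R] f by exact: continuous_measurable_fun.
rewrite -(setUv [set` `[0%R, +oo[]) ge0_integral_setU//= ; last 4 first.
  exact: measurableC.
  by apply/measurable_EFinP; rewrite setUv.
  by move=> x _; rewrite lee_fin.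
  exact/disj_setPCl.
congr (_ + _)%E; rewrite setCitvr.
rewrite integral_itv_bndo_bndc; last exact/measurable_EFinP/measurable_funTS.
rewrite -{1}oppr0 ge0_integration_by_substitutionNy//.
exact: continuous_subspaceT.
Qed.

Lemma ge0_integral_line_opp f : (forall x, 0 <= f x) -> continuous f ->
  (\int[mu]_x (f (- x))%:E = \int[mu]_x (f x)%:E)%E.
Proof.
move=> f0 cf; rewrite [RHS]ge0_integral_line_split// addeC.
rewrite ge0_integral_line_split//.
  by under [X in (_ + X)%E]eq_integral do rewrite opprK.
by move=> x; apply: (@continuous_comp _ _ _ -%R f); [exact: oppr_continuous|exact: cf].
Qed.

Lemma ge0_FTC_line f F (l l' : R) : (forall x, 0 <= f x) -> continuous f ->
  (forall x, is_derive x (1 : R) F (f x)) ->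
  F x @[x --> +oo] --> l -> F (- x) @[x --> +oo] --> l' ->
  (\int[mu]_x (f x)%:E = (l - l')%:E)%E.
Proof.
move=> f0 cf dF Fl Fl'.
have cfN : continuous (fun x => f (- x)).
  by move=> x; apply: (@continuous_comp _ _ _ -%R f); [exact: oppr_continuous|exact: cf].
have dFN (x : R) : is_derive x (1 : R) (fun x => - F (- x)) (f (- x)).
  have := @is_deriveN _ _ _ _ x 1 _ (@is_derive1_comp _ F -%R x _ _ (dF (- x)) (is_deriveNid _ _)).
  by rewrite mulrN1 opprK.
have cF (G : R -> R) (g x : R) : is_derive x (1 : R) G g -> {for x, continuous G}.
  by move=> [dG _]; apply: differentiable_continuous; exact/derivable1_diffP.
rewrite ge0_integral_line_split//.
rewrite (@ge0_continuous_FTC2y _ f F 0 l)//; first last.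
- by move=> x _; rewrite derive1E; case: (dF x).
- by apply: cvg_at_right_filter; exact: (cF _ _ _ (dF 0)).
- exact: continuous_subspaceT.
rewrite (@ge0_continuous_FTC2y _ (fun x => f (- x)) (fun x => - F (- x)) 0 (- l'))//.
- by rewrite oppr0 -!EFinB -EFinD; congr _%:E; ring.
- exact: continuous_subspaceT.
- exact: cvgN.
- by apply: cvg_at_right_filter; exact: (cF _ _ _ (dFN 0)).
- by move=> x _; rewrite derive1E; case: (dFN x).
Qed.

(** The Fourier transform of [expabs e], with total mass [2 * pi]. For [e = 1] it also serves as the
    standard integrable majorant. *)
Definition poisson e s : R := 2 * e / (e ^+ 2 + s ^+ 2).

Lemma poisson_gt0 e s : 0 < e -> 0 < poisson e s.
Proof.
by move=> e0; rewrite divr_gt0// ?mulr_gt0// ltr_pwDl ?exprn_gt0// sqr_ge0.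
Qed.

Lemma continuous_poisson e : 0 < e -> continuous (poisson e).
Proof.
move=> e0 s; apply: cvgM; first exact: cvg_cst.
apply: cvgV; first by rewrite gt_eqF// ltr_pwDl ?exprn_gt0// sqr_ge0.
by apply: cvgD; [exact: cvg_cst|exact: exprn_continuous].
Qed.

Lemma integral_poisson e x : 0 < e ->
  (\int[mu]_s (poisson e (s - x))%:E = (2 * pi)%:E)%E.
Proof.
move=> e0; have en0 : e != 0 by rewrite gt_eqF.
pose F s := 2 * atan ((s - x) / e).
have affine (s : R) : is_derive s (1 : R) (fun s => (s - x) / e) e^-1.
  have d0 : is_derive s (1 : R) (id - cst x) (1 - 0) :=
    is_deriveB (is_derive_id _ _) (is_derive_cst _ _ _).
  have := @is_deriveZ _ _ _ _ e^-1 s 1 _ d0.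
  rewrite (_ : e^-1 \*: (id - cst x) = fun s => (s - x) / e).
    by move=> /is_derive_eq; apply; rewrite subr0 -[LHS]/(_ * _) mulr1.
  by apply/funext => t; rewrite -[LHS]/(_ * (_ - _)) mulrC.
have dF (s : R) : is_derive s (1 : R) F (poisson e (s - x)).
  have d1 := @is_derive1_comp _ _ _ s _ _ (is_derive1_atan _) (affine s).
  have := @is_deriveZ _ _ _ _ 2 s 1 _ d1 => /is_derive_eq; apply.
  rewrite -[LHS]/(_ * (_ * _)) /poisson.
  have q : e ^+ 2 + (s - x) ^+ 2 != 0.
    by rewrite gt_eqF// ltr_pwDl ?exprn_gt0// sqr_ge0.
  by field; rewrite ?q ?en0.
have lim c : atan ((s + c) / e) @[s --> +oo] --> (pi / 2 : R).
  apply: (cvg_comp (fun s => (s + c) / e) (@atan R) _ (@cvgy_atan R)).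
  apply/cvgryPge => A; near=> s.
  rewrite ler_pdivlMr// -lerBlDr; near: s; apply: nbhs_pinfty_ge; by rewrite num_real.
rewrite (@ge0_FTC_line _ F pi (- pi)) //.
- by congr _%:E; ring.
- by move=> s; rewrite ltW// poisson_gt0.
- move=> s; apply: (@continuous_comp _ _ _ (fun s => s - x) (poisson e)).
    by apply: cvgB; [exact: cvg_id|exact: cvg_cst].
  exact: continuous_poisson.
- have -> : (pi : R) = 2 * (pi / 2) by field.
  by apply: cvgM; [exact: cvg_cst|exact: lim].
- have -> : - (pi : R) = 2 * (- (pi / 2)) by field.
  apply: cvgM; first exact: cvg_cst.
  under eq_fun do rewrite -opprD mulNr atanN.
  by apply: cvgN; exact: lim.
Unshelve. all: by end_near. Qed.

Definition expabs e x : R := expR (- (e * `|x|)).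

Lemma expabs_gt0 e x : 0 < expabs e x. Proof. exact: expR_gt0. Qed.

Lemma expabs_le1 e x : 0 < e -> expabs e x <= 1.
Proof. by move=> e0; rewrite -expR0 ler_expR oppr_le0 mulr_ge0// ltW. Qed.

Lemma continuous_expabs e : continuous (expabs e).
Proof.
move=> x; apply: (@continuous_comp _ _ _ (fun x => - (e * `|x|)) expR).
  by apply: cvgN; apply: cvgM; [exact: cvg_cst|exact: norm_continuous].
exact: continuous_expR.
Qed.

Let is_derive_expN e (x : R) :
  is_derive x (1 : R) (fun x => expR (- (e * x))) (- e * expR (- (e * x))).
Proof.
have := @is_derive1_comp _ expR (fun x => - e * x) x _ (- e) (is_derive_expR _).
have d0 : is_derive x (1 : R) (- e \*: id) (- e *: 1) := @is_deriveZ _ _ _ _ _ x 1 _ (is_derive_id _ _).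
rewrite -[_ *: 1]/(_ * 1) mulr1 in d0 => /(_ d0).
rewrite (_ : expR \o (fun x => - e * x) = fun x => expR (- (e * x))); last first.
  by apply/funext => y; rewrite /= mulNr.
move=> /is_derive_eq; apply.
by rewrite [LHS]mulrC; congr (_ * expR _); rewrite mulNr.
Qed.

Let cvg_expN e : 0 < e -> expR (- (e * x)) @[x --> +oo] --> (0 : R).
Proof.
move=> e0; apply: (cvg_comp (fun x => e * x) (fun x => expR (- x)) _ (@cvgr_expR R)).
apply/cvgryPge => A; near=> x.
rewrite -ler_pdivrMl// ; near: x; apply: nbhs_pinfty_ge; by rewrite num_real.
Unshelve. all: by end_near. Qed.

(** Adding 1 to the cosine makes the integrand nonnegative, so that the fundamental theorem for
    nonnegative integrands applies. The case [b = 0] gives the integral of [expabs], and subtracting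
    it from the case [b = 1] isolates the cosine. *)
Let integral_expabs_aux e s (b : R) : 0 < e -> 0 <= b <= 1 ->
  (\int[mu]_x (expabs e x * (1 + b * cos (s * x)))%:E =
   (2 / e + b * poisson e s)%:E)%E.
Proof.
move=> e0 /andP[b0 b1]; have en0 : e != 0 by rewrite gt_eqF.
have q0 : 0 < e ^+ 2 + s ^+ 2 by rewrite ltr_pwDl ?exprn_gt0// sqr_ge0.
pose f x := expabs e x * (1 + b * cos (s * x)).
have ccos : continuous (fun x => cos (s * x)).
  move=> x; apply: (@continuous_comp _ _ _ (fun x => s * x) cos).
    by apply: cvgM; [exact: cvg_cst|exact: cvg_id].
  exact: continuous_cos.
have cf : continuous f.
  move=> x; apply: cvgM; first exact: continuous_expabs.
  by apply: cvgD; [exact: cvg_cst|apply: cvgM; [exact: cvg_cst|exact: ccos]].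
have f0 x : 0 <= f x.
  rewrite mulr_ge0 ?(ltW (expabs_gt0 _ _))//.
  have : b * - cos (s * x) <= 1 * 1.
    apply: le_trans (_ : b * 1 <= _); last by rewrite ler_pM.
    by rewrite ler_wpM2l// lerNl cos_geN1.
  lra.
(* The antiderivative on the half-line, vanishing at +oo; evenness of the integrand doubles the
   result. *)
pose H x := expR (- (e * x)) * (- e^-1 + b * ((s * sin (s * x) - e * cos (s * x)) / (e ^+ 2 + s ^+ 2))).
have dlin (x : R) : is_derive x (1 : R) (fun x => s * x) s.
  have d0 : is_derive x (1 : R) (s \*: id) (s *: 1) := @is_deriveZ _ _ _ _ _ x 1 _ (is_derive_id _ _).
  by rewrite -[_ *: 1]/(_ * 1) mulr1 in d0.
have dH (x : R) : is_derive x (1 : R) H (expR (- (e * x)) * (1 + b * cos (s * x))).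
  have ds := @is_deriveZ _ _ _ _ s x 1 _ (@is_derive1_comp _ _ _ x _ _ (is_derive_sin _) (dlin x)).
  have dc := @is_deriveZ _ _ _ _ e x 1 _ (@is_derive1_comp _ _ _ x _ _ (is_derive_cos _) (dlin x)).
  have d1 := @is_deriveZ _ _ _ _ (b / (e ^+ 2 + s ^+ 2)) x 1 _ (is_deriveB ds dc).
  have d2 := is_deriveM (is_derive_expN e x) (is_deriveD (is_derive_cst (- e^-1) x 1) d1).
  rewrite (_ : H = (fun x0 : R => expR (- (e * x0))) *
     (cst (- e^-1) + (b / (e ^+ 2 + s ^+ 2)) \*: ((s \*: (sin \o [eta *%R s])) - (e \*: (cos \o [eta *%R s]))))).
    apply: is_derive_eq d2 _ => /=.
    rewrite !fctE /GRing.scale/= /GRing.scale/=.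
    by field; rewrite ?en0 ?gt_eqF.
  apply/funext => y; rewrite /H !fctE /GRing.scale/= /GRing.scale/=; congr (_ * (_ + _)).
  by ring.
have H0 : H x @[x --> +oo] --> (0 : R).
  pose B := e^-1 + (`|s| + e) / (e ^+ 2 + s ^+ 2).
  apply: (@squeeze_cvgr _ _ _ _ (fun x => - (expR (- (e * x)) * B)) (fun x => expR (- (e * x)) * B)).
  - near=> x; rewrite -ler_norml /H normrM ger0_norm ?expR_ge0//.
    rewrite ler_wpM2l ?expR_ge0//; apply: le_trans (ler_normD _ _) _.
    rewrite normrN (@ger0_norm _ e^-1) ?invr_ge0 ?(ltW e0)// /B lerD2l normrM (ger0_norm b0).
    apply: (@le_trans _ _ (1 * `|(s * sin (s * x) - e * cos (s * x)) / (e ^+ 2 + s ^+ 2)|)).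
      by rewrite ler_wpM2r.
    rewrite mul1r normrM normfV (gtr0_norm q0) ler_wpM2r ?invr_ge0 ?(ltW q0)//.
    apply: le_trans (ler_normB _ _) _; rewrite !normrM (gtr0_norm e0) lerD//.
      by rewrite ler_piMr// sin_max.
    by rewrite ler_piMr ?cos_max// ltW.
  - by rewrite -oppr0 -(mul0r B); apply: cvgN; apply: cvgM; [exact: cvg_expN|exact: cvg_cst].
  - by rewrite -(mul0r B); apply: cvgM; [exact: cvg_expN|exact: cvg_cst].
have cH : {for 0, continuous H}.
  by have [d _] := dH 0; apply: differentiable_continuous; exact/derivable1_diffP.
rewrite ge0_symfun_integralT//; last first.
  by move=> x; rewrite /= /expabs normrN mulrN cosN.
rewrite -set_itvcy (@ge0_continuous_FTC2y _ f H 0 0)//.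
- rewrite /H mulr0 oppr0 expR0 mulr0 sin0 cos0 /poisson -EFinB -EFinM.
  by congr _%:E; field; rewrite en0 gt_eqF.
- exact: continuous_subspaceT.
- exact: cvg_at_right_filter.
- move=> x; rewrite in_itv/= andbT => x0; rewrite derive1E.
  by have [_ ->] := dH x; rewrite /f /expabs gtr0_norm.
Unshelve. all: by end_near. Qed.

Lemma integral_expabs e : 0 < e -> (\int[mu]_x (expabs e x)%:E = (2 / e)%:E)%E.
Proof.
move=> e0; have := @integral_expabs_aux e 0 0 e0; rewrite lexx ler01 => /(_ isT).
rewrite mul0r addr0 => <-.
by apply: eq_integral => x _; rewrite mul0r addr0 mulr1.
Qed.

Lemma integrable_expabs e : 0 < e -> mu.-integrable setT (EFin \o expabs e).
Proof.
move=> e0; apply/integrableP; split.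
  by apply: measurable_EFin_continuous; exact: continuous_expabs.
under eq_integral do rewrite /= ger0_norm ?(ltW (expabs_gt0 _ _))//.
by rewrite integral_expabs// ltry.
Qed.

Let integrable_expabsM e (c : R -> R) : 0 < e -> continuous c -> (forall x, `|c x| <= 1) ->
  mu.-integrable setT (EFin \o (fun x => expabs e x * c x)).
Proof.
move=> e0 cc c1; apply: le_integrable (integrable_expabs e0) => //.
  apply: measurable_EFin_continuous => x.
  by apply: cvgM; [exact: continuous_expabs|exact: cc].
move=> x _ /=; rewrite lee_fin normrM [leRHS]ger0_norm ?(ltW (expabs_gt0 _ _))//.
by rewrite ger0_norm ?(ltW (expabs_gt0 _ _))// ler_piMr// ltW// expabs_gt0.
Qed.

Let continuous_cosM s : continuous (fun x => cos (s * x)).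
Proof.
move=> x; apply: (@continuous_comp _ _ _ (fun x => s * x) cos).
  by apply: cvgM; [exact: cvg_cst|exact: cvg_id].
exact: continuous_cos.
Qed.

Let continuous_sinM s : continuous (fun x => sin (s * x)).
Proof.
move=> x; apply: (@continuous_comp _ _ _ (fun x => s * x) sin).
  by apply: cvgM; [exact: cvg_cst|exact: cvg_id].
exact: continuous_sin.
Qed.

Lemma integrable_expabs_cos e s : 0 < e ->
  mu.-integrable setT (EFin \o (fun x => expabs e x * cos (s * x))).
Proof.
by move=> e0; apply: integrable_expabsM => // x; exact: cos_max.
Qed.

Lemma integrable_expabs_sin e s : 0 < e ->
  mu.-integrable setT (EFin \o (fun x => expabs e x * sin (s * x))).
Proof.
by move=> e0; apply: integrable_expabsM => // x; exact: sin_max.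
Qed.

Lemma Rintegral_expabs_cos e s : 0 < e ->
  (\int[mu]_x (expabs e x * cos (s * x)) = poisson e s)%R.
Proof.
move=> e0; have := @integral_expabs_aux e s 1 e0; rewrite lexx ler01 => /(_ isT) h.
apply: (addrI (2 / e)); rewrite -[X in X + _ = _]/(fine (2 / e)%:E) -integral_expabs//.
rewrite -[fine _]/(\int[mu]_x (expabs e x))%R -RintegralD//; first last.
- exact: integrable_expabs_cos.
- exact: integrable_expabs.
rewrite -[RHS]/(fine (2 / e + poisson e s)%:E) -[poisson e s]mul1r -h.
by rewrite /Rintegral; congr fine; apply: eq_integral => x _; rewrite mul1r mulrDr mulr1.
Qed.

(** Adding [expabs] gives a nonnegative function, for which reflection invariance is available;
    reflection flips the sign of the sine term only. *)
Lemma Rintegral_expabs_sin e s : 0 < e ->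
  (\int[mu]_x (expabs e x * sin (s * x)) = 0)%R.
Proof.
move=> e0; pose f x := expabs e x + expabs e x * sin (s * x).
have h := @ge0_integral_line_opp f.
have {h} : (\int[mu]_x (f (- x)) = \int[mu]_x (f x))%R.
  rewrite /Rintegral h// => x.
    rewrite /f -[X in X + _]mulr1 -mulrDr mulr_ge0 ?(ltW (expabs_gt0 _ _))//.
  apply: cvgD; first exact: continuous_expabs.
  by apply: cvgM; [exact: continuous_expabs|exact: continuous_sinM].
have i1 := integrable_expabs e0; have i2 := integrable_expabs_sin s e0.
rewrite [in RHS]/f RintegralD//.
rewrite (_ : (fun x => f (- x)) = fun x => expabs e x - expabs e x * sin (s * x)).
  by rewrite RintegralB//; lra.
by apply/funext => x; rewrite /f /expabs normrN mulrN sinN mulrN.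
Qed.

(* [h' + 2 C / (1 + x^2)] is nonnegative, so that the fundamental theorem of
   calculus for nonnegative integrands applies to it. *)
Lemma integral_derive_eq0 (h h' : R -> R) (C : R) :
  (forall x, is_derive x (1 : R) h (h' x)) -> continuous h' ->
  (forall x, `|h x| <= C * poisson 1 x) -> (forall x, `|h' x| <= C * poisson 1 x) ->
  (\int[mu]_x h' x = 0)%R.
Proof.
move=> dh ch' hC h'C.
have p0 : (\int[mu]_s (poisson 1 s)%:E = (2 * pi)%:E)%E.
  by rewrite -(integral_poisson 0 ltr01); apply: eq_integral => s _; rewrite subr0.
have C0 : 0 <= C.
  have := le_trans (normr_ge0 _) (hC 0).
  by rewrite pmulr_lge0// poisson_gt0.
have pE x : poisson 1 x = 2 / (1 + x ^+ 2) by rewrite /poisson mulr1 expr1n.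
have cp := continuous_poisson (ltr01 : 0 < 1 :> R).
have i1 : mu.-integrable setT (EFin \o (poisson 1 : R -> R)).
  apply/integrableP; split; first exact: measurable_EFin_continuous.
  under eq_integral do rewrite /= ger0_norm ?(ltW (poisson_gt0 _ ltr01))//.
  by rewrite p0 ltry.
have i1' : mu.-integrable setT (EFin \o (fun x => C * poisson 1 x)).
  apply: (@eq_integrable _ _ _ mu _ _ (fun x => C%:E * (poisson 1 x)%:E)%E) => //.
  exact: integrableZl.
have i2 : mu.-integrable setT (EFin \o h').
  apply: le_integrable i1' => //; first exact: measurable_EFin_continuous.
  by move=> x _; rewrite /= lee_fin; apply: le_trans (h'C x) (ler_norm _).
have lim0 (g : R -> R) : (forall x, `|g x| <= C * poisson 1 x) -> g x @[x --> +oo] --> (0 : R).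
  move=> gC; apply/cvgrPdist_le => d d0; near=> x.
  rewrite sub0r normrN; apply: le_trans (gC x) _; rewrite pE.
  have x1 : 1 <= x by near: x; apply: nbhs_pinfty_ge; by rewrite num_real.
  have xd : 2 * C / d <= x by near: x; apply: nbhs_pinfty_ge; by rewrite num_real.
  rewrite mulrA ler_pdivrMr; last by rewrite ltr_pwDl// sqr_ge0.
  move: xd; rewrite ler_pdivrMr// => xd.
  have h2 : x * 1 <= x * x by rewrite ler_wpM2l//; lra.
  by have := ler_wpM2l (ltW d0) h2; lra.
pose F x := h x + 2 * C * atan x.
have dF (x : R) : is_derive x (1 : R) F (h' x + C * poisson 1 x).
  have := is_deriveD (dh x) (@is_deriveZ _ _ _ _ (2 * C) x 1 _ (is_derive1_atan x)).
  move=> /is_derive_eq; apply; congr (_ + _).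
  by rewrite -[LHS]/(_ * _) pE; ring.
have := @ge0_FTC_line (fun x => h' x + C * poisson 1 x) F (C * pi) (- (C * pi)).
move=> /(_ _ _ dF) H.
suff : (\int[mu]_x (h' x + C * poisson 1 x) = C * pi + C * pi)%R.
  rewrite RintegralD// RintegralZl// /Rintegral.
  by rewrite p0/=; lra.
rewrite /Rintegral H ?opprK//.
- by move=> x; have := h'C x; rewrite ler_norml; lra.
- by move=> x; apply: cvgD; [exact: ch'|apply: cvgM; [exact: cvg_cst|exact: cp]].
- rewrite -[X in _ --> X]add0r (_ : C * pi = 2 * C * (pi / 2)); last by field.
  apply: cvgD; first exact: lim0.
  by apply: cvgM; [exact: cvg_cst|exact: cvgy_atan].
- rewrite -[X in _ --> X]add0r (_ : - (C * pi) = 2 * C * (- (pi / 2))); last by field.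
  apply: cvgD.
    by apply: lim0 => x; apply: le_trans (hC _) _; rewrite !pE sqrrN.
  apply: cvgM; first exact: cvg_cst.
  by under eq_fun do rewrite atanN; apply: cvgN; exact: cvgy_atan.
Unshelve. all: by end_near. Qed.

End line_integrals.

(** * Integration over tuples *)

Section tuple_integrals.
Context (R : realType).
Local Notation leb := (@lebesgue_measure R).
Local Notation RT := (measurableTypeR R).
Local Notation mu n := (lebesgue_measure_tuple R n).
Implicit Types (n : nat).

Lemma ge0_integral_tuple_succ n (f : n.+1.-tuple RT -> \bar R) :
  measurable_fun setT f -> (forall t, 0 <= f t)%E ->
  (\int[mu n.+1]_t f t = \int[leb]_x \int[mu n]_t f (tcons (x, t)))%E.
Proof.
move=> mf f0.
rewrite (ge0_integral_pushforward (@measurable_tcons _ RT n) (leb \x mu n)%E (D := setT))//.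
rewrite preimage_setT fubini_tonelli1//=.
by apply: measurableT_comp => //; exact: measurable_tcons.
Qed.

Lemma integrable_tcons n (f : n.+1.-tuple RT -> R) :
  (mu n.+1).-integrable setT (EFin \o f) ->
  (leb \x mu n)%E.-integrable setT (fun p => (f (tcons p))%:E).
Proof.
move=> /integrableP[mf foo]; apply/integrableP; split.
  by apply: (measurableT_comp mf); exact: measurable_tcons.
apply: le_lt_trans foo.
rewrite (ge0_integral_pushforward (@measurable_tcons _ RT n) (leb \x mu n)%E (D := setT))//.
exact: measurableT_comp.
Qed.

Lemma integral_tuple_prod n (f : n.+1.-tuple RT -> R) :
  (mu n.+1).-integrable setT (EFin \o f) ->
  (\int[mu n.+1]_t (f t)%:E = \int[leb \x mu n]_p (f (tcons p))%:E)%E.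
Proof.
move=> fi; have /integrableP[mf _] := fi.
rewrite (integral_pushforward (@measurable_tcons _ RT n) mf (mu := (leb \x mu n)%E) (D := setT))//.
by rewrite preimage_setT; exact: integrable_tcons.
Qed.

Lemma integral_tuple_succ n (f : n.+1.-tuple RT -> R) :
  (mu n.+1).-integrable setT (EFin \o f) ->
  (\int[mu n.+1]_t (f t)%:E = \int[leb]_x \int[mu n]_t (f (tcons (x, t)))%:E)%E.
Proof.
move=> fi; rewrite integral_tuple_prod//.
by rewrite -(integral12_prod_meas1 (integrable_tcons fi)).
Qed.

Lemma integral_tuple_succ_swap n (f : n.+1.-tuple RT -> R) :
  (mu n.+1).-integrable setT (EFin \o f) ->
  (\int[mu n.+1]_t (f t)%:E = \int[mu n]_t \int[leb]_x (f (tcons (x, t)))%:E)%E.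
Proof.
move=> fi; rewrite integral_tuple_prod//.
by rewrite -(integral21_prod_meas1 (integrable_tcons fi)).
Qed.

Lemma tnth_tcons0 n x (t : n.-tuple RT) : tnth (tcons (x, t)) ord0 = x.
Proof. by []. Qed.

Lemma tnth_tconsS n x (t : n.-tuple RT) i :
  tnth (tcons (x, t)) (lift ord0 i) = tnth t i.
Proof. by rewrite /tcons/= (tnth_nth x) (tnth_nth x). Qed.

Lemma measurable_prod_tnth n (F : 'I_n -> R -> R) :
  (forall i, measurable_fun [set: RT] (F i)) ->
  measurable_fun [set: n.-tuple RT] (fun t => \prod_i F i (tnth t i)).
Proof.
move=> mF; elim: (index_enum _) => [|i e IH].
  by under eq_fun do rewrite big_nil; exact: measurable_cst.
under eq_fun do rewrite big_cons.
apply: measurable_funM => //.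
by apply: (measurableT_comp (mF i)); exact: measurable_tnth.
Qed.

Lemma measurable_sum_tnth n (a : 'I_n -> R) :
  measurable_fun [set: n.-tuple RT] (fun t => \sum_i a i * tnth t i).
Proof.
elim: (index_enum _) => [|i e IH].
  by under eq_fun do rewrite big_nil; exact: measurable_cst.
under eq_fun do rewrite big_cons.
apply: measurable_funD => //; apply: measurable_funM; first exact: measurable_cst.
exact: measurable_tnth.
Qed.

Lemma integral_prod_tnth n (F : 'I_n -> R -> R) (c : 'I_n -> R) :
  (forall i, continuous (F i)) -> (forall i x, 0 <= F i x) ->
  (forall i, \int[leb]_x (F i x)%:E = (c i)%:E)%E ->
  (\int[mu n]_t (\prod_i F i (tnth t i))%:E = (\prod_i c i)%:E)%E.
Proof.
elim: n F c => [|n IH] F c cF F0 Fc.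
  have h : (\int[mu 0]_t (cst 1%E) t = 1)%E.
    by rewrite integral_dirac//= diracT mul1e.
  by rewrite big_ord0 -h; apply: eq_integral => t _; rewrite big_ord0.
have mF i : measurable_fun [set: RT] (F i) by exact: continuous_measurable_fun.
rewrite ge0_integral_tuple_succ; first last.
- by move=> t; rewrite lee_fin prodr_ge0.
- by apply/measurable_EFinP; exact: measurable_prod_tnth.
pose F' i := F (lift ord0 i); pose c' i := c (lift ord0 i).
transitivity (\int[leb]_x ((\prod_i c' i)%:E * (F ord0 x)%:E))%E.
  apply: eq_integral => x _.
  rewrite -(IH F' c')//; [|by move=> i; exact: cF|by move=> i; exact: F0|by move=> i; exact: Fc].
  rewrite muleC -ge0_integralZl//=; first last.
  - by rewrite lee_fin.
  - by move=> t _; rewrite lee_fin prodr_ge0// => i _; exact: F0.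
  - by apply/measurable_EFinP; apply: measurable_prod_tnth => i; exact: mF.
  apply: eq_integral => t _; rewrite big_ord_recl/= -EFinM; congr (_ * _)%:E.
  by apply: eq_bigr => i _; rewrite tnth_tconsS.
have c0 i : 0 <= c i by rewrite -lee_fin -Fc integral_ge0// => x _; rewrite lee_fin.
rewrite ge0_integralZl//=; first last.
- by rewrite lee_fin prodr_ge0// => i _; exact: c0.
- by move=> x _; rewrite lee_fin.
- exact/measurable_EFinP.
by rewrite Fc -EFinM big_ord_recl mulrC.
Qed.

Definition pois n (e : R) (c : 'I_n -> R) (t : n.-tuple RT) : R :=
  \prod_i poisson e (tnth t i - c i).

Lemma pois_gt0 n e (c : 'I_n -> R) t : 0 < e -> 0 < pois e c t.
Proof. by move=> e0; apply: prodr_gt0 => i _; exact: poisson_gt0. Qed.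

Let cont_shift e (c : R) : 0 < e -> continuous (fun x => poisson e (x - c)).
Proof.
move=> e0 x; apply: (@continuous_comp _ _ _ (fun s => s - c) (poisson e)).
  by apply: cvgB; [exact: cvg_id|exact: cvg_cst].
exact: continuous_poisson.
Qed.

Lemma measurable_pois n e (c : 'I_n -> R) : 0 < e ->
  measurable_fun [set: n.-tuple RT] (pois e c).
Proof.
move=> e0; apply: (@measurable_prod_tnth n (fun i x => poisson e (x - c i))) => i.
by apply: continuous_measurable_fun; exact: cont_shift.
Qed.

Lemma integral_pois n e (c : 'I_n -> R) : 0 < e ->
  (\int[mu n]_t (pois e c t)%:E = ((2 * pi) ^+ n)%:E)%E.
Proof.
move=> e0; rewrite (@integral_prod_tnth n (fun i x => poisson e (x - c i)) (fun=> 2 * pi)).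
- by rewrite prodr_const card_ord.
- by move=> i; exact: cont_shift.
- by move=> i x; rewrite ltW// poisson_gt0.
- by move=> i; exact: integral_poisson.
Qed.

Lemma integrable_pois n e (c : 'I_n -> R) : 0 < e ->
  (mu n).-integrable setT (EFin \o pois e c).
Proof.
move=> e0; apply/integrableP; split; first by apply/measurable_EFinP; exact: measurable_pois.
under eq_integral do rewrite /= ger0_norm ?(ltW (pois_gt0 _ _ e0))//.
by rewrite integral_pois// ltry.
Qed.

Lemma integrable_dominated d (T : measurableType d) (m : {measure set T -> \bar R})
    (f g : T -> R) (C : R) :
  measurable_fun setT f -> m.-integrable setT (EFin \o g) ->
  (forall t, `|f t| <= C * g t) -> m.-integrable setT (EFin \o f).
Proof.
move=> mf gi fg.
have gi' : m.-integrable setT (fun x => C%:E * (g x)%:E)%E by exact: integrableZl.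
apply: le_integrable gi' => //; first exact/measurable_EFinP.
by move=> t _ /=; rewrite lee_fin; apply: le_trans (fg t) (ler_norm _).
Qed.

Section integrable_EFin.
Context d (T : measurableType d) (m : {measure set T -> \bar R}).
Implicit Types f g : T -> R.

Lemma integrable_EFinD f g : m.-integrable setT (EFin \o f) ->
  m.-integrable setT (EFin \o g) -> m.-integrable setT (EFin \o (fun t => f t + g t)).
Proof. by move=> fi gi; exact: (@integrableD _ _ _ m setT measurableT _ _ fi gi). Qed.

Lemma integrable_EFinZ (c : R) f : m.-integrable setT (EFin \o f) ->
  m.-integrable setT (EFin \o (fun t => c * f t)).
Proof. by move=> fi; exact: (@integrableZl _ _ _ m setT measurableT c _ fi). Qed.

Lemma integrable_EFinB f g : m.-integrable setT (EFin \o f) ->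
  m.-integrable setT (EFin \o g) -> m.-integrable setT (EFin \o (fun t => f t - g t)).
Proof. by move=> fi gi; exact: (@integrableB _ _ _ m setT measurableT _ _ fi gi). Qed.

End integrable_EFin.

Lemma Rintegral_dominated d (T : measurableType d) (m : {measure set T -> \bar R})
    (f g : T -> R) (C : R) :
  measurable_fun setT f -> m.-integrable setT (EFin \o g) ->
  (forall t, `|f t| <= C * g t) ->
  `|\int[m]_t f t| <= C * \int[m]_t g t.
Proof.
move=> mf gi fg; have fi := integrable_dominated mf gi fg.
apply: le_trans (le_normr_Rintegral measurableT fi) _.
rewrite -RintegralZl//; apply: le_Rintegral => //.
- exact: (integrable_norm fi).
- exact: integrable_EFinZ.
Qed.

Definition kexp n (e : R) (t : n.-tuple RT) : R := \prod_i expabs e (tnth t i).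

Lemma kexp_ge0 n e (t : n.-tuple RT) : 0 <= kexp e t.
Proof. by apply: prodr_ge0 => i _; rewrite ltW// expabs_gt0. Qed.

Lemma kexp_le1 n e (t : n.-tuple RT) : 0 < e -> kexp e t <= 1.
Proof.
move=> e0; apply: prodr_ile1 => i _.
by rewrite ltW ?expabs_gt0// expabs_le1.
Qed.

Lemma measurable_kexp n e : measurable_fun [set: n.-tuple RT] (@kexp n e).
Proof.
apply: (@measurable_prod_tnth n (fun i => expabs e)) => i.
by apply: continuous_measurable_fun; exact: continuous_expabs.
Qed.

Lemma integrable_kexp n e : 0 < e -> (mu n).-integrable setT (EFin \o @kexp n e).
Proof.
move=> e0; apply/integrableP; split; first by apply/measurable_EFinP; exact: measurable_kexp.
under eq_integral do rewrite /= ger0_norm ?kexp_ge0//.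
rewrite (@integral_prod_tnth n (fun=> expabs e) (fun=> 2 / e)) ?ltry//.
- by move=> i; exact: continuous_expabs.
- by move=> i x; rewrite ltW// expabs_gt0.
- by move=> i; exact: integral_expabs.
Qed.

Definition phase n (s : 'I_n -> R) (t : n.-tuple RT) : R := \sum_i s i * tnth t i.

Lemma measurable_trig n (s : 'I_n -> R) :
  measurable_fun [set: n.-tuple RT] (fun t => cos (phase s t)) /\
  measurable_fun [set: n.-tuple RT] (fun t => sin (phase s t)).
Proof.
split.
  by apply: (measurableT_comp (continuous_measurable_fun (@continuous_cos R)));
    exact: measurable_sum_tnth.
by apply: (measurableT_comp (continuous_measurable_fun (@continuous_sin R)));
    exact: measurable_sum_tnth.
Qed.

Lemma integrable_kexp_trig n e (s : 'I_n -> R) : 0 < e ->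
  (mu n).-integrable setT (EFin \o (fun t => kexp e t * cos (phase s t))) /\
  (mu n).-integrable setT (EFin \o (fun t => kexp e t * sin (phase s t))).
Proof.
move=> e0; have [m1 m2] := measurable_trig s.
split; (apply: (@integrable_dominated _ _ _ _ (@kexp n e) 1);
  [|exact: integrable_kexp|]).
- by apply: measurable_funM => //; exact: measurable_kexp.
- by move=> t; rewrite mul1r normrM (ger0_norm (kexp_ge0 _ _)) ler_piMr ?kexp_ge0 ?cos_max.
- by apply: measurable_funM => //; exact: measurable_kexp.
- by move=> t; rewrite mul1r normrM (ger0_norm (kexp_ge0 _ _)) ler_piMr ?kexp_ge0 ?sin_max.
Qed.

Lemma Rintegral_tuple_succ n (f : n.+1.-tuple RT -> R) :
  (mu n.+1).-integrable setT (EFin \o f) ->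
  (forall x, (mu n).-integrable setT (fun t => (f (tcons (x, t)))%:E)) ->
  (\int[mu n.+1]_t f t = \int[leb]_x (\int[mu n]_t f (tcons (x, t))))%R.
Proof.
move=> fi fxi; rewrite /Rintegral integral_tuple_succ//; congr fine.
by apply: eq_integral => x _; rewrite fineK//; exact: integrable_fin_num.
Qed.

(** The addition formulas split off the first coordinate and mix cosine and sine, so both integrals
    are treated in one induction. *)
Lemma Rintegral_kexp_trig n e (s : 'I_n -> R) : 0 < e ->
  (\int[mu n]_t (kexp e t * cos (phase s t)) = \prod_i poisson e (s i))%R /\
  (\int[mu n]_t (kexp e t * sin (phase s t)) = 0)%R.
Proof.
move=> e0; elim: n s => [|n IH] s.
  have h (c : R) : (\int[mu 0]_t (cst c%:E) t = c%:E)%E.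
    by rewrite integral_dirac//= diracT mul1e.
  split.
    rewrite big_ord0 -[RHS]/(fine 1%:E) -h /Rintegral; congr fine.
    by apply: eq_integral => t _; rewrite /kexp /phase !big_ord0 cos0 mulr1.
  rewrite -[RHS]/(fine 0%:E) -h /Rintegral; congr fine.
  by apply: eq_integral => t _; rewrite /kexp /phase !big_ord0 sin0 mulr0.
have [i1 i2] := integrable_kexp_trig s e0.
pose s' i := s (lift ord0 i).
have [IHc IHs] := IH s'; have [j1 j2] := @integrable_kexp_trig n e s' e0.
have kE x (t : n.-tuple RT) : kexp e (tcons (x, t)) = expabs e x * kexp e t.
  rewrite /kexp big_ord_recl tnth_tcons0; congr (_ * _).
  by apply: eq_bigr => i _; rewrite tnth_tconsS.
have pE x (t : n.-tuple RT) : phase s (tcons (x, t)) = s ord0 * x + phase s' t.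
  rewrite /phase big_ord_recl tnth_tcons0; congr (_ + _).
  by apply: eq_bigr => i _; rewrite tnth_tconsS.
have jZ c (f : n.-tuple RT -> R) : (mu n).-integrable setT (EFin \o f) ->
    (mu n).-integrable setT (EFin \o (fun t => c * f t)).
  exact: integrable_EFinZ.
have cE x (t : n.-tuple RT) : kexp e (tcons (x, t)) * cos (phase s (tcons (x, t))) =
    expabs e x * cos (s ord0 * x) * (kexp e t * cos (phase s' t)) -
    expabs e x * sin (s ord0 * x) * (kexp e t * sin (phase s' t)).
  by rewrite kE pE cosD; ring.
have sE x (t : n.-tuple RT) : kexp e (tcons (x, t)) * sin (phase s (tcons (x, t))) =
    expabs e x * sin (s ord0 * x) * (kexp e t * cos (phase s' t)) +
    expabs e x * cos (s ord0 * x) * (kexp e t * sin (phase s' t)).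
  by rewrite kE pE sinD; ring.
split.
- rewrite Rintegral_tuple_succ//; last first.
    move=> x; under eq_fun do rewrite cE.
    by apply: integrable_EFinB; exact: jZ.
  transitivity (\int[leb]_x (expabs e x * cos (s ord0 * x) * \prod_i poisson e (s' i)))%R.
    apply: eq_Rintegral => x _; under eq_Rintegral do rewrite cE.
    rewrite RintegralB//; [|exact: jZ|exact: jZ].
    by rewrite RintegralZl// RintegralZl// IHc IHs mulr0 subr0.
  rewrite RintegralZr//; last exact: integrable_expabs_cos.
  by rewrite Rintegral_expabs_cos// big_ord_recl.
- rewrite Rintegral_tuple_succ//; last first.
    move=> x; under eq_fun do rewrite sE.
    by apply: integrable_EFinD; exact: jZ.
  transitivity (\int[leb]_x (expabs e x * sin (s ord0 * x) * \prod_i poisson e (s' i)))%R.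
    apply: eq_Rintegral => x _; under eq_Rintegral do rewrite sE.
    rewrite RintegralD//; [|exact: jZ|exact: jZ].
    by rewrite RintegralZl// RintegralZl// IHc IHs mulr0 addr0.
  rewrite RintegralZr//; last exact: integrable_expabs_sin.
  by rewrite Rintegral_expabs_sin// mul0r.
Qed.

Definition upd n (t : n.-tuple RT) (j : 'I_n) (s : R) : n.-tuple RT :=
  [tuple (if i == j then s else tnth t i) | i < n].

(** If [j] is the first coordinate, Fubini integrates it innermost and [integral_derive_eq0]
    applies. Otherwise the first coordinate [x] is frozen, its kernel [poisson 1 x] joins the
    constant, and induction applies. *)
Lemma Rintegral_partial_eq0 n (j : 'I_n) (H H' : n.-tuple RT -> R) (C : R) :
  measurable_fun setT H' ->
  (forall t, `|H t| <= C * pois 1 (fun=> 0) t) ->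
  (forall t, `|H' t| <= C * pois 1 (fun=> 0) t) ->
  (forall t s, is_derive s (1 : R) (fun s => H (upd t j s)) (H' (upd t j s))) ->
  (forall t, continuous (fun s => H' (upd t j s))) ->
  (\int[mu n]_t (H' t)%:E = 0)%E.
Proof.
elim: n j H H' C => [|n IH] j H H' C; first by case: j.
move=> mH' HC H'C dH cH'.
have int : (mu n.+1).-integrable setT (EFin \o H').
  by apply: (integrable_dominated mH' _ H'C); exact: integrable_pois.
have pE x (t : n.-tuple RT) : pois 1 (fun=> 0) (tcons (x, t)) = poisson 1 x * pois 1 (fun=> 0) t.
  rewrite /pois big_ord_recl tnth_tcons0 subr0; congr (_ * _).
  by apply: eq_bigr => i _; rewrite tnth_tconsS.
have := unliftP ord0 j; case=> [i ji|j0].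
  rewrite integral_tuple_succ// integral0_eq// => x _.
  have uE (t : n.-tuple RT) s : upd (tcons (x, t)) j s = tcons (x, upd t i s).
    apply: eq_from_tnth => k; rewrite tnth_mktuple.
    have := unliftP ord0 k; case=> [k' ->|->].
      by rewrite tnth_tconsS tnth_tconsS tnth_mktuple ji (inj_eq lift_inj).
    by rewrite ji.
  apply: (IH i (fun t => H (tcons (x, t))) _ (C * poisson 1 x)).
  - apply: (measurableT_comp mH').
    apply: (@measurable_cons _ _ _ RT (fun=> x) n id); [exact: measurable_cst|exact: measurable_id].
  - by move=> t; rewrite -mulrA -pE.
  - by move=> t; rewrite -mulrA -pE.
  - by move=> t s; have := dH (tcons (x, t)) s; under eq_fun do rewrite uE; rewrite uE.
  - by move=> t s; have := cH' (tcons (x, t)) s; under eq_fun do rewrite uE.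
rewrite integral_tuple_succ_swap// integral0_eq// => t _.
have uE x s : upd (tcons (x, t)) j s = tcons (s, t).
  apply: eq_from_tnth => k; rewrite tnth_mktuple.
  have := unliftP ord0 k; case=> [k' ->|->]; last by rewrite j0 eqxx.
  by rewrite !tnth_tconsS j0.
have dh (s : R) : is_derive s (1 : R) (fun s => H (tcons (s, t))) (H' (tcons (s, t))).
  by have := dH (tcons ((0 : R) : RT, t)) s; under eq_fun do rewrite uE; rewrite uE.
have ch : continuous (fun s : R => H' (tcons (s, t))).
  by move=> s; have := cH' (tcons ((0 : R) : RT, t)) s; under eq_fun do rewrite uE.
have hC (f : n.+1.-tuple RT -> R) : (forall t, `|f t| <= C * pois 1 (fun=> 0) t) ->
    forall s, `|f (tcons (s, t))| <= (C * pois 1 (fun=> 0) t) * poisson 1 s.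
  by move=> fC s; rewrite mulrAC -mulrA -pE.
have h0 := integral_derive_eq0 dh ch (hC H HC) (hC H' H'C).
have hi : leb.-integrable setT (EFin \o (fun s : R => H' (tcons (s, t)))).
  apply: (@integrable_dominated _ RT leb (fun s => H' (tcons (s, t)))
      (fun s => poisson 1 (s - 0)) (C * pois 1 (fun=> 0) t)).
  - exact: continuous_measurable_fun.
  - apply/integrableP; split.
      by apply/measurable_EFinP; apply: continuous_measurable_fun; exact: cont_shift.
    under eq_integral do rewrite /= ger0_norm ?(ltW (poisson_gt0 _ ltr01))//.
    by rewrite integral_poisson// ltry.
  - by move=> s; rewrite subr0; exact: hC.
rewrite -[LHS](fineK (integrable_fin_num measurableT hi)).
by rewrite -[fine _]/(\int[leb]_x H' (tcons (x, t)))%R h0.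
Qed.

End tuple_integrals.

(** * Integrals of functions of row vectors *)

Section row_integrals.
Context (R : realType) (N : nat).
Local Notation RT := (measurableTypeR R).
Local Notation mu := (lebesgue_measure_tuple R N).
Local Notation V := 'rV[R]_N.
Local Notation row := (@row_of_tuple R N).
Implicit Types (u v h : V -> R) (x y c xi : V).

Lemma measurable_countable_comp d (T : measurableType d) (I : countType)
    (F : T -> I) (g : I -> R) :
  (forall i, measurable (F @^-1` [set i])) -> measurable_fun setT (g \o F).
Proof.
move=> mF _ Y _; rewrite setTI.
have -> : (g \o F) @^-1` Y = \bigcup_n (if unpickle n is Some i then
    (if `[< Y (g i) >] then F @^-1` [set i] else set0) else set0).
  apply/seteqP; split => [t Yt|t [n _]].
    by exists (pickle (F t)) => //; rewrite pickleK asboolT.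
  by case: unpickle => // i; case: asboolP => // Yi Fi; rewrite /= Fi.
apply: bigcupT_measurable => n; case: unpickle => // i.
by case: asboolP => // _; exact: mF.
Qed.

Lemma mx_norm_le (x : V) (e : R) : 0 <= e -> (forall i, `|x 0 i| <= e) -> `|x| <= e.
Proof.
move=> e0 xe; rewrite -[`|x|]/(mx_norm x) mx_normrE; apply: bigmax_le => // -[i j] _ /=.
by rewrite ord1.
Qed.

(* A continuous function is the limit of its compositions with the coordinatewise
   roundings to the lattices [(k + 1)^-1 Z^N], which have countable range. *)
Lemma measurable_row h : continuous h -> measurable_fun setT (h \o row).
Proof.
move=> ch.
pose F (k : nat) (t : N.-tuple RT) : {ffun 'I_N -> int} :=
  [ffun i => Num.floor (tnth t i * k.+1%:R)].
pose G (k : nat) (z : {ffun 'I_N -> int}) : V := \row_i ((z i)%:~R / k.+1%:R).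
apply: (@measurable_fun_cvg _ _ _ setT (fun k => (h \o G k) \o F k)).
  move=> k; apply: measurable_countable_comp => z.
  have -> : F k @^-1` [set z] = \bigcap_(i in [set: 'I_N])
      ((fun t : N.-tuple RT => tnth t i * k.+1%:R) @^-1` [set` `[(z i)%:~R, (z i + 1)%:~R[]).
    apply/seteqP; split => [t /= <-|t].
      by move=> i _ /=; rewrite in_itv/= ffunE floor_itv.
    move=> Ft; apply/ffunP => i; rewrite ffunE; apply: floor_def.
    by have := Ft i I; rewrite /= in_itv.
  apply: fin_bigcap_measurable => [|i _]; first exact: finite_finset.
  rewrite -[X in measurable X]setTI.
  have : measurable_fun [set: N.-tuple RT] (fun t => tnth t i * k.+1%:R).
    by apply: measurable_funM; [exact: measurable_tnth|exact: measurable_cst].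
  by apply => //; exact: measurable_itv.
move=> t _ /=; apply: (cvg_comp (fun k => G k (F k t)) h _ (ch (row t))).
apply/cvgrPdist_le => e e0; near=> k.
apply: mx_norm_le (ltW e0) _ => i; rewrite !mxE ffunE.
set s := tnth t i; have k0 : 0 < k.+1%:R :> R by rewrite ltr0n.
have /andP[f1 f2] := floor_itv (s * k.+1%:R).
apply: (@le_trans _ _ (k.+1%:R^-1)); last first.
  rewrite invf_ple ?posrE//; near: k.
  exists (Num.bound e^-1) => // m /= m1.
  apply: le_trans (ltW (archi_boundP _)) _; first by rewrite invr_ge0 ltW.
  by rewrite ler_nat (leq_trans m1).
have -> : s - (Num.floor (s * k.+1%:R))%:~R / k.+1%:R =
    (s * k.+1%:R - (Num.floor (s * k.+1%:R))%:~R) / k.+1%:R.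
  by field; rewrite gt_eqF.
rewrite normrM normfV (gtr0_norm k0) ler_pdivrMr// mulVf ?gt_eqF//.
rewrite ger0_norm ?subr_ge0//; move: f2; rewrite intrD; lra.
Unshelve. all: by end_near. Qed.

Definition RI h : R := (\int[mu]_t h (row t))%R.

Definition Lint h := mu.-integrable setT (EFin \o (h \o row)).

(** The integrable majorant centred at [c]. Its integral is [(2 * pi) ^+ N] for every [c], so
    estimates relative to it are uniform in the centre. *)
Definition wt c x : R := \prod_i poisson 1 (x 0 i - c 0 i).

Lemma wt_row c t : wt c (row t) = pois 1 (fun i => c 0 i) t.
Proof. by rewrite /wt /pois; apply: eq_bigr => i _; rewrite mxE. Qed.

Lemma wt_gt0 c x : 0 < wt c x.
Proof. by apply: prodr_gt0 => i _; exact: poisson_gt0. Qed.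

Definition nsq x : R := \sum_i x 0 i ^+ 2.

Lemma nsq_ge0 x : 0 <= nsq x.
Proof. by apply: sumr_ge0 => i _; exact: sqr_ge0. Qed.

Lemma sqr_le_nsq x i : x 0 i ^+ 2 <= nsq x.
Proof. by rewrite /nsq (bigD1 i)//= lerDl sumr_ge0// => j _; exact: sqr_ge0. Qed.

Lemma coord_le_nsq x i : `|x 0 i| <= 1 + nsq x.
Proof.
have := sqr_le_nsq x i; rewrite -real_normK ?num_real// => h.
by have := sqr_ge0 (`|x 0 i| - 1); have := normr_ge0 (x 0 i); lra.
Qed.

Lemma wt_ge x : ((1 + nsq x) ^+ N)^-1 <= wt 0 x.
Proof.
have n0 := nsq_ge0 x.
rewrite /wt -exprVn -[N in leLHS]card_ord -prodr_const; apply: ler_prod => i _.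
rewrite invr_ge0 addr_ge0//= mxE subr0 /poisson mulr1 expr1n.
have xi := sqr_le_nsq x i; have x0 := sqr_ge0 (x 0 i).
rewrite ler_pdivlMr; last lra.
rewrite mulrC ler_pdivrMr; last lra.
by lra.
Qed.

Lemma RintegralwtE c : (\int[mu]_t wt c (row t))%R = (2 * pi) ^+ N.
Proof.
rewrite /Rintegral -[RHS]/(fine ((2 * pi) ^+ N)%:E).
rewrite -(@integral_pois R N 1 (fun i => c 0 i) ltr01); congr fine.
by apply: eq_integral => t _; rewrite wt_row.
Qed.

Lemma Lint_wt c : Lint (wt c).
Proof.
apply: eq_integrable (integrable_pois (fun i => c 0 i) ltr01) => // t _ /=.
by rewrite wt_row.
Qed.

Lemma Lint_dominated c h (C : R) : continuous h -> (forall x, `|h x| <= C * wt c x) ->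
  Lint h.
Proof.
move=> ch hC; apply: (@integrable_dominated _ _ _ _ _ (wt c \o row) C).
- exact: measurable_row.
- exact: Lint_wt.
- by move=> t; exact: hC.
Qed.

Lemma RI_dominated c h (C : R) : continuous h -> (forall x, `|h x| <= C * wt c x) ->
  `|RI h| <= C * (2 * pi) ^+ N.
Proof.
move=> ch hC; rewrite -(RintegralwtE c).
apply: (@Rintegral_dominated _ _ _ _ (h \o row) (wt c \o row)).
- exact: measurable_row.
- exact: Lint_wt.
- by move=> t; exact: hC.
Qed.

Lemma RID u v : Lint u -> Lint v -> RI (fun x => u x + v x) = RI u + RI v.
Proof. by move=> iu iv; rewrite /RI RintegralD. Qed.

Lemma RIB u v : Lint u -> Lint v -> RI (fun x => u x - v x) = RI u - RI v.
Proof. by move=> iu iv; rewrite /RI RintegralB. Qed.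

Lemma RIZ (a : R) u : Lint u -> RI (fun x => a * u x) = a * RI u.
Proof. by move=> iu; rewrite /RI RintegralZl. Qed.

Lemma LintZ (a : R) u : Lint u -> Lint (fun x => a * u x).
Proof. by move=> iu; exact: integrable_EFinZ. Qed.

Lemma LintB u v : Lint u -> Lint v -> Lint (fun x => u x - v x).
Proof. by move=> iu iv; exact: integrable_EFinB. Qed.

Lemma row_upd (t : N.-tuple RT) (j : 'I_N) (s s0 : R) :
  row (upd t j (s + s0)) = s *: unit_vec R j + row (upd t j s0).
Proof.
apply/rowP => i; rewrite !mxE !tnth_mktuple eqxx/=.
by case: eqP => _; [rewrite mulr1|rewrite mulr0 add0r].
Qed.

Lemma continuous_row_upd t j : continuous (fun s : R => row (upd t j s)).
Proof.
have -> : (fun s : R => row (upd t j s)) = (fun s => s *: unit_vec R j + row (upd t j 0)).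
  by apply/funext => s; rewrite -row_upd addr0.
move=> s; apply: cvgD; last exact: cvg_cst.
by apply: cvgZr_tmp; exact: cvg_id.
Qed.

Lemma RI_partial_eq0 j h (C : R) : (forall x, derivable h x (unit_vec R j)) ->
  continuous ('D_(unit_vec R j) h) -> (forall x, `|h x| <= C * wt 0 x) ->
  (forall x, `|'D_(unit_vec R j) h x| <= C * wt 0 x) -> RI ('D_(unit_vec R j) h) = 0.
Proof.
move=> dh cdh hC dhC.
have w0 t : wt 0 (row t) = pois 1 (fun=> 0) t.
  by rewrite wt_row; apply: eq_bigr => i _; rewrite mxE.
transitivity (fine (0 : \bar R)) => //; congr fine.
apply: (@Rintegral_partial_eq0 R N j (h \o row) ('D_(unit_vec R j) h \o row) C) => //.
- exact: measurable_row.
- by move=> t; rewrite -w0; exact: hC.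
- by move=> t; rewrite -w0; exact: dhC.
- move=> t s /=; have dhs := dh (row (upd t j s)).
  have q : (fun r : R => r^-1 *: ((fun s => h (row (upd t j s))) (r *: 1 + s) -
      h (row (upd t j s)))) @ 0^' --> ('D_(unit_vec R j) h (row (upd t j s)) : R^o).
    rewrite (_ : (fun r : R => _) = fun r : R =>
      r^-1 *: (h (r *: unit_vec R j + row (upd t j s)) - h (row (upd t j s)))); first exact: dhs.
    by apply/funext => r; rewrite -[r *: 1]/(r * 1) mulr1 row_upd.
  by apply: DeriveDef; [apply/cvg_ex; eexists; exact: q|exact/cvg_lim].
- move=> t s; apply: (@continuous_comp R V R (fun s => row (upd t j s)) ('D_(unit_vec R j) h) s).
    exact: continuous_row_upd.
  exact: cdh.
Qed.

End row_integrals.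

(** * The Fourier transform *)

Section continuous_real_functions.
Context (R : realType) (T : topologicalType).
Implicit Types f g : T -> R.

Lemma contD f g : continuous f -> continuous g -> continuous (fun x => f x + g x).
Proof. by move=> cf cg x; exact: cvgD (cf x) (cg x). Qed.

Lemma contB f g : continuous f -> continuous g -> continuous (fun x => f x - g x).
Proof. by move=> cf cg x; exact: cvgB (cf x) (cg x). Qed.

Lemma contM f g : continuous f -> continuous g -> continuous (fun x => f x * g x).
Proof. by move=> cf cg x; exact: cvgM (cf x) (cg x). Qed.

Lemma contN f : continuous f -> continuous (fun x => - f x).
Proof. by move=> cf x; exact: cvgN (cf x). Qed.

Lemma cont_comp (h : R -> R) f : continuous h -> continuous f -> continuous (h \o f).
Proof. by move=> ch cf x; exact: continuous_comp (cf x) (ch (f x)). Qed.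

End continuous_real_functions.

Section trigonometric_bounds.
Context (R : realType).
Implicit Types (h a b x : R).

Let mvt_bound (f f' : R -> R) h (M : R) :
  (forall x, is_derive x (1 : R) f (f' x)) ->
  (forall c, `|c| <= `|h| -> `|f' c| <= M) -> `|f h - f 0| <= M * `|h|.
Proof.
move=> df fM.
have cf a b : {within `[a, b], continuous f}.
  by apply: derivable_within_continuous => x _; case: (df x).
have [h0|h0|->] := ltgtP h 0; last by rewrite subrr !normr0 mulr0.
  have [c /[!in_itv]/= /andP[c1 c2] fc] := MVT h0 (fun x _ => df x) (cf _ _).
  rewrite distrC fc normrM sub0r normrN ler_wpM2r// fM//.
  by rewrite !ltr0_norm// lerN2 ltW.
have [c /[!in_itv]/= /andP[c1 c2] fc] := MVT h0 (fun x _ => df x) (cf _ _).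
rewrite fc normrM subr0 ler_wpM2r// fM//.
by rewrite !gtr0_norm// ltW.
Qed.

Lemma norm_sin_le h : `|sin h| <= `|h|.
Proof.
have := @mvt_bound sin cos h 1 (@is_derive_sin R); rewrite sin0 subr0 mul1r.
by apply => c _; exact: cos_max.
Qed.

Lemma norm_cosB1_le h : `|cos h - 1| <= `|h|.
Proof.
have := @mvt_bound cos (fun x => - sin x) h 1 (@is_derive_cos R); rewrite cos0 mul1r.
by apply => c _; rewrite normrN; exact: sin_max.
Qed.

Lemma norm_cosB1_le_sqr h : `|cos h - 1| <= h ^+ 2.
Proof.
have := @mvt_bound cos (fun x => - sin x) h `|h| (@is_derive_cos R).
rewrite cos0 -expr2 real_normK ?num_real//; apply => c ch.
by rewrite normrN; exact: le_trans (norm_sin_le c) ch.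
Qed.

Lemma norm_sinB_le_sqr h : `|sin h - h| <= h ^+ 2.
Proof.
have d (x : R) : is_derive x (1 : R) (fun x => sin x - x) (cos x - 1).
  exact: is_deriveB (is_derive_sin _) (is_derive_id _ _).
have := @mvt_bound (fun x => sin x - x) (fun x => cos x - 1) h `|h| d.
rewrite sin0 !subr0 -expr2 real_normK ?num_real//; apply => c ch.
exact: le_trans (norm_cosB1_le c) ch.
Qed.

Lemma norm_trig_le a b x : `|a * cos x + b * sin x| <= `|a| + `|b|.
Proof.
apply: le_trans (ler_normD _ _) _; rewrite !normrM.
by rewrite lerD// ler_piMr// ?cos_max ?sin_max.
Qed.

Lemma trig_lipschitz a b x h :
  `|a * cos (x + h) + b * sin (x + h) - (a * cos x + b * sin x)|
    <= 2 * (`|a| + `|b|) * `|h|.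
Proof.
rewrite cosD sinD (_ : _ - _ = (a * cos x + b * sin x) * (cos h - 1) +
   (b * cos x + - a * sin x) * sin h); last by ring.
apply: le_trans (ler_normD _ _) _; rewrite !normrM.
have h1 := norm_trig_le a b x; have h2 := norm_trig_le b (- a) x; rewrite normrN in h2.
have : `|a * cos x + b * sin x| * `|cos h - 1| <= (`|a| + `|b|) * `|h|.
  by rewrite ler_pM// norm_cosB1_le.
have : `|b * cos x + - a * sin x| * `|sin h| <= (`|b| + `|a|) * `|h|.
  by rewrite ler_pM// norm_sin_le.
lra.
Qed.

(** The constant is uniform in [x]; this permits differentiation under the integral by a direct
    estimate. *)
Lemma trig_taylor a b x h :
  `|a * cos (x + h) + b * sin (x + h) - (a * cos x + b * sin x) -
    h * (b * cos x + - a * sin x)| <= 2 * (`|a| + `|b|) * h ^+ 2.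
Proof.
rewrite cosD sinD (_ : _ - _ - _ = (a * cos x + b * sin x) * (cos h - 1) +
   (b * cos x + - a * sin x) * (sin h - h)); last by ring.
apply: le_trans (ler_normD _ _) _; rewrite !normrM.
have h1 := norm_trig_le a b x; have h2 := norm_trig_le b (- a) x; rewrite normrN in h2.
have : `|a * cos x + b * sin x| * `|cos h - 1| <= (`|a| + `|b|) * h ^+ 2.
  by rewrite ler_pM// norm_cosB1_le_sqr.
have : `|b * cos x + - a * sin x| * `|sin h - h| <= (`|b| + `|a|) * h ^+ 2.
  by rewrite ler_pM// norm_sinB_le_sqr.
lra.
Qed.

End trigonometric_bounds.

Section real_fourier.
Context (R : realType) (N : nat).
Local Notation V := 'rV[R]_N.
Implicit Types (u v : V -> R) (x y c xi : V) (s : seq 'I_N).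

(* For [f = u + i v], the real and imaginary parts of the Fourier transform of [f]
   are [trigint u v] and [trigint v (- u)]. *)
Definition trigint u v xi :=
  RI (fun x => u x * cos (dot x xi) + v x * sin (dot x xi)).

Lemma dotDr x xi eta : dot x (xi + eta) = dot x xi + dot x eta.
Proof. by rewrite /dot -big_split/=; apply: eq_bigr => i _; rewrite mxE mulrDr. Qed.

Lemma dotDl x y xi : dot (x + y) xi = dot x xi + dot y xi.
Proof. by rewrite /dot -big_split/=; apply: eq_bigr => i _; rewrite mxE mulrDl. Qed.

Lemma dot_unitr x (t : R) j : dot x (t *: unit_vec R j) = t * x 0 j.
Proof.
rewrite /dot (bigD1 j)//= !mxE !eqxx big1 ?addr0; first by rewrite mulr1 mulrC.
by move=> i ij; rewrite !mxE (negPf ij) andbF mulr0 mulr0.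
Qed.

Lemma dotC x xi : dot x xi = dot xi x.
Proof. by apply: eq_bigr => i _; rewrite mulrC. Qed.

Lemma continuous_dot xi : continuous (fun x => dot x xi).
Proof.
rewrite /dot; elim: (index_enum _) => [|i e IH].
  by under eq_fun do rewrite big_nil; exact: cst_continuous.
under eq_fun do rewrite big_cons.
apply: contD => //; apply: contM; first exact: coord_continuous.
exact: cst_continuous.
Qed.

Lemma continuous_trig u v xi : continuous u -> continuous v ->
  continuous (fun x => u x * cos (dot x xi) + v x * sin (dot x xi)).
Proof.
move=> cu cv; apply: contD; apply: contM => //.
  exact: cont_comp (@continuous_cos R) (@continuous_dot xi).
exact: cont_comp (@continuous_sin R) (@continuous_dot xi).
Qed.

Lemma coord_norm_le x i : `|x 0 i| <= `|x|.
Proof.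
rewrite -[`|x|]/(mx_norm x) mx_normrE.
exact: (@le_bigmax _ R _ 0 (fun ij => `|x ij.1 ij.2|) (0, i)).
Qed.

Lemma norm_dot_le x xi : `|dot x xi| <= N%:R * (1 + nsq x) * `|xi|.
Proof.
apply: le_trans (ler_norm_sum _ _ _) _.
apply: (@le_trans _ _ (\sum_(i < N) (1 + nsq x) * `|xi|)).
  by apply: ler_sum => i _; rewrite normrM ler_pM// ?coord_le_nsq ?coord_norm_le.
by rewrite sumr_const card_ord -[X in X <= _]mulr_natl mulrA.
Qed.

Definition rapid u :=
  continuous u /\ forall k : nat, exists C : R, forall x, `|u x| * (1 + nsq x) ^+ k <= C.

Lemma nsq1_gt0 x : 0 < 1 + nsq x.
Proof. by rewrite ltr_pwDl// nsq_ge0. Qed.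

Lemma rapid_wt u (k : nat) : rapid u ->
  exists2 C, 0 <= C & forall x, `|u x| * (1 + nsq x) ^+ k <= C * wt 0 x.
Proof.
move=> [_ /(_ (k + N)%N)[C hC]]; exists `|C| => // x.
apply: le_trans (_ : `|C| * ((1 + nsq x) ^+ N)^-1 <= _); last by rewrite ler_wpM2l// wt_ge.
rewrite ler_pdivlMr ?exprn_gt0 ?nsq1_gt0// -mulrA -exprD.
exact: le_trans (hC x) (ler_norm C).
Qed.

Lemma rapidN u : rapid u -> rapid (fun x => - u x).
Proof.
move=> [cu hu]; split; first exact: contN.
by move=> k; have [C hC] := hu k; exists C => x; rewrite normrN.
Qed.

Lemma rapid_coord u j : rapid u -> rapid (fun x => x 0 j * u x).
Proof.
move=> [cu hu]; split.
  by apply: contM => //; exact: coord_continuous.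
move=> k; have [C hC] := hu k.+1; exists C => x; apply: le_trans (hC x).
rewrite normrM exprS [leRHS]mulrA; apply: ler_wpM2r.
  by rewrite exprn_ge0// ltW// nsq1_gt0.
by rewrite mulrC ler_wpM2l// coord_le_nsq.
Qed.

Lemma rapid_dominated2 u v : rapid u -> rapid v ->
  exists2 C, 0 <= C & forall x, (`|u x| + `|v x|) * (1 + nsq x) ^+ 2 <= C * wt 0 x.
Proof.
move=> ru rv; have [C C0 hC] := rapid_wt 2 ru; have [D D0 hD] := rapid_wt 2 rv.
exists (C + D); first exact: addr_ge0.
by move=> x; rewrite !mulrDl lerD.
Qed.

Lemma nsq_exp_ge1 x k : 1 <= (1 + nsq x) ^+ k.
Proof. by rewrite exprn_ege1// lerDl nsq_ge0. Qed.

Lemma rapid_dominated u v : rapid u -> rapid v ->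
  exists2 C, 0 <= C & forall x, `|u x| + `|v x| <= C * wt 0 x.
Proof.
move=> ru rv; have [C C0 hC] := rapid_dominated2 ru rv; exists C => // x.
by apply: le_trans (hC x); rewrite ler_peMr ?addr_ge0// nsq_exp_ge1.
Qed.

Lemma trigint_dominated c u v (C : R) xi : continuous u -> continuous v ->
  (forall x, `|u x| + `|v x| <= C * wt c x) -> `|trigint u v xi| <= C * (2 * pi) ^+ N.
Proof.
move=> cu cv uv; apply: (@RI_dominated R N c); first exact: continuous_trig.
by move=> x; apply: le_trans (norm_trig_le _ _ _) (uv x).
Qed.

Lemma Lint_trig c u v (C : R) xi : continuous u -> continuous v ->
  (forall x, `|u x| + `|v x| <= C * wt c x) ->
  Lint (fun x => u x * cos (dot x xi) + v x * sin (dot x xi)).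
Proof.
move=> cu cv uv; apply: (@Lint_dominated R N c _ C); first exact: continuous_trig.
by move=> x; apply: le_trans (norm_trig_le _ _ _) (uv x).
Qed.

Lemma continuous_trigint u v : rapid u -> rapid v -> continuous (trigint u v).
Proof.
move=> ru rv xi; have [cu _] := ru; have [cv _] := rv.
have [C C0 hC] := rapid_dominated2 ru rv.
have [D D0 hD] := rapid_dominated ru rv.
pose K := 2 * N%:R * C * (2 * pi) ^+ N.
have K0 : 0 <= K by rewrite /K !mulr_ge0 ?exprn_ge0// mulr_ge0// pi_ge0.
have lip eta : `|trigint u v xi - trigint u v eta| <= K * `|xi - eta|.
  rewrite /trigint -RIB; [|exact: Lint_trig cu cv hD..].
  apply: le_trans (_ : (2 * N%:R * C * `|xi - eta|) * (2 * pi) ^+ N <= _); last first.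
    by rewrite /K mulrAC.
  apply: (@RI_dominated R N 0).
    by apply: contB; exact: continuous_trig.
  move=> x; have -> : dot x xi = dot x eta + dot x (xi - eta) by rewrite -dotDr addrC subrK.
  apply: le_trans (trig_lipschitz _ _ _ _) _.
  have h1 := norm_dot_le x (xi - eta).
  have h2 : 0 <= 2 * (`|u x| + `|v x|) by rewrite mulr_ge0// addr_ge0.
  apply: le_trans (ler_wpM2l h2 h1) _.
  have -> : 2 * (`|u x| + `|v x|) * (N%:R * (1 + nsq x) * `|xi - eta|) =
    2 * N%:R * `|xi - eta| * ((`|u x| + `|v x|) * (1 + nsq x)) by ring.
  have -> : 2 * N%:R * C * `|xi - eta| * wt 0 x = 2 * N%:R * `|xi - eta| * (C * wt 0 x) by ring.
  rewrite ler_wpM2l ?mulr_ge0//; apply: le_trans (hC x).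
  rewrite ler_wpM2l ?addr_ge0// expr2 ler_peMr ?(ltW (nsq1_gt0 _))//.
  by rewrite lerDl nsq_ge0.
apply/(@cvgrPdist_le _ _ _ (nbhs (xi : V))) => e e0; near=> eta.
apply: le_trans (lip eta) _.
apply: (@le_trans _ _ (K * (e / (K + 1)))); last first.
  by rewrite mulrA ler_pdivrMr ?ltr_wpDl// mulrC ler_wpM2l ?(ltW e0)// lerDl.
rewrite ler_wpM2l//; near: eta.
by apply: cvgr_dist_le; rewrite ?divr_gt0 ?ltr_wpDl//; exact: cvg_id.
Unshelve. all: by end_near. Qed.

(** The integrated Taylor remainder is quadratic in [t]: [trig_taylor] produces [x 0 j ^+ 2], which
    two powers of [1 + nsq x] absorb. *)
Lemma is_derive_trigint u v xi j : rapid u -> rapid v ->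
  is_derive xi (unit_vec R j) (trigint u v)
    (trigint (fun x => x 0 j * v x) (fun x => - (x 0 j * u x)) xi).
Proof.
move=> ru rv; have [cu _] := ru; have [cv _] := rv.
have [C C0 hC] := rapid_dominated2 ru rv.
have [D D0 hD] := rapid_dominated ru rv.
have rju := rapidN (rapid_coord j ru); have rjv := rapid_coord j rv.
have [E E0 hE] := rapid_dominated rjv rju.
set l := trigint _ _ xi.
pose K := 2 * C * (2 * pi) ^+ N.
have K0 : 0 <= K by rewrite /K !mulr_ge0 ?exprn_ge0// mulr_ge0// pi_ge0.
have taylor (t : R) : `|trigint u v (t *: unit_vec R j + xi) - trigint u v xi - t * l|
    <= K * t ^+ 2.
  have iE := Lint_trig xi rjv.1 rju.1 hE.
  rewrite /l /trigint -RIB; [|exact: Lint_trig cu cv hD..].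
  rewrite -RIZ// -RIB; [|apply: LintB; exact: Lint_trig cu cv hD|exact: LintZ].
  apply: le_trans (_ : (2 * C * t ^+ 2) * (2 * pi) ^+ N <= _); last by rewrite /K mulrAC.
  apply: (@RI_dominated R N 0).
    apply: contB; first by apply: contB; exact: continuous_trig.
    apply: contM; first exact: cst_continuous.
    exact (continuous_trig rjv.1 rju.1).
  move=> x; have -> : dot x (t *: unit_vec R j + xi) = dot x xi + t * x 0 j.
    by rewrite dotDr dot_unitr addrC.
  have -> : t * (x 0 j * v x * cos (dot x xi) + - (x 0 j * u x) * sin (dot x xi)) =
    (t * x 0 j) * (v x * cos (dot x xi) + - u x * sin (dot x xi)) by ring.
  apply: le_trans (trig_taylor _ _ _ _) _.
  have -> : 2 * (`|u x| + `|v x|) * (t * x 0 j) ^+ 2 =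
    2 * t ^+ 2 * ((`|u x| + `|v x|) * x 0 j ^+ 2) by ring.
  have -> : 2 * C * t ^+ 2 * wt 0 x = 2 * t ^+ 2 * (C * wt 0 x) by ring.
  apply: ler_wpM2l; first by rewrite mulr_ge0// sqr_ge0.
  apply: le_trans (hC x).
  rewrite ler_wpM2l ?addr_ge0//.
  have := sqr_le_nsq x j; have := nsq_ge0 x; have := sqr_ge0 (nsq x); lra.
have q : (fun t : R => t^-1 *: (trigint u v (t *: unit_vec R j + xi) - trigint u v xi))
    @ 0^' --> (l : R^o).
  apply/cvgrPdist_le => e e0; near=> t.
  have t0 : t != 0 by near: t; exact: nbhs_dnbhs_neq.
  have nt0 : 0 < `|t| by rewrite normr_gt0.
  rewrite -[t^-1 *: _]/(t^-1 * _) distrC.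
  have -> : t^-1 * (trigint u v (t *: unit_vec R j + xi) - trigint u v xi) - l =
    t^-1 * (trigint u v (t *: unit_vec R j + xi) - trigint u v xi - t * l).
    by field.
  rewrite normrM normfV ler_pdivrMl//; apply: le_trans (taylor t) _.
  rewrite -real_normK ?num_real// expr2 mulrA mulrC ler_wpM2l//.
  have h : `|t| <= e / (K + 1).
    near: t; apply: nbhs_dnbhs; apply/nbhs_normP; exists (e / (K + 1)) => /=.
      by rewrite divr_gt0// ltr_wpDl.
    by move=> t /=; rewrite sub0r normrN => /ltW.
  apply: le_trans (ler_wpM2l K0 h) _.
  by rewrite mulrA ler_pdivrMr ?ltr_wpDl// mulrC ler_wpM2l ?(ltW e0)// lerDl.
by apply: DeriveDef; [apply/cvg_ex; exists l|exact/cvg_lim].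
Unshelve. all: by end_near. Qed.

Lemma partial_trigint u v j : rapid u -> rapid v -> 'D_(unit_vec R j) (trigint u v) =
  trigint (fun x => x 0 j * v x) (fun x => - (x 0 j * u x)).
Proof.
by move=> ru rv; apply/funext => xi; have [_ ->] := is_derive_trigint xi j ru rv.
Qed.

Lemma rsmooth_trigint u v : rapid u -> rapid v -> rsmooth (trigint u v).
Proof.
move=> ru rv k; elim: k u v ru rv => [|k IH] u v ru rv /=; first exact: continuous_trigint.
split; first exact: continuous_trigint.
move=> j; split; first by move=> xi; case: (is_derive_trigint xi j ru rv).
rewrite partial_trigint//; apply: IH; first exact: rapid_coord.
by apply: rapidN; exact: rapid_coord.
Qed.

(* Multiplication of [u + i v] by the product of the [- i x_j], for [j] in [s]. *)
Definition mulw s u v : (V -> R) * (V -> R) :=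
  foldr (fun j p => (fun x => x 0 j * p.2 x, fun x => - (x 0 j * p.1 x))) (u, v) s.

Lemma rapid_mulw s u v : rapid u -> rapid v ->
  rapid (mulw s u v).1 /\ rapid (mulw s u v).2.
Proof.
move=> ru rv; elim: s => //= j s [r1 r2]; split; first exact: rapid_coord.
by apply: rapidN; exact: rapid_coord.
Qed.

Lemma rderw_trigint s u v : rapid u -> rapid v ->
  rderw s (trigint u v) = trigint (mulw s u v).1 (mulw s u v).2.
Proof.
move=> ru rv; elim: s => //= j s ->; have [r1 r2] := rapid_mulw s ru rv.
by rewrite partial_trigint.
Qed.

Lemma is_derive_dot_comp (g : R -> R) (l : R) x xi j :
  is_derive (dot x xi) (1 : R) g l ->
  is_derive x (unit_vec R j) (fun x => g (dot x xi)) (l * xi 0 j).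
Proof.
move=> dg.
have d0 : is_derive (0 : R) (1 : R) (fun t : R => xi 0 j * t + dot x xi) (xi 0 j).
  have d1 : is_derive (0 : R) (1 : R) (xi 0 j \*: id + cst (dot x xi)) (xi 0 j *: 1 + 0) :=
    is_deriveD (@is_deriveZ _ _ _ _ _ _ _ _ (is_derive_id _ _)) (is_derive_cst _ _ _).
  by move/is_derive_eq: d1; apply; rewrite addr0 -[LHS]/(_ * _) mulr1.
have := @is_derive1_comp _ g (fun t : R => xi 0 j * t + dot x xi) 0 l (xi 0 j).
rewrite mulr0 add0r => /(_ dg d0) [d2 d3].
have q : (fun t : R => t^-1 *: ((fun x => g (dot x xi)) (t *: unit_vec R j + x) - g (dot x xi)))
    @ 0^' --> (l * xi 0 j : R^o).
  rewrite -d3; move: d2; rewrite /derivable /derive.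
  rewrite (_ : (fun h : R => h^-1 *: _) = fun t : R =>
    t^-1 *: (g (dot (t *: unit_vec R j + x) xi) - g (dot x xi))) //.
  apply/funext => t /=; rewrite -[t *: 1]/(t * 1) mulr1 addr0 mulr0 add0r.
  by rewrite dotDl (dotC (t *: _)) dot_unitr (mulrC t).
by apply: DeriveDef; [apply/cvg_ex; eexists; exact: q|exact/cvg_lim].
Qed.

(** Integration by parts: the [j]-th derivative of the whole integrand [h] integrates to 0 by
    [RI_partial_eq0]. *)
Lemma trigint_partial u v j xi : rsmooth u -> rsmooth v -> rapid u -> rapid v ->
  rapid ('D_(unit_vec R j) u) -> rapid ('D_(unit_vec R j) v) ->
  trigint ('D_(unit_vec R j) u) ('D_(unit_vec R j) v) xi =
    - (xi 0 j * trigint v (fun x => - u x) xi).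
Proof.
move=> us vs ru rv rdu rdv; have rNu := rapidN ru.
pose h x := u x * cos (dot x xi) + v x * sin (dot x xi).
pose h1 x := 'D_(unit_vec R j) u x * cos (dot x xi) + 'D_(unit_vec R j) v x * sin (dot x xi).
pose h2 x := v x * cos (dot x xi) + - u x * sin (dot x xi).
have dh x : is_derive x (unit_vec R j) h (h1 x + xi 0 j * h2 x).
  have dc := @is_derive_dot_comp _ _ x xi j (is_derive_cos _).
  have ds := @is_derive_dot_comp _ _ x xi j (is_derive_sin _).
  have du : is_derive x (unit_vec R j) u ('D_(unit_vec R j) u x).
    by apply: DeriveDef => //; exact: rsmooth_derivable.
  have dv : is_derive x (unit_vec R j) v ('D_(unit_vec R j) v x).
    by apply: DeriveDef => //; exact: rsmooth_derivable.
  have := is_deriveD (is_deriveM du dc) (is_deriveM dv ds).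
  move=> /is_derive_eq; apply; rewrite -![_ *: _]/(_ * _) /h1 /h2; ring.
have dhE : 'D_(unit_vec R j) h = fun x => h1 x + xi 0 j * h2 x.
  by apply/funext => x; have [_ ->] := dh x.
have [C C0 hC] := rapid_dominated ru rv.
have [D D0 hD] := rapid_dominated rdu rdv.
have [E E0 hE] := rapid_dominated rv rNu.
have i1 : Lint h1 := Lint_trig xi rdu.1 rdv.1 hD.
have i2 : Lint h2 := Lint_trig xi rv.1 rNu.1 hE.
have : RI ('D_(unit_vec R j) h) = 0.
  apply: (@RI_partial_eq0 R N j h (C + D + `|xi 0 j| * E)).
  - by move=> x; case: (dh x).
  - rewrite dhE; apply: contD; first exact: continuous_trig xi rdu.1 rdv.1.
    apply: (@contM R V (fun=> xi 0 j) h2); first exact: cst_continuous.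
    exact: continuous_trig rv.1 rNu.1.
  - move=> x; apply: le_trans (le_trans (norm_trig_le _ _ _) (hC x)) _.
    by rewrite ler_wpM2r ?(ltW (wt_gt0 _ _))// -addrA lerDl addr_ge0// mulr_ge0.
  - move=> x; have [_ ->] := dh x; apply: le_trans (ler_normD _ _) _; rewrite normrM.
    have a1 := le_trans (norm_trig_le _ _ (dot x xi)) (hD x).
    have a2 := ler_wpM2l (normr_ge0 (xi 0 j)) (le_trans (norm_trig_le _ _ (dot x xi)) (hE x)).
    apply: le_trans (lerD a1 a2) _; rewrite mulrA -mulrDl.
    by rewrite ler_wpM2r ?(ltW (wt_gt0 _ _))// -addrA lerDr.
rewrite dhE RID//; last exact: LintZ.
by rewrite RIZ// => /eqP; rewrite addr_eq0 => /eqP.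
Qed.

End real_fourier.

Section Fubini_dominated.
Context (R : realType) d1 d2 (T1 : measurableType d1) (T2 : measurableType d2).
Variables (m1 : {sigma_finite_measure set T1 -> \bar R}).
Variables (m2 : {sigma_finite_measure set T2 -> \bar R}).

Lemma Rintegral_swap (F : T1 * T2 -> R) (g : T1 -> R) (k : T2 -> R) (C : R) :
  measurable_fun setT F -> m1.-integrable setT (EFin \o g) ->
  m2.-integrable setT (EFin \o k) -> (forall x, 0 <= g x) -> (forall y, 0 <= k y) ->
  (forall x y, `|F (x, y)| <= C * (g x * k y)) ->
  (\int[m1]_x (\int[m2]_y F (x, y)) = \int[m2]_y (\int[m1]_x F (x, y)))%R.
Proof.
move=> mF gi ki g0 k0 hF.
have /integrableP[/measurable_EFinP mg goo] := gi.
have /integrableP[/measurable_EFinP mk koo] := ki.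
have mgk : measurable_fun setT (fun p : T1 * T2 => g p.1 * k p.2).
  apply: measurable_funM; first exact: (measurableT_comp mg).
  exact: (measurableT_comp mk).
have gki : (m1 \x m2)%E.-integrable setT (EFin \o (fun p => g p.1 * k p.2)).
  apply/integrable12ltyP; first exact/measurable_EFinP.
  have kE : (\int[m2]_y (k y)%:E = (\int[m2]_y k y)%R%:E)%E.
    by rewrite /Rintegral fineK//; exact: integrable_fin_num.
  under eq_integral => x _.
    under eq_integral do rewrite /= ger0_norm ?mulr_ge0// EFinM.
    rewrite integralZl//= kE -EFinM mulrC EFinM.
    over.
  rewrite integralZl//=.
  have gE : (\int[m1]_y (g y)%:E = (\int[m1]_y g y)%R%:E)%E.
    by rewrite /Rintegral fineK//; exact: integrable_fin_num.
  by rewrite gE -EFinM ltry.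
have Fi : (m1 \x m2)%E.-integrable setT (EFin \o F).
  by apply: (@integrable_dominated _ _ _ _ _ (fun p => g p.1 * k p.2) C) => // -[x y]; exact: hF.
have F1 x : m2.-integrable setT (EFin \o (fun y => F (x, y))).
  apply: (@integrable_dominated _ _ _ _ _ k (C * g x)) => //.
    exact: (measurableT_comp mF).
  by move=> y; rewrite -mulrA.
have F2 y : m1.-integrable setT (EFin \o (fun x => F (x, y))).
  apply: (@integrable_dominated _ _ _ _ _ g (C * k y)) => //.
    exact: (measurableT_comp mF).
  by move=> x; rewrite -mulrA [_ * g x]mulrC.
rewrite /Rintegral; congr fine.
transitivity (\int[m1]_x \int[m2]_y (F (x, y))%:E)%E.
  by apply: eq_integral => x _; rewrite fineK//; exact: integrable_fin_num (F1 x).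
rewrite (integral12_prod_meas1 Fi) -(integral21_prod_meas1 Fi).
by apply: eq_integral => y _; rewrite fineK//; exact: integrable_fin_num (F2 y).
Qed.

End Fubini_dominated.

(** * Fourier inversion as a supremum bound *)

Section Fourier_inversion_bound.
Context (R : realType) (N : nat).
Local Notation V := 'rV[R]_N.
Local Notation RT := (measurableTypeR R).
Local Notation mu := (lebesgue_measure_tuple R N).
Local Notation row := (@row_of_tuple R N).
Variables (u v : V -> R) (x : V) (B C : R).
Hypotheses (cu : continuous u) (cv : continuous v).
Hypothesis uvC : forall y, `|u y| + `|v y| <= C * wt 0 y.

Let sh (t : N.-tuple RT) (i : 'I_N) := tnth t i - x 0 i.

Let C0 : 0 <= C.
Proof.
have h := le_trans (addr_ge0 (normr_ge0 _) (normr_ge0 _)) (uvC 0).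
by rewrite -(@pmulr_lge0 _ (wt 0 (0 : V))) ?wt_gt0.
Qed.

Let dot_phase t tau : dot (row t - x) (row tau) = phase (sh t) tau.
Proof. by apply: eq_bigr => i _; rewrite !mxE. Qed.

(* The translated transform, damped by the factors [expabs e], whose Fourier
   transforms are the Poisson kernels. *)
Let damped e (p : N.-tuple RT * N.-tuple RT) : R := kexp e p.2 *
  (u (row p.1) * cos (phase (sh p.1) p.2) + v (row p.1) * sin (phase (sh p.1) p.2)).

Let measurable_damped e : measurable_fun setT (damped e).
Proof.
have mph : measurable_fun setT (fun p : N.-tuple RT * N.-tuple RT => phase (sh p.1) p.2).
  rewrite /phase /sh; elim: (index_enum _) => [|i s IH].
    by under eq_fun do rewrite big_nil; exact: measurable_cst.
  under eq_fun do rewrite big_cons.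
  apply: measurable_funD => //; apply: measurable_funM; last first.
    by apply: (measurableT_comp (measurable_tnth i)).
  apply: measurable_funB; last exact: measurable_cst.
  by apply: (measurableT_comp (measurable_tnth i)).
apply: measurable_funM.
  by apply: (measurableT_comp (@measurable_kexp R N e)).
apply: measurable_funD; apply: measurable_funM.
- by apply: (measurableT_comp (measurable_row cu)).
- exact: (measurableT_comp (continuous_measurable_fun (@continuous_cos R)) mph).
- by apply: (measurableT_comp (measurable_row cv)).
- exact: (measurableT_comp (continuous_measurable_fun (@continuous_sin R)) mph).
Qed.

Let damped_swap e : 0 < e ->
  (\int[mu]_tau (\int[mu]_t damped e (t, tau)) =
   \int[mu]_t (\int[mu]_tau damped e (t, tau)))%R.
Proof.
move=> e0; apply/esym.
apply: (@Rintegral_swap _ _ _ _ _ _ _ _ (wt 0 \o row) (@kexp R N e) C) => //.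
- exact: Lint_wt.
- exact: integrable_kexp.
- by move=> t; rewrite ltW// wt_gt0.
- by move=> t; exact: kexp_ge0.
- move=> t tau; rewrite normrM ger0_norm ?kexp_ge0// mulrA mulrC ler_wpM2r ?kexp_ge0//.
  exact: le_trans (norm_trig_le _ _ _) (uvC _).
Qed.

Let damped_inner e tau : (\int[mu]_t damped e (t, tau))%R = kexp e tau *
  (trigint u v (row tau) * cos (dot x (row tau)) -
   trigint v (fun y => - u y) (row tau) * sin (dot x (row tau))).
Proof.
have i1 := @Lint_trig _ _ 0 _ _ _ (row tau) cu cv uvC.
have uvC' y : `|v y| + `|- u y| <= C * wt 0 y by rewrite normrN addrC.
have i2 := @Lint_trig _ _ 0 _ _ _ (row tau) cv (contN cu) uvC'.
have eqD t : damped e (t, tau) = kexp e tau * (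
    cos (dot x (row tau)) * (u (row t) * cos (dot (row t) (row tau)) +
                             v (row t) * sin (dot (row t) (row tau))) -
    sin (dot x (row tau)) * (v (row t) * cos (dot (row t) (row tau)) +
                             - u (row t) * sin (dot (row t) (row tau)))).
  rewrite /damped/= -dot_phase; congr (_ * _).
  have -> : dot (row t - x) (row tau) = dot (row t) (row tau) - dot x (row tau).
    by rewrite dotDl; congr (_ + _); rewrite /dot -sumrN; apply: eq_bigr => i _; rewrite !mxE mulNr.
  by rewrite cosB sinB; ring.
under eq_Rintegral do rewrite eqD.
have j1 := LintZ (cos (dot x (row tau))) i1.
have j2 := LintZ (sin (dot x (row tau))) i2.
rewrite RintegralZl//; last exact: LintB j1 j2.
congr (_ * _); rewrite -[LHS]/(RI (fun y => cos (dot x (row tau)) * (u y * cos (dot y (row tau)) +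
                             v y * sin (dot y (row tau))) -
    sin (dot x (row tau)) * (v y * cos (dot y (row tau)) +
                             - u y * sin (dot y (row tau))))).
by rewrite RIB// RIZ// RIZ// mulrC [X in _ - X]mulrC.
Qed.

Let damped_outer e t : 0 < e ->
  (\int[mu]_tau damped e (t, tau))%R = u (row t) * pois e (fun i => x 0 i) t.
Proof.
move=> e0; have [i1 i2] := integrable_kexp_trig (sh t) e0.
have [h1 h2] := Rintegral_kexp_trig (sh t) e0.
transitivity (\int[mu]_tau (u (row t) * (kexp e tau * cos (phase (sh t) tau)) +
   v (row t) * (kexp e tau * sin (phase (sh t) tau))))%R.
  by apply: eq_Rintegral => tau _; rewrite /damped/=; ring.
rewrite RintegralD//; [|exact: integrable_EFinZ|exact: integrable_EFinZ].
by rewrite RintegralZl// RintegralZl// h1 h2 mulr0 addr0.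
Qed.

Hypothesis T1 : forall xi, `|trigint u v xi| <= B * wt 0 xi.
Hypothesis T2 : forall xi, `|trigint v (fun y => - u y) xi| <= B * wt 0 xi.
Hypothesis cT1 : continuous (trigint u v).
Hypothesis cT2 : continuous (trigint v (fun y => - u y)).

(** Integrating [damped] in the two orders gives, on one side, [u] tested against the Poisson kernel
    at [x] and, on the other, a damped combination of both parts of the transform. The factor 2
    counts these parts; the bound is free of [e]. *)
Let damped_bound e : 0 < e ->
  `|(\int[mu]_t (u (row t) * pois e (fun i => x 0 i) t))%R| <= 2 * B * (2 * pi) ^+ N.
Proof.
move=> e0.
under eq_Rintegral do rewrite -(damped_outer _ e0).
rewrite -damped_swap//; under eq_Rintegral do rewrite damped_inner.
rewrite -(@RintegralwtE R N 0).
apply: (@Rintegral_dominated _ _ _ _ _ (wt 0 \o row)).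
- apply: measurable_funM; first exact: measurable_kexp.
  apply: (@measurable_row R N (fun xi => trigint u v xi * cos (dot x xi) -
    trigint v (fun y => - u y) xi * sin (dot x xi))).
  have cd : continuous (fun xi => dot x xi).
    by under eq_fun do rewrite dotC; exact: continuous_dot.
  apply: contB; apply: contM => //.
    exact: cont_comp (@continuous_cos R) cd.
  exact: cont_comp (@continuous_sin R) cd.
- exact: Lint_wt.
- move=> tau; rewrite normrM ger0_norm ?kexp_ge0//.
  apply: le_trans (_ : `|trigint u v (row tau)| + `|trigint v (fun y => - u y) (row tau)| <= _).
    apply: le_trans (_ : 1 * _ <= _).
      apply: ler_pM; rewrite ?kexp_ge0 ?kexp_le1//; exact: lexx.
    rewrite mul1r; apply: le_trans (ler_normB _ _) _; rewrite !normrM.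
    by rewrite lerD// ler_piMr// ?cos_max ?sin_max.
  by apply: le_trans (lerD (T1 _) (T2 _)) _; rewrite /= -mulr2n -[leLHS]mulr_natl mulrA.
Qed.

(** Bounded and quadratic at 0, so that a kernel of width [e] times [phi] is at most [e] times the
    kernel of width 1. The approximation error is thus of order [e] without splitting the domain. *)
Let phi (s : R) := s ^+ 2 / (1 + s ^+ 2).

Let phi_ge0 s : 0 <= phi s.
Proof. by rewrite divr_ge0 ?addr_ge0 ?sqr_ge0. Qed.

Let poisson_phi e s : 0 < e -> poisson e s * phi s <= e * poisson 1 s.
Proof.
move=> e0; rewrite /poisson /phi mulr1 expr1n.
have s2 := sqr_ge0 s; have e2 : 0 < e ^+ 2 by rewrite exprn_gt0.
rewrite mulf_div ler_pdivrMr; last by rewrite mulr_gt0; lra.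
have -> : e * (2 / (1 + s ^+ 2)) * ((e ^+ 2 + s ^+ 2) * (1 + s ^+ 2)) =
  e * (2 * (e ^+ 2 + s ^+ 2)) by field; lra.
have -> : 2 * e * s ^+ 2 = e * (2 * s ^+ 2) by ring.
by rewrite ler_pM2l//; lra.
Qed.

(** Near [x] continuity gives [eta]. Elsewhere some coordinate is away from that of [x], its [phi]
    is bounded below, and boundedness of [u] suffices; [2 ^+ N] bounds [wt 0]. *)
Let modulus (eta : R) : 0 < eta -> exists2 K, 0 <= K &
  forall y, `|u y - u x| <= eta + K * \sum_i phi (y 0 i - x 0 i).
Proof.
move=> eta0; have /cvgrPdist_le/(_ eta eta0) : u @ x --> u x by exact: cu.
rewrite -[X in X -> _]/(nbhs (x : V) [set y | `|u x - u y| <= eta]).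
move=> /nbhs_normP[del /= del0 hdel].
pose M := C * 2 ^+ N.
have uM y : `|u y| <= M.
  apply: le_trans (le_trans _ (uvC y)) _; first by rewrite lerDl.
  rewrite /M ler_wpM2l// /wt -[N in leRHS]card_ord -prodr_const.
  apply: ler_prod => i _; rewrite ltW ?poisson_gt0//=.
  rewrite /poisson mulr1 expr1n ler_pdivrMr ?ltr_pwDl ?sqr_ge0//.
  by rewrite ler_peMr// lerDl sqr_ge0.
have M0 : 0 <= M by apply: le_trans (uM 0).
have p0 : 0 < phi (del / 2) by rewrite /phi divr_gt0 ?ltr_pwDl ?exprn_gt0 ?divr_gt0 ?sqr_ge0.
have K0 : 0 <= 2 * M / phi (del / 2) by rewrite divr_ge0 ?(ltW p0)// mulr_ge0.
exists (2 * M / phi (del / 2)) => //.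
move=> y; have S0 : 0 <= \sum_i phi (y 0 i - x 0 i) by apply: sumr_ge0.
have [near|/existsNP[i /negP hi]] := pselect (forall i, `|y 0 i - x 0 i| <= del / 2).
  apply: le_trans (_ : eta <= _); last first.
    by rewrite lerDl mulr_ge0.
  rewrite distrC; apply: hdel => /=; rewrite distrC.
  apply: le_lt_trans (_ : del / 2 < del); last by lra.
  by apply: mx_norm_le; [lra|move=> i; rewrite !mxE].
move: hi; rewrite -ltNge => hi.
apply: le_trans (_ : 2 * M <= _).
  by apply: le_trans (ler_normB _ _) _; have := uM x; have := uM y; lra.
apply: le_trans (_ : 2 * M / phi (del / 2) * phi (y 0 i - x 0 i) <= _); last first.
  apply: ler_wpDl; first exact: ltW.
  apply: ler_wpM2l => //.
  by rewrite (bigD1 i)//= lerDl sumr_ge0.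
rewrite -mulrA ler_peMr ?mulr_ge0// mulrC ler_pdivlMr// mul1r.
set s := y 0 i - x 0 i.
have h : (del / 2) ^+ 2 <= s ^+ 2.
  by rewrite -(real_normK (num_real s)) lerXn2r ?nnegrE ?(ltW hi)//; lra.
rewrite /phi ler_pdivrMr ?ltr_pwDl ?sqr_ge0// mulrAC ler_pdivlMr ?ltr_pwDl ?sqr_ge0//.
by move: h; set a := (del / 2) ^+ 2; set b := s ^+ 2; nra.
Qed.

(** The Poisson kernels form an approximate identity of mass [(2 * pi) ^+ N], so [damped_bound]
    passes to the value at [x] up to [eta], and the mass cancels. *)
Lemma trigint_sup_bound : `|u x| <= 2 * B.
Proof.
have P0 : 0 < (2 * pi : R) ^+ N by rewrite exprn_gt0// mulr_gt0// pi_gt0.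
apply/ler_addgt0Pr => eta eta0.
have [K K0 hK] := modulus (divr_gt0 eta0 (ltr0n R 2)).
(* This makes [K * e * N] at most [eta / 2]; the other half of [eta] comes from the modulus of
   continuity. *)
pose e : R := eta / 2 / (K * N%:R + 1).
have KN : 0 < K * N%:R + 1 by rewrite ltr_wpDl// mulr_ge0.
have e0 : 0 < e by rewrite !divr_gt0.
pose px := @pois R N e (fun i => x 0 i).
have ip : mu.-integrable setT (EFin \o px) := integrable_pois (fun i => x 0 i) e0.
have px0 t : 0 < px t := pois_gt0 _ _ e0.
have intp : (\int[mu]_t px t)%R = (2 * pi) ^+ N by rewrite /Rintegral integral_pois.
(* The [i]-th kernel of [px] is widened to width 1. The mass is unchanged, and [e * q i] dominates
   [px] times the [i]-th [phi]. *)
pose q i t := \prod_(k < N) poisson (if k == i then 1 else e) (tnth t k - x 0 k).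
have ee k i : 0 < (if k == i :> 'I_N then 1 else e) by case: eqP.
have cq i k : continuous (fun s : R => poisson (if k == i then 1 else e) (s - x 0 k)).
  by apply: (cont_comp (continuous_poisson (ee _ _))); apply: contB; [move=> ?; exact: cvg_id|exact: cst_continuous].
have qE i : (\int[mu]_t (q i t)%:E = ((2 * pi) ^+ N)%:E)%E.
  rewrite /q (@integral_prod_tnth R N (fun k s => poisson (if k == i then 1 else e) (s - x 0 k)) (fun=> 2 * pi)).
  - by rewrite prodr_const card_ord.
  - exact: cq.
  - by move=> k s; rewrite ltW// poisson_gt0.
  - by move=> k; exact: integral_poisson.
have q0 i t : 0 <= q i t by apply: prodr_ge0 => k _; rewrite ltW// poisson_gt0.
have iq i : mu.-integrable setT (EFin \o q i).
  apply/integrableP; split.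
    apply/measurable_EFinP.
    apply: (@measurable_prod_tnth R N (fun k s => poisson (if k == i then 1 else e) (s - x 0 k))) => k.
    by apply: continuous_measurable_fun; exact: cq.
  by under eq_integral do rewrite /= ger0_norm//; rewrite qE ltry.
have qx i t : px t * phi (tnth t i - x 0 i) <= e * q i t.
  rewrite /px /pois /q (bigD1 i)//= [in leRHS](bigD1 i)//= eqxx mulrAC [leRHS]mulrA.
  rewrite [X in _ * X <= _](eq_bigr (fun k => poisson (if k == i then 1 else e) (tnth t k - x 0 k))).
    by apply: ler_wpM2r; [apply: prodr_ge0 => k _; rewrite ltW// poisson_gt0|exact: poisson_phi].
  by move=> k /negPf ->.
pose Q t := \sum_i q i t.
have iQ : mu.-integrable setT (EFin \o Q) /\ (\int[mu]_t Q t)%R = N%:R * (2 * pi) ^+ N.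
  rewrite /Q; have -> : N%:R * (2 * pi) ^+ N = \sum_(i < N) (2 * pi) ^+ N :> R.
    by rewrite sumr_const card_ord mulr_natl.
  elim: (index_enum _) => [|i s [IH1 IH2]].
    under [X in _ /\ X = _]eq_Rintegral do rewrite big_nil.
    rewrite big_nil /Rintegral integral0; split => //.
    by apply: eq_integrable (integrable0 _ _) => // t _ /=; rewrite big_nil.
  have e1 t : \sum_(j <- i :: s) q j t = q i t + \sum_(j <- s) q j t by rewrite big_cons.
  split.
    by apply: eq_integrable (integrable_EFinD (iq i) IH1) => // t _ /=; rewrite e1.
  under eq_Rintegral do rewrite e1.
  by rewrite RintegralD// IH2 big_cons /Rintegral qE.
have [iQ1 iQ2] := iQ.
have mpx : measurable_fun setT px by exact: measurable_pois.
have Q0 t : 0 <= Q t by apply: sumr_ge0.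
pose D t := (u (row t) - u x) * px t.
have hD t : `|D t| <= 1 * (eta / 2 * px t + K * e * Q t).
  rewrite mul1r /D normrM (ger0_norm (ltW (px0 t))).
  apply: le_trans (ler_wpM2r (ltW (px0 t)) (hK _)) _.
  rewrite mulrDl lerD2l -[leLHS]mulrA -[leRHS]mulrA ler_wpM2l// mulr_suml /Q mulr_sumr.
  by apply: ler_sum => i _; rewrite mxE mulrC; exact: qx.
have iG : mu.-integrable setT (EFin \o (fun t => eta / 2 * px t + K * e * Q t)).
  by apply: integrable_EFinD; exact: integrable_EFinZ.
have mD : measurable_fun setT D.
  apply: measurable_funM => //; apply: measurable_funB; last exact: measurable_cst.
  exact: measurable_row.
have := Rintegral_dominated mD iG hD.
rewrite mul1r RintegralD//; [|exact: integrable_EFinZ|exact: integrable_EFinZ].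
rewrite !RintegralZl// intp iQ2.
have iD := integrable_dominated mD iG hD.
have -> : (\int[mu]_t D t)%R = (\int[mu]_t (u (row t) * px t))%R - u x * (2 * pi) ^+ N.
  rewrite -intp -RintegralZl// -RintegralB//; last exact: integrable_EFinZ.
    by apply: eq_Rintegral => t _; rewrite /D mulrBl.
  have := integrable_EFinD iD (integrable_EFinZ (u x) ip).
  by apply: eq_integrable => // t _ /=; rewrite /D mulrBl subrK.
move=> h1; have h2 := damped_bound e0; rewrite -/px in h2.
set I := (\int[mu]_t _)%R in h1 h2.
have : `|u x| * (2 * pi) ^+ N <= (2 * B + eta) * (2 * pi) ^+ N.
  have -> : `|u x| * (2 * pi) ^+ N = `|u x * (2 * pi) ^+ N|.
    by rewrite normrM (ger0_norm (ltW P0)).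
  have h3 := ler_normB I (I - u x * (2 * pi) ^+ N).
  rewrite subKr in h3; apply: le_trans h3 (le_trans (lerD h2 h1) _).
  rewrite mulrA -!mulrDl ler_pM2r// lerD2l.
  apply: (@le_trans _ _ (eta / 2 + eta / 2)); last by lra.
  rewrite lerD2l mulrAC /e mulrA ler_pdivrMr// mulrC ler_wpM2l ?lerDl//; lra.
by rewrite ler_pM2r.
Qed.

End Fourier_inversion_bound.

(** * Weighted estimates *)

Section weighted_estimates.
Context (R : realType) (w : R -> R) (hw : nonquasianalytic_weight w) (N : nat).
Local Notation V := 'rV[R]_N.
Local Notation ew n x := (expR (- (n%:R * w (enorm x)))).
Implicit Types (u v g : V -> R) (x y c xi : V) (s : seq 'I_N) (m n k l : nat).

Lemma enorm_ge0 x : 0 <= enorm x. Proof. exact: sqrtr_ge0. Qed.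

Lemma enorm_sqr x : enorm x ^+ 2 = nsq x.
Proof. by rewrite sqr_sqrtr// nsq_ge0. Qed.

Lemma coord_le_enorm x i : `|x 0 i| <= enorm x.
Proof. by rewrite -sqrtr_sqr ler_wsqrtr// sqr_le_nsq. Qed.

Lemma enorm_le x (t : R) : 0 <= t -> (forall i, `|x 0 i| <= t) -> enorm x <= N%:R * t.
Proof.
move=> t0 xt; have Nt0 : 0 <= N%:R * t by rewrite mulr_ge0.
rewrite -[leRHS](ger0_norm Nt0) -sqrtr_sqr; apply: ler_wsqrtr.
apply: (@le_trans _ _ (\sum_(i < N) t ^+ 2)).
  by apply: ler_sum => i _; rewrite -(real_normK (num_real (x 0 i))) lerXn2r// nnegrE.
rewrite sumr_const card_ord -[X in X <= _]mulr_natl exprMn ler_wpM2r ?sqr_ge0//.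
by rewrite -natrX ler_nat; case: (N) => // n; rewrite expnS expn1 leq_pmulr.
Qed.

(** The normalization of [w] allows points below 1 to be replaced by 1, as the bounds on [gam]
    require. *)
Lemma weight_max1 (t : R) : 0 <= t -> w (Num.max 1 t) = w t.
Proof.
move=> t0; have [t1|//] := leP t 1.
by rewrite !(weight_normalized hw)// ?lexx ?ler01 ?t0.
Qed.

Lemma weight_dilate_max1 (A : R) : exists L C, 0 <= C /\
  forall t s : R, 0 <= t -> 0 <= s -> s <= A * Num.max 1 t -> w s <= L%:R * w t + C.
Proof.
have [L [C [C0 h]]] := weight_dilate hw A; exists L, C; split=> // t s t0 s0 st.
by rewrite -(weight_max1 t0); apply: h => //; rewrite le_max ler01.
Qed.

Lemma expR_weightD m n x : ew (m + n)%N x = ew m x * ew n x.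
Proof. by rewrite natrD mulrDl opprD expRD. Qed.

Lemma expR_weight_le m n x : (m <= n)%N -> ew n x <= ew m x.
Proof.
move=> mn; rewrite ler_expR lerN2 ler_wpM2r ?ler_nat//.
exact: (weight_ge0 hw) (enorm_ge0 _).
Qed.

(** The price of integrability: a fixed number [p] of factors exp (- w), through the logarithmic
    lower bound of [w]. *)
Lemma expR_weight_le_wt : exists (p : nat) (K : R), 0 <= K /\ forall x, ew p x <= K * wt 0 x.
Proof.
have [p [C [C0 hC]]] := weight_log hw.
exists (p * 2 * N)%N, ((C ^+ 2) ^+ N); split; first by rewrite exprn_ge0// sqr_ge0.
move=> x; have e0 := enorm_ge0 x.
have h1 : 1 + nsq x <= C ^+ 2 * expR ((p * 2)%:R * w (enorm x)).
  apply: (@le_trans _ _ ((1 + enorm x) ^+ 2)); first by rewrite -enorm_sqr; have := e0; nra.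
  apply: le_trans (_ : (C * expR (p%:R * w (enorm x))) ^+ 2 <= _).
    by rewrite lerXn2r ?nnegrE ?hC ?addr_ge0// mulr_ge0 ?expR_ge0// ltW.
  by rewrite exprMn -expRM_natl natrM mulrA (mulrC p%:R).
apply: le_trans (ler_wpM2l _ (wt_ge x)); last by rewrite exprn_ge0// sqr_ge0.
rewrite ler_pdivlMr ?exprn_gt0 ?nsq1_gt0// expRN ler_pdivrMl ?expR_gt0//.
apply: le_trans (_ : (C ^+ 2 * expR ((p * 2)%:R * w (enorm x))) ^+ N <= _).
  by rewrite lerXn2r ?nnegrE ?(ltW (nsq1_gt0 _))// mulr_ge0 ?expR_ge0 ?sqr_ge0.
rewrite exprMn -expRM_natl [leRHS]mulrC.
by rewrite (_ : N%:R * _ = (p * 2 * N)%:R * w (enorm x))// !natrM; ring.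
Qed.

(** The weight of a given order may vanish for small [m]; for [m] large depending on [k] it does
    not, so single derivatives can be recovered from jet bounds. *)
Lemma gam_gt0 k : exists2 m, (0 < m)%N & 0 < gam w m k.
Proof.
have [p [C [C0 hC]]] := weight_log hw; exists (p * k).+1 => //.
apply: lt_le_trans (_ : C ^- k <= _); first by rewrite invr_gt0 exprn_gt0.
apply: gam_glb => //; first by rewrite invr_ge0 exprn_ge0// ltW.
move=> t t1; have t0 : 0 <= t by lra.
rewrite ler_pdivrMl ?exprn_gt0//; apply: (@le_trans _ _ ((C * expR (p%:R * w t)) ^+ k)).
  rewrite lerXn2r ?nnegrE ?mulr_ge0 ?expR_ge0 ?(ltW C0)//.
  by apply: le_trans (hC t t0); rewrite lerDr.
rewrite exprMn ler_wpM2l ?exprn_ge0 ?(ltW C0)// -expRM_natl ler_expR mulrA -natrM mulnC.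
by rewrite ler_wpM2r ?(weight_ge0 hw)// ler_nat.
Qed.

(* The real functions on which all the [seminorm_q] are finite. *)
Definition gs_class u := rsmooth u /\
  forall m n, (0 < m)%N -> exists C, forall x, jetb w m u x (C * ew n x).

Lemma gs_class_decay u s n : gs_class u -> sortedw s ->
  exists2 C, 0 <= C & forall x, `|rderw s u x| <= C * ew n x.
Proof.
move=> [_ hu] ss; have [m m0 g0] := gam_gt0 (size s).
have [C hC] := hu m n m0; exists (`|C| / gam w m (size s)).
  by rewrite divr_ge0 ?(ltW g0).
move=> x; rewrite mulrAC ler_pdivlMr//; apply: le_trans (hC x s ss) _.
by rewrite ler_wpM2r ?expR_ge0// ler_norm.
Qed.

Lemma rapid_weight_decay u : continuous u ->
  (forall n, exists2 C, 0 <= C & forall x, `|u x| <= C * ew n x) -> rapid u.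
Proof.
move=> cu hu; split=> // k; have [p [K [K0 hp]]] := weight_log hw.
have [C C0 hC] := hu (p * 2 * k)%N.
exists (C * (K ^+ 2) ^+ k) => x; have e0 := enorm_ge0 x.
apply: (@le_trans _ _ (C * ew (p * 2 * k)%N x * ((K * expR (p%:R * w (enorm x))) ^+ 2) ^+ k)).
  apply: ler_pM => //; first by rewrite exprn_ge0// ltW// nsq1_gt0.
  rewrite lerXn2r ?nnegrE ?sqr_ge0 ?(ltW (nsq1_gt0 _))//.
  apply: le_trans (_ : (1 + enorm x) ^+ 2 <= _).
    by rewrite -enorm_sqr; have := e0; nra.
  by rewrite lerXn2r ?nnegrE ?hp ?addr_ge0// mulr_ge0 ?expR_ge0// ltW.
rewrite expRN (_ : (p * 2 * k)%:R * _ = k%:R * (2 * (p%:R * w (enorm x)))); last first.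
  by rewrite !natrM; ring.
rewrite !expRM_natl; set E := expR _; have E0 : 0 < E by exact: expR_gt0.
have a0 : E ^+ p ^+ 2 ^+ k != 0 by rewrite gt_eqF// !exprn_gt0.
rewrite (_ : (K * E ^+ p) ^+ 2 ^+ k = K ^+ 2 ^+ k * E ^+ p ^+ 2 ^+ k); last first.
  by rewrite (exprMn _ K) exprMn.
by move: a0; set a := E ^+ p ^+ 2 ^+ k; set b := K ^+ 2 ^+ k => a0;
  rewrite (_ : C / a * (b * a) = C * b)//; field.
Qed.

Definition schwartz u := rsmooth u /\ forall s, sortedw s -> rapid (rderw s u).

Lemma schwartz_gs_class u : gs_class u -> schwartz u.
Proof.
move=> hu; have [us _] := hu; split=> // s ss; apply: rapid_weight_decay.
  by apply: rsmooth_continuous; exact: rsmooth_rderw.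
by move=> n; exact: gs_class_decay.
Qed.

Lemma schwartzN u : schwartz u -> schwartz (fun x => - u x).
Proof.
move=> [us hu]; split; first exact: rsmoothN.
by move=> s ss; rewrite rderwN//; apply: rapidN; exact: hu.
Qed.

Lemma gs_classN u : gs_class u -> gs_class (fun x => - u x).
Proof.
move=> [us hu]; split; first exact: rsmoothN.
by move=> m n m0; have [C hC] := hu m n m0; exists C => x; exact: jetbN.
Qed.

(** The growth of order [p] is absorbed by using the decay of [u] at order [p + n]. *)
Lemma gs_class_mul g u : gs_class u -> rsmooth g ->
  (forall m, (0 < m)%N -> exists A p, 0 <= A /\
     forall x, jetb w m g x (A * expR (p%:R * w (enorm x)))) ->
  gs_class (fun x => g x * u x).
Proof.
move=> [us hu] gs hg; split; first exact: rsmoothM.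
move=> m n m0; have [l [C [l0 C0 h]]] := jetb_mul hw N m0.
have [A [p [A0 hA]]] := hg l l0; have [B hB] := hu l (p + n)%N l0.
exists (C * A * B) => x; have := h _ _ _ _ _ gs us (hA x) (hB x).
rewrite expR_weightD expRN; set e := expR _.
have e0 : e != 0 by rewrite gt_eqF ?expR_gt0.
by rewrite (_ : C * (A * e) * (B * (e^-1 * ew n x)) = C * A * B * ew n x)//; field.
Qed.

Lemma jetb_coord m j x : (0 < m)%N -> jetb w m (fun x : V => x 0 j) x (1 + enorm x).
Proof.
move=> m0 s _; apply: (@le_trans _ _ `|rderw s (fun x : V => x 0 j) x|).
  by rewrite ler_piMr// gam_le1.
have e0 := enorm_ge0 x.
case: (lastP s) => [|s' i] /=; first by apply: le_trans (coord_le_enorm _ _) _; lra.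
rewrite -cats1 rderw_cat/= partial_coord; apply: le_trans (rderw_cst _ _ _) _.
by rewrite normr_nat; case: (i == j) => /=; lra.
Qed.

Lemma gs_class_coord u j : gs_class u -> gs_class (fun x => x 0 j * u x).
Proof.
move=> hu; apply: (@gs_class_mul (fun x => x 0 j)) => //; first exact: rsmooth_coord.
move=> m m0.
have [p [K [K0 hp]]] := weight_log hw; exists K, p; split; first exact: ltW.
move=> x; apply: jetbW (jetb_coord j x m0) => //.
by apply: hp; exact: enorm_ge0.
Qed.

Lemma gs_class_mulw s u v : gs_class u -> gs_class v ->
  gs_class (mulw s u v).1 /\ gs_class (mulw s u v).2.
Proof.
move=> hu hv; elim: s => //= j s [h1 h2]; split; first exact: gs_class_coord.
by apply: gs_classN; exact: gs_class_coord.
Qed.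

Lemma trigintN u v xi : rapid u -> rapid v ->
  trigint (fun x => - u x) (fun x => - v x) xi = - trigint u v xi.
Proof.
move=> ru rv; have [C _ hC] := rapid_dominated ru rv.
rewrite -mulN1r -RIZ; last exact: Lint_trig ru.1 rv.1 hC.
by congr RI; apply/funext => x; ring.
Qed.

(** Each integration by parts multiplies by a coordinate of [xi] and exchanges the two parts of the
    transform up to sign, hence the parity of the length. Absolute values dispose of the signs. *)
Lemma trigint_rderw u v s xi : schwartz u -> schwartz v -> sortedw s ->
  let a := trigint u v xi in let b := trigint v (fun x => - u x) xi in
  `|trigint (rderw s u) (rderw s v) xi| =
    (\prod_(j <- s) `|xi 0 j|) * `|if odd (size s) then b else a| /\
  `|trigint (rderw s v) (fun x => - rderw s u x) xi| =
    (\prod_(j <- s) `|xi 0 j|) * `|if odd (size s) then a else b|.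
Proof.
move=> hu hv; elim: s => [_|j s IH ss] /=; first by rewrite !big_nil !mul1r.
have ss' : sortedw s by move: ss; rewrite /sortedw /=; exact: path_sorted.
have [h1 h2] := IH ss'.
have [us _] := hu; have [vs _] := hv.
have su := rsmooth_rderw s us; have sv := rsmooth_rderw s vs.
have ru := hu.2 _ ss'; have rv := hv.2 _ ss'.
have rdu : rapid ('D_(unit_vec R j) (rderw s u)) := hu.2 _ ss.
have rdv : rapid ('D_(unit_vec R j) (rderw s v)) := hv.2 _ ss.
have e1 := trigint_partial (j := j) xi su sv ru rv rdu rdv.
have dN : 'D_(unit_vec R j) (fun x => - rderw s u x) =
    fun x => - 'D_(unit_vec R j) (rderw s u) x by exact: (rderwN [:: j] su).
have rdNu : rapid ('D_(unit_vec R j) (fun x => - rderw s u x)) by rewrite dN; exact: rapidN.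
have e2 := trigint_partial (j := j) xi sv (rsmoothN su) rv (rapidN ru) rdv rdNu.
rewrite dN trigintN// in e2.
rewrite !big_cons e1 e2 !normrN !normrM !normrN h1 h2 !mulrA.
by case: (odd _).
Qed.

Lemma gam_prod_le m s xi : (0 < m)%N ->
  gam w m (size s) * \prod_(j <- s) `|xi 0 j| <= expR (m%:R * w (enorm xi)).
Proof.
move=> m0; rewrite -(weight_max1 (enorm_ge0 xi)).
apply: le_trans (gam_bound hw (size s) m0 _); last by rewrite le_max lexx.
rewrite ler_wpM2l ?gam_ge0//; elim: s => [|j s IH]; first by rewrite big_nil.
rewrite big_cons exprS ler_pM ?prodr_ge0//.
by rewrite le_max coord_le_enorm orbT.
Qed.

(** [trigint_sup_bound] is applied to each derivative. Of the [m + p] factors exp (- w), [m] pay for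
    the monomial against the weight by [gam_prod_le], and [p] for integrability. *)
Lemma jetb_of_trigint_decay m : (0 < m)%N -> exists l K, 0 <= K /\
  forall u v B x, schwartz u -> schwartz v -> 0 <= B ->
    (forall xi, `|trigint u v xi| <= B * ew l xi) ->
    (forall xi, `|trigint v (fun x => - u x) xi| <= B * ew l xi) ->
    jetb w m u x (K * B).
Proof.
move=> m0; have [p [K [K0 hK]]] := expR_weight_le_wt.
exists (m + p)%N, (2 * K); split; first by rewrite mulr_ge0.
move=> u v B x hu hv B0 h1 h2 s ss.
have [g0|g0] := leP (gam w m (size s)) 0.
  apply: (@le_trans _ _ 0); first by rewrite mulr_ge0_le0.
  by rewrite !mulr_ge0.
rewrite -ler_pdivlMr// -!mulrA.
have ru := hu.2 _ ss; have rv := hv.2 _ ss.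
have [C _ hC] := rapid_dominated ru rv.
have key xi (z : R) : `|z| <= B * ew (m + p)%N xi ->
    \prod_(j <- s) `|xi 0 j| * `|z| <= K * (B / gam w m (size s)) * wt 0 xi.
  move=> hz; rewrite (_ : _ * wt 0 xi = B * (K * wt 0 xi) / gam w m (size s)); last by ring.
  rewrite ler_pdivlMr// [leLHS]mulrC [leLHS]mulrA.
  apply: le_trans (ler_wpM2l _ hz) _; first by rewrite mulr_ge0 ?gam_ge0 ?prodr_ge0.
  apply: le_trans (ler_wpM2r _ (gam_prod_le s xi m0)) _; first by rewrite mulr_ge0 ?expR_ge0.
  rewrite expR_weightD [in ew m xi]expRN; set e := expR _.
  have e0 : e != 0 by rewrite gt_eqF ?expR_gt0.
  rewrite (_ : e * (B * (e^-1 * ew p xi)) = B * ew p xi); last by field.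
  by rewrite ler_wpM2l.
have rNu := rapidN ru.
apply: (@trigint_sup_bound R N _ _ x (K * (B / gam w m (size s))) C ru.1 rv.1 hC).
- move=> xi; have [-> _] := trigint_rderw xi hu hv ss.
  by case: odd; exact: key.
- move=> xi; have [_ ->] := trigint_rderw xi hu hv ss.
  by case: odd; exact: key.
- exact: continuous_trigint.
- exact: continuous_trigint.
Qed.

(** Integrate by parts [k] times along the largest coordinate of [xi], with the order [k] that
    [gam_dual] provides at this coordinate. [L] comes from comparing the Euclidean norm with [N]
    times that coordinate. *)
Lemma trigint_decay l : (0 < N)%N -> exists m K, [/\ (0 < m)%N, 0 <= K &
  forall c u v A, schwartz u -> schwartz v ->
    (forall x, jetb w m u x (A * wt c x)) -> (forall x, jetb w m v x (A * wt c x)) ->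
    forall xi, `|trigint u v xi| <= K * A * ew l xi].
Proof.
move=> N0; have [L [C1 [C10 hL]]] := weight_dilate_max1 N%:R.
have [m [C [m0 C0 hm]]] := gam_dual hw (l * L).
pose P : R := 2 * (2 * pi) ^+ N.
have P0 : 0 <= P by rewrite mulr_ge0// exprn_ge0// mulr_ge0// pi_ge0.
exists m, (expR (l%:R * C1) * (C * P)); split=> //.
  by rewrite mulr_ge0 ?expR_ge0// mulr_ge0// ltW.
move=> c u v A hu hv uA vA xi.
have A0 : 0 <= A.
  have := jetb_ge0 hw (uA 0); by rewrite pmulr_lge0// wt_gt0.
have bound j k : gam w m k * (`|xi 0 j| ^+ k * `|trigint u v xi|) <= P * A.
  have ss : sortedw (nseq k j).
    by rewrite /sortedw; case: k => //= k; elim: k => //= k ->; rewrite leqnn.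
  have sz : size (nseq k j) = k by rewrite size_nseq.
  have [g0|g0] := leP (gam w m k) 0.
    apply: (@le_trans _ _ 0); first by rewrite mulr_le0_ge0// mulr_ge0// exprn_ge0.
    by rewrite mulr_ge0.
  have ru := hu.2 _ ss; have rv := hv.2 _ ss.
  have hE (z : R) y : `|z| * gam w m (size (nseq k j)) <= A * wt c y ->
      `|z| <= A / gam w m k * wt c y.
    by rewrite sz mulrAC ler_pdivlMr.
  have b1 : `|trigint (rderw (nseq k j) u) (rderw (nseq k j) v) xi| <=
      2 * A / gam w m k * (2 * pi) ^+ N.
    apply: (@trigint_dominated R N c _ _ _ xi ru.1 rv.1) => y.
    apply: le_trans (lerD (hE _ _ (uA y _ ss)) (hE _ _ (vA y _ ss))) _.
    by rewrite -mulr2n -[leLHS]mulr_natl !mulrA.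
  have b2 : `|trigint (rderw (nseq k j) v) (fun x => - rderw (nseq k j) u x) xi| <=
      2 * A / gam w m k * (2 * pi) ^+ N.
    apply: (@trigint_dominated R N c _ _ _ xi rv.1 (rapidN ru).1) => y; rewrite normrN.
    apply: le_trans (lerD (hE _ _ (vA y _ ss)) (hE _ _ (uA y _ ss))) _.
    by rewrite -mulr2n -[leLHS]mulr_natl !mulrA.
  have [e1 e2] := trigint_rderw xi hu hv ss.
  have pk : \prod_(i <- nseq k j) `|xi 0 i| = `|xi 0 j| ^+ k.
    by rewrite big_nseq -Monoid.iteropE.
  rewrite pk sz in e1 e2; rewrite e1 in b1; rewrite e2 in b2.
  have -> : P * A = gam w m k * (2 * A / gam w m k * (2 * pi) ^+ N).
    by rewrite /P; field; rewrite gt_eqF.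
  by rewrite ler_pM2l//; move: b1 b2; case: odd.
have [j hj] : exists j, forall i, `|xi 0 i| <= `|xi 0 j|.
  exists [arg max_(i > Ordinal N0) `|xi 0 i|]%O => i.
  by case: arg_maxP => // j _ h; exact: h.
have ej : enorm xi <= N%:R * Num.max 1 `|xi 0 j|.
  by apply: enorm_le; [rewrite le_max ler01|move=> i; rewrite le_max hj orbT].
have wj := hL _ _ (normr_ge0 _) (enorm_ge0 _) ej.
have key : expR ((l * L)%:R * w `|xi 0 j|) * `|trigint u v xi| <= C * (P * A).
  have [k hk] : exists k, expR ((l * L)%:R * w `|xi 0 j|) <=
      C * (Num.max 1 `|xi 0 j| ^+ k * gam w m k).
    by rewrite -(weight_max1 (normr_ge0 (xi 0 j))); apply: hm; rewrite le_max lexx.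
  apply: le_trans (ler_wpM2r (normr_ge0 _) hk) _.
  rewrite -[leLHS]mulrA ler_wpM2l ?(ltW C0)//.
  (* If the largest coordinate is below 1, no integration by parts is required and the case of order
     0 suffices. *)
  move: (bound j k) (bound j 0%N); rewrite (gam0 hw m0) expr0 !mul1r.
  case: (leP 1 `|xi 0 j|) => j1 b1 b2; first by apply: le_trans b1; rewrite mulrA [_ ^+ k * _]mulrC.
  apply: le_trans b2; rewrite expr1n mul1r ler_piMl// gam_le1//.
rewrite expRN ler_pdivlMr ?expR_gt0// mulrC.
apply: (@le_trans _ _ (expR (l%:R * C1) * expR ((l * L)%:R * w `|xi 0 j|) * `|trigint u v xi|)).
  rewrite ler_wpM2r// -expRD ler_expR natrM -mulrA -mulrDr addrC.
  by rewrite ler_wpM2l.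
by rewrite -!mulrA ler_wpM2l ?expR_ge0//; move: key; rewrite !mulrA.
Qed.

End weighted_estimates.

(** * Localization at a moving centre *)

Section localization.
Context (R : realType) (w : R -> R) (hw : nonquasianalytic_weight w) (N : nat).
Local Notation V := 'rV[R]_N.
Local Notation ew n x := (expR (- (n%:R * w (enorm x)))).
Implicit Types (u v g h : V -> R) (x y c xi : V) (s : seq 'I_N) (m n k l : nat) (r : R).

(** The strict inequality makes the region of vanishing open, so that all derivatives vanish there
    as well. *)
Definition boxed c r h := forall x i, r < `|x 0 i - c 0 i| -> h x = 0.

Lemma open_coord_gt c r i : open [set x : V | r < `|x 0 i - c 0 i|].
Proof.
apply: (@open_comp _ _ (fun x : V => `|x 0 i - c 0 i|) [set t | r < t]); last exact: open_gt.
move=> x _; apply: (@cont_comp _ _ (fun t : R => `|t|) (fun x : V => x 0 i - c 0 i)).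
  exact: norm_continuous.
by apply: contB; [exact: coord_continuous|exact: cst_continuous].
Qed.

Lemma jetb_local m (U : set V) u v x B : open U -> (forall y, U y -> u y = v y) -> U x ->
  jetb w m v x B -> jetb w m u x B.
Proof. by move=> oU uv Ux hv s ss; rewrite (rderw_local s oU uv Ux); exact: hv. Qed.

Lemma jetb0 m x : (0 < m)%N -> jetb w m (fun=> 0 : R) x 0.
Proof. by move=> m0; have := jetb_cst hw (0 : R) x m0; rewrite normr0. Qed.

Lemma jetb_boxed m c r h x i : (0 < m)%N -> boxed c r h -> r < `|x 0 i - c 0 i| ->
  jetb w m h x 0.
Proof.
move=> m0 bh xr; apply: (@jetb_local m [set x : V | r < `|x 0 i - c 0 i|] h (fun=> 0) x 0) => //.
- exact: open_coord_gt.
- by move=> y /=; exact: bh.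
- exact: jetb0.
Qed.

Lemma wt_box r : exists2 K, 0 <= K &
  forall c x, (forall i, `|x 0 i - c 0 i| <= r) -> 1 <= K * wt c x.
Proof.
pose q : R := 1 + r ^+ 2; have q0 : 0 < q by rewrite ltr_pwDl// sqr_ge0.
exists (q ^+ N) => [|c x hx]; first by rewrite exprn_ge0// ltW.
rewrite -ler_pdivrMl ?exprn_gt0// mulr1 /wt -exprVn -[N in leLHS]card_ord -prodr_const.
apply: ler_prod => i _; rewrite invr_ge0 (ltW q0)/= /poisson mulr1 expr1n.
set t := x 0 i - c 0 i.
have h : t ^+ 2 <= r ^+ 2.
  by rewrite -(real_normK (num_real t)) lerXn2r ?nnegrE ?hx ?(le_trans _ (hx i)).
have t0 := sqr_ge0 t.
by rewrite ler_pdivlMr ?ler_pdivrMl /q//; lra.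
Qed.

Lemma box_dichotomy c r x : (exists i, r < `|x 0 i - c 0 i|) \/
  (forall i, `|x 0 i - c 0 i| <= r).
Proof.
have [h|/existsNP[i /negP]] := pselect (forall i, `|x 0 i - c 0 i| <= r); first by right.
by rewrite -ltNge => h; left; exists i.
Qed.

(** On the box [wt c] is bounded below independently of [c]. This gives localized functions the
    integrable majorant that [trigint_decay] expects. *)
Lemma jetb_boxed_wt r : exists2 K, 0 <= K & forall m c h A, (0 < m)%N -> boxed c r h ->
  (forall x, (forall i, `|x 0 i - c 0 i| <= r) -> jetb w m h x A) -> 0 <= A ->
  forall x, jetb w m h x (A * K * wt c x).
Proof.
have [K K0 hK] := wt_box r; exists K => // m c h A m0 bh hA A0 x.
have [[i xi]|xr] := box_dichotomy c r x.
  apply: jetbW (jetb_boxed m0 bh xi) => //.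
  by rewrite !mulr_ge0 ?(ltW (wt_gt0 _ _)).
apply: jetbW (hA x xr) => //.
by rewrite -mulrA ler_peMr// hK.
Qed.

Lemma gs_class_boxed c r h : rsmooth h -> boxed c r h ->
  (forall m, (0 < m)%N -> exists A, forall x, (forall i, `|x 0 i - c 0 i| <= r) -> jetb w m h x A) ->
  gs_class w h.
Proof.
move=> hs bh hj; split=> // m n m0; have [A hA] := hj m m0.
pose t := N%:R * (`|r| + enorm c).
exists (`|A| * expR (n%:R * w t)) => x.
have [[i xi]|xr] := box_dichotomy c r x.
  by apply: jetbW (jetb_boxed m0 bh xi) => //; rewrite !mulr_ge0 ?expR_ge0.
apply: jetbW (hA x xr) => //; apply: le_trans (ler_norm _) _.
rewrite -mulrA -expRD ler_peMr// -expR0 ler_expR subr_ge0 ler_wpM2l//.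
apply: weight_le => //; first exact: enorm_ge0.
apply: enorm_le => [|i]; first by rewrite addr_ge0// enorm_ge0.
rewrite -[x 0 i](subrK (c 0 i)); apply: le_trans (ler_normD _ _) _.
by apply: lerD; [apply: le_trans (xr i) (ler_norm _)|exact: coord_le_enorm].
Qed.

Lemma weight_box (N0 : (0 < N)%N) r : exists L C, 0 <= C /\ forall c x,
  (forall i, `|x 0 i - c 0 i| <= r) -> w (enorm c) <= L%:R * w (enorm x) + C.
Proof.
have [L [C [C0 hL]]] := weight_dilate_max1 hw (N%:R * (`|r| + 1)).
exists L, C; split=> // c x xr; apply: hL; rewrite ?enorm_ge0//.
rewrite -mulrA; apply: enorm_le => [|i]; first by rewrite mulr_ge0 ?addr_ge0// le_max ler01.
rewrite -[c 0 i](subKr (x 0 i)); apply: le_trans (ler_normB _ _) _.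
have h1 := le_trans (xr i) (ler_norm r); have h2 := coord_le_enorm x i.
set M := Num.max 1 _.
have M1 : 1 <= M by rewrite le_max lexx.
have M2 : enorm x <= M by rewrite le_max lexx orbT.
have := normr_ge0 r; nra.
Qed.

Lemma gs_class_trigint_decay u v n : (0 < N)%N -> gs_class w u -> gs_class w v ->
  exists2 C, 0 <= C & forall xi, `|trigint u v xi| <= C * ew n xi.
Proof.
move=> N0 hu hv; have [m [K [m0 K0 h]]] := trigint_decay hw n N0.
have [p [P [P0 hP]]] := expR_weight_le_wt hw N.
have [_ /(_ m p m0)[A hA]] := hu; have [_ /(_ m p m0)[B hB]] := hv.
pose D := (`|A| + `|B|) * P.
exists (K * D); first by rewrite mulr_ge0// mulr_ge0// addr_ge0.
have le (E : R) x : `|E| <= `|A| + `|B| -> E * ew p x <= D * wt 0 x.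
  move=> hE; rewrite /D -mulrA; apply: le_trans (ler_wpM2r (expR_ge0 _) (ler_norm E)) _.
  by apply: ler_pM; rewrite ?expR_ge0.
move=> xi; apply: (h 0) => //; try exact: (schwartz_gs_class hw).
  by move=> x; apply: jetbW (hA x) => //; apply: le; rewrite lerDl.
by move=> x; apply: jetbW (hB x) => //; apply: le; rewrite lerDr.
Qed.

(* The transform of the localization of [u + i v] at [c] decays in [xi], uniformly in
   [c], and in [c], uniformly in [xi]; the geometric mean of both bounds decays in
   both variables. *)
Lemma gs_class_of_decay u v : (0 < N)%N -> rsmooth u -> rsmooth v ->
  (forall s n, sortedw s -> exists2 C, 0 <= C & forall x, `|rderw s u x| <= C * ew n x) ->
  (forall s n, sortedw s -> exists2 C, 0 <= C & forall x, `|rderw s v x| <= C * ew n x) ->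
  (forall n, exists2 C, 0 <= C & forall xi, `|trigint u v xi| <= C * ew n xi) ->
  (forall n, exists2 C, 0 <= C & forall xi, `|trigint v (fun x => - u x) xi| <= C * ew n xi) ->
  gs_class w u.
Proof.
move=> N0 us vs du dv dT1 dT2.
have su : schwartz u.
  split=> // s ss; apply: (rapid_weight_decay hw) => [|n]; last exact: du.
  by apply: rsmooth_continuous; exact: rsmooth_rderw.
have sv : schwartz v.
  split=> // s ss; apply: (rapid_weight_decay hw) => [|n]; last exact: dv.
  by apply: rsmooth_continuous; exact: rsmooth_rderw.
have ru : rapid u := su.2 [::] isT; have rv : rapid v := sv.2 [::] isT.
(* Bounds without decay in [x] come first; they control the jets of the localized functions
   uniformly in the centre. *)
have bnd m : (0 < m)%N -> exists2 A, 0 <= A & forall x, jetb w m u x A /\ jetb w m v x A.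
  move=> m0; have [l [K [K0 h]]] := jetb_of_trigint_decay hw N m0.
  have [C1 C10 h1] := dT1 l; have [C2 C20 h2] := dT2 l.
  have h1' xi : `|trigint u v xi| <= (C1 + C2) * ew l xi.
    by apply: le_trans (h1 xi) _; rewrite ler_wpM2r ?expR_ge0// lerDl.
  have h2' xi : `|trigint v (fun x => - u x) xi| <= (C1 + C2) * ew l xi.
    by apply: le_trans (h2 xi) _; rewrite ler_wpM2r ?expR_ge0// lerDr.
  exists (K * (C1 + C2)); first by rewrite mulr_ge0// addr_ge0.
  move=> x; split; first by apply: (h u v) => //; exact: addr_ge0.
  apply: (h v (fun x => - u x)) => //; [exact: schwartzN|exact: addr_ge0|].
  by move=> xi; rewrite trigintN// normrN.
have [chi [chis chi1 chi0 chij]] := cutoff_exists hw N.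
have lchi c : boxed c 5 (chi c 1).
  by move=> x i xi; apply: (chi0 c 1 x i) => //; rewrite mulr1 ltW.
split=> // m n m0; have [l [K [K0 hjet]]] := jetb_of_trigint_decay hw N m0.
(* The exponent [2 * l], like [2 * n] further on, is halved by the geometric mean. *)
have [m' [K' [m'0 K'0 hdec]]] := trigint_decay hw (2 * l) N0.
have [L [C1 [C10 hL]]] := weight_box N0 5.
have [kap kap0 hkap] := jetb_boxed_wt 5.
have [kap' kap'0 hkap'] := wt_box 5.
have prodj m1 : (0 < m1)%N -> exists2 A, 0 <= A & forall c x,
    jetb w m1 (fun x => chi c 1 x * u x) x A /\ jetb w m1 (fun x => chi c 1 x * v x) x A.
  move=> m10; have [l1 [D [l10 D0 hmul]]] := jetb_mul hw N m10.
  have [E hE] := chij _ l10; have [F F0 hF] := bnd _ l10.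
  exists (D * `|E| * F); first by rewrite !mulr_ge0.
  move=> c x; have hE' : jetb w l1 (chi c 1) x `|E|.
    by apply: jetbW (hE c 1 x _) => //; exact: ler_norm.
  by split; apply: hmul => //; [exact: chis|have [] := hF x|exact: chis|have [] := hF x].
have hgs c h : rsmooth h -> boxed c 5 h ->
    (forall m1, (0 < m1)%N -> exists A, forall x, jetb w m1 h x A) -> schwartz h.
  move=> hs bh hj; apply: (schwartz_gs_class hw); apply: gs_class_boxed bh _ => // m1 m10.
  by have [A hA] := hj _ m10; exists A => x _.
(* Only the empty word of this jet is used: [E] bounds [chi] itself, as the weight of order 0 is
   1. *)
have [E hE] := chij 1%N isT.
have [A A0 hA] := prodj m' m'0.
have [Cu Cu0 hCu] := du [::] (2 * n * L)%N isT.
have [Cv Cv0 hCv] := dv [::] (2 * n * L)%N isT.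
pose D1 := K' * (A * kap).
pose D2 := `|E| * (Cu + Cv) * expR ((2 * n)%:R * C1) * kap' * (2 * pi) ^+ N.
have D10 : 0 <= D1 by rewrite mulr_ge0// mulr_ge0.
have D20 : 0 <= D2 by rewrite !mulr_ge0 ?expR_ge0 ?addr_ge0// exprn_ge0// mulr_ge0// pi_ge0.
have small c x : (`|chi c 1 x * u x| + `|chi c 1 x * v x|) <=
    `|E| * (Cu + Cv) * expR ((2 * n)%:R * C1) * kap' * ew (2 * n) c * wt c x.
  have [[i xi]|xr] := box_dichotomy c 5 x.
    rewrite (lchi c x i xi) !mul0r normr0 addr0.
    by rewrite !mulr_ge0 ?expR_ge0 ?addr_ge0 ?(ltW (wt_gt0 _ _)).
  have e1 : `|chi c 1 x| <= `|E|.
    have := hE c 1 x (lexx _) [::] isT; rewrite (gam0 hw)// mulr1 => h.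
    exact: le_trans h (ler_norm _).
  rewrite !normrM -mulrDr.
  have e2 : `|u x| + `|v x| <= (Cu + Cv) * ew (2 * n * L) x.
    by rewrite mulrDl; apply: lerD; [exact: hCu|exact: hCv].
  have e3 : ew (2 * n * L) x <= expR ((2 * n)%:R * C1) * ew (2 * n) c.
    rewrite -expRD ler_expR [(2 * n * L)%:R]natrM.
    by have := ler_wpM2l (ler0n R (2 * n)) (hL c x xr); rewrite mulrDr mulrA; lra.
  have e4 := hkap' c x xr.
  apply: le_trans (ler_pM (normr_ge0 _) (addr_ge0 (normr_ge0 _) (normr_ge0 _)) e1 e2) _.
  apply: le_trans (ler_wpM2l (normr_ge0 E) (ler_wpM2l (addr_ge0 Cu0 Cv0) e3)) _.
  rewrite -[leLHS]mulr1; set a := `|E|; set b := Cu + Cv; set d := expR _; set e := ew _ _.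
  rewrite (_ : a * b * d * kap' * e * wt c x = a * (b * (d * e)) * (kap' * wt c x)); last by ring.
  apply: ler_wpM2l => //.
  apply: mulr_ge0; [exact: normr_ge0|apply: mulr_ge0; [exact: addr_ge0|]].
  by apply: mulr_ge0; exact: expR_ge0.
have key c p q xi : schwartz p -> schwartz q ->
    (forall x, jetb w m' p x (A * kap * wt c x)) -> (forall x, jetb w m' q x (A * kap * wt c x)) ->
    (forall x, `|p x| + `|q x| <=
       `|E| * (Cu + Cv) * expR ((2 * n)%:R * C1) * kap' * ew (2 * n) c * wt c x) ->
    `|trigint p q xi| <= (D1 + D2) * ew n c * ew l xi.
  move=> sp sq jp jq pq.
  have b1 := hdec c p q _ sp sq jp jq xi.
  have b2 := @trigint_dominated R N c p q _ xi (rsmooth_continuous sp.1) (rsmooth_continuous sq.1) pq.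
  (* Squares are compared: the product of the two bounds has the factor [D1 * D2], at most the
     square of [D1 + D2]. *)
  rewrite -(@ler_pXn2r _ 2)// ?nnegrE ?mulr_ge0 ?expR_ge0 ?addr_ge0//.
  rewrite expr2; apply: le_trans (ler_pM (normr_ge0 _) (normr_ge0 _) b1 b2) _.
  have dbl k y : ew (2 * k) y = ew k y ^+ 2 by rewrite mul2n -addnn expR_weightD expr2.
  rewrite !dbl; set a := ew l xi; set b := ew n c.
  rewrite (_ : K' * (A * kap) * a ^+ 2 * _ = D1 * D2 * (b * a) ^+ 2); last by rewrite /D1 /D2; ring.
  rewrite -[_ * b * a]mulrA [leRHS]exprMn; apply: ler_wpM2r; first exact: sqr_ge0.
  move: D10 D20; generalize D1 D2 => d1 d2 d10 d20; nra.
exists (K * (D1 + D2)) => c.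
(* The cut-off is 1 on this neighbourhood of [c], so [u] and its localization have the same jet at
   [c]. *)
pose U := [set x : V | forall i, `|x 0 i - c 0 i| < 1].
have oU : open U.
  rewrite (_ : U = ball (c : V) 1).
    exact: ball_open.
  apply/seteqP; split=> x.
    by move=> hx; split=> // i j; rewrite (ord1 i) /ball/= distrC; exact: hx.
  by move=> [_ hx] i; have := hx 0 i; rewrite /ball/= distrC.
apply: (jetb_local oU (v := fun x => chi c 1 x * u x)) => //.
- by move=> x xU; rewrite chi1 ?mul1r// => i; rewrite ltW// xU.
- by move=> i; rewrite subrr normr0.
have bu : boxed c 5 (fun x => chi c 1 x * u x) by move=> x i xi; rewrite (lchi c x i xi) mul0r.
have bv : boxed c 5 (fun x => chi c 1 x * v x) by move=> x i xi; rewrite (lchi c x i xi) mul0r.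
have shu : rsmooth (fun x => chi c 1 x * u x) by apply: rsmoothM => //; exact: chis.
have shv : rsmooth (fun x => chi c 1 x * v x) by apply: rsmoothM => //; exact: chis.
have scu : schwartz (fun x => chi c 1 x * u x).
  apply: hgs bu _ => // m1 m10; have [B _ hB] := prodj m1 m10; exists B => x.
  by have [] := hB c x.
have scv : schwartz (fun x => chi c 1 x * v x).
  apply: hgs bv _ => // m1 m10; have [B _ hB] := prodj m1 m10; exists B => x.
  by have [] := hB c x.
have ju := hkap m' c _ A m'0 bu (fun x _ => (hA c x).1) A0.
have jv := hkap m' c _ A m'0 bv (fun x _ => (hA c x).2) A0.
rewrite -mulrA; apply: (hjet _ (fun x => chi c 1 x * v x)) => //.
- by rewrite mulr_ge0 ?expR_ge0 ?addr_ge0.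
- by move=> xi; apply: key => //; exact: small.
- move=> xi; apply: key => //; first exact: schwartzN.
    by move=> x; apply: jetbN.
  by move=> x; rewrite normrN addrC; exact: small.
Qed.

End localization.

(** * The spaces *)

Lemma finite_threshold (T : Type) (F : set T) (P : T -> nat -> Prop) : finite_set F ->
  (forall p, F p -> exists k0, forall k, (k0 <= k)%N -> P p k) ->
  exists k, forall p, F p -> P p k.
Proof.
move=> /(@finite_seqP {classic T})[s ->] h.
suff [k hk] : exists k0, forall k, (k0 <= k)%N -> forall p, [set` s] p -> P p k.
  by exists k => p; apply: hk.
elim: s h => [|q s IH] h; first by exists 0%N.
have [k1 h1] := h q (mem_head q s).
have [|k2 h2] := IH; first by move=> p ps; apply: h; rewrite /= inE orbC [p \in s]ps.
exists (maxn k1 k2) => k; rewrite geq_max => /andP[k1k k2k] p /=.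
rewrite inE => /orP[/eqP ->|ps]; first exact: h1.
by apply: h2.
Qed.

(** Reduces density to approximation of each [f] by elements of [A] within each neighbourhood of 0,
    the form in which the truncations are used. *)
Lemma dense_subspaceI (K : numDomainType) (V : lmodType K) (E : lcs V) (A : set V) :
  A 0 -> (forall a f g, A f -> A g -> A (a *: f + g)) -> A `<=` E ->
  (forall f U, Defs.space E f -> nbhs0 E U -> exists2 g, A g & U (g - f)) ->
  A \dense_subspace_of E.
Proof.
move=> A0 Al AE h; split=> //.
  split; first exact/mem_set.
  by move=> a f g /set_mem Af /set_mem Ag; apply/mem_set; exact: Al.
move=> O [f Of] oO; have {}oO : lcs_open O by exact: oO.
have [U NU UO] := oO f Of.
have [g Ag Ug] := h (val f) U (set_mem (valP f)) NU.
pose g' : lcs_type E := exist _ g (mem_set (AE g Ag)).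
by exists g'; split => //; exact: UO.
Qed.

Section spaces.
Context (R : realType) (w : R -> R) (hw : nonquasianalytic_weight w) (N : nat).
Hypothesis N0 : (0 < N)%N.
Local Notation V := 'rV[R]_N.
Local Notation cf := (cfun R N).
Local Notation ew n x := (expR (- (n%:R * w (enorm x)))).
Local Notation re f := (fun x => complex.Re (f x)).
Local Notation im f := (fun x => complex.Im (f x)).
Local Notation normc := ComplexField.Normc.normc.
Implicit Types (f g : cf) (x xi : V) (m n k l : nat) (r : R) (a : multi_index N).

Lemma smoothE f : smooth f <-> rsmooth (re f) /\ rsmooth (im f).
Proof.
split=> [h|[h1 h2] k]; last by split.
by split=> k; have [] := h k.
Qed.

Lemma Re_linear (z : R[i]) f g : re (z *: f + g) =
  fun x => complex.Re z * complex.Re (f x) + - complex.Im z * complex.Im (f x) +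
           complex.Re (g x).
Proof.
apply/funext => x; rewrite -[(z *: f + g) x]/(z * f x + g x).
by case: z (f x) (g x) => a b [c d] [e h] /=; rewrite mulNr.
Qed.

Lemma Im_linear (z : R[i]) f g : im (z *: f + g) =
  fun x => complex.Re z * complex.Im (f x) + complex.Im z * complex.Re (f x) +
           complex.Im (g x).
Proof.
apply/funext => x; rewrite -[(z *: f + g) x]/(z * f x + g x).
by case: z (f x) (g x) => a b [c d] [e h] /=.
Qed.

Lemma rsmoothZ (c : R) (u : V -> R) : rsmooth u -> rsmooth (fun x => c * u x).
Proof. by move=> us; apply: rsmoothM => //; exact: rsmooth_cst. Qed.

Lemma smooth_linear z f g : smooth f -> smooth g -> smooth (z *: f + g).
Proof.
move=> /smoothE[f1 f2] /smoothE[g1 g2]; apply/smoothE.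
by rewrite Re_linear Im_linear; split; apply: rsmoothD => //; apply: rsmoothD; exact: rsmoothZ.
Qed.

Lemma smooth0 : smooth (0 : cf).
Proof. by apply/smoothE; split; exact: (@rsmooth_cst R N 0). Qed.

Definition lin_bound (z : R[i]) : R := `|complex.Re z| + `|complex.Im z|.

Lemma cjet_linear m z f g x (A B : R) : smooth f -> smooth g ->
  cjet w m f x A -> cjet w m g x B -> cjet w m (z *: f + g) x (lin_bound z * A + B).
Proof.
move=> /smoothE[f1 f2] /smoothE[g1 g2] [f1j f2j] [g1j g2j].
rewrite /cjet Re_linear Im_linear /lin_bound mulrDl; split.
  apply: (jetbD hw) => //; first by apply: rsmoothD; exact: rsmoothZ.
  rewrite -(normrN (complex.Im z)).
  by apply: (jetbD hw); [exact: rsmoothZ|exact: rsmoothZ|exact: jetbZ|exact: jetbZ].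
apply: (jetbD hw) => //; first by apply: rsmoothD; exact: rsmoothZ.
by apply: (jetbD hw); [exact: rsmoothZ|exact: rsmoothZ|exact: jetbZ|exact: jetbZ].
Qed.

Lemma cjetW m l f x (A B : R) : (0 < m)%N -> (m <= l)%N -> A <= B ->
  cjet w l f x A -> cjet w m f x B.
Proof. by move=> m0 ml AB [h1 h2]; split; exact: jetbW hw _ _ _ _ _ _ _ m0 ml AB _. Qed.

Lemma cjet0 m x : (0 < m)%N -> cjet w m (0 : cf) x 0.
Proof. by move=> m0; split; exact: (jetb0 hw). Qed.

Lemma cjet_local m (U : set V) f g x B : open U -> (forall y, U y -> f y = g y) -> U x ->
  cjet w m g x B -> cjet w m f x B.
Proof.
move=> oU fg Ux [h1 h2]; split.
  by apply: (jetb_local oU _ Ux h1) => y Uy; rewrite fg.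
by apply: (jetb_local oU _ Ux h2) => y Uy; rewrite fg.
Qed.

Lemma in_E f : Defs.space (E_space w N) f <-> smooth f /\
  forall K m, compact K -> (0 < m)%N -> exists C, forall x, K x -> cjet w m f x C.
Proof.
split=> [[fs h]|[fs h]]; split=> // K m cK m0.
  by have [C _ hC] := seminorm_p_lty hw m0 (h K m cK m0); exists C.
have [C hC] := h K m cK m0.
by apply: le_lt_trans (seminorm_p_le hw m0 hC) _; exact: ltry.
Qed.

Lemma in_OM f : Defs.space (OM_space w N) f <-> smooth f /\
  forall m, (0 < m)%N -> exists n C, (0 < n)%N /\
    forall x, cjet w m f x (C * expR (n%:R * w (enorm x))).
Proof.
split=> [h|[fs h] m /= m0].
  split; first by have [n _ []] := h 1%N isT.
  move=> m m0; have [n n0 [_ /(seminorm_r_lty hw m0)[C _ hC]]] := h m m0.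
  by exists n, C.
have [n [C [n0 hC]]] := h m m0; exists n => //; split=> //.
by apply: le_lt_trans (seminorm_r_le hw m0 hC) _; exact: ltry.
Qed.

Lemma in_OC_step n f :
  (\bigcap_(m in [set m | (0 < m)%N]) O_set w m n%:Z) f <-> smooth f /\
  forall m, (0 < m)%N -> exists C, forall x, cjet w m f x (C * expR (n%:R * w (enorm x))).
Proof.
split=> [h|[fs h] m /= m0].
  split; first by have [] := h 1%N isT.
  move=> m m0; have [_ /(seminorm_r_lty hw m0)[C _ hC]] := h m m0.
  by exists C.
have [C hC] := h m m0; split=> //.
by apply: le_lt_trans (seminorm_r_le hw m0 hC) _; exact: ltry.
Qed.

Lemma in_OC f : Defs.space (OC_space w N) f <-> exists2 n, (0 < n)%N & smooth f /\
  forall m, (0 < m)%N -> exists C, forall x, cjet w m f x (C * expR (n%:R * w (enorm x))).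
Proof.
split=> [[n n0 /in_OC_step h]|[n n0 h]]; first by exists n.
by exists n => //; apply/in_OC_step.
Qed.

Lemma compact_box r : compact [set x : V | forall i, `|x 0 i| <= r].
Proof.
have := @rV_compact R N (fun=> [set` `[- r, r]]) (fun=> @segment_compact R (- r) r).
rewrite (_ : [set v | _] = [set x : V | forall i, `|x 0 i| <= r])//.
by apply/seteqP; split=> x /= h i; have := h i; rewrite /= in_itv/= ler_norml.
Qed.

Lemma cjet_boxed m r f x i : (0 < m)%N -> boxed 0 r (re f) -> boxed 0 r (im f) ->
  r < `|x 0 i| -> cjet w m f x 0.
Proof.
move=> m0 b1 b2 xi; have xi' : r < `|x 0 i - (0 : V) 0 i| by rewrite mxE subr0.
by split; [exact: (jetb_boxed hw m0 b1 xi')|exact: (jetb_boxed hw m0 b2 xi')].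
Qed.

Lemma in_D f : D_space w N f <-> [/\ smooth f,
  exists2 r, 0 <= r & boxed 0 r (re f) /\ boxed 0 r (im f) &
  forall m, (0 < m)%N -> exists C, forall x, cjet w m f x C].
Proof.
split=> [[/in_E[fs fE] cf]|[fs [r r0 [b1 b2]] fj]]; last first.
  split; first by apply/in_E; split=> // K m cK m0; have [C hC] := fj m m0; exists C.
  apply: (subclosed_compact (@closed_closure _ _) (@compact_box r)).
  have /closure_id -> : closed [set x : V | forall i, `|x 0 i| <= r].
    by apply: compact_closed; [exact: norm_hausdorff|exact: compact_box].
  apply: closureS => x /= /eqP fx i; rewrite leNgt; apply/negP => xi; apply: fx.
  have xi' : r < `|x 0 i - (0 : V) 0 i| by rewrite mxE subr0.
  by have := b1 x i xi'; have := b2 x i xi'; case: (f x) => a b /= -> ->.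
have out x : ~ closure [set x | f x != 0] x -> f x = 0.
  by move=> nx; apply/eqP/negPn/negP => fx; apply: nx; exact: subset_closure.
split=> //.
  have [M [_ hM]] := compact_bounded cf.
  pose r := `|M| + 1; exists r; first by rewrite addr_ge0.
  have b x i : r < `|x 0 i - (0 : V) 0 i| -> f x = 0.
    rewrite mxE subr0 => xi; apply: out => cx.
    have /(_ x cx) : forall x, closure [set x | f x != 0] x -> `|x| <= r.
      by apply: hM; rewrite /r; have := ler_norm M; lra.
    by move=> /(le_trans (coord_norm_le x i)); rewrite leNgt xi.
  by split=> x i xi; rewrite (b x i xi).
move=> m m0; have [C hC] := fE _ m cf m0; exists `|C| => x.
have [cx|ncx] := pselect (closure [set x | f x != 0] x).
  by apply: cjetW (hC x cx) => //; exact: ler_norm.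
apply: (cjetW m0 (leqnn m) (normr_ge0 C)).
apply: (@cjet_local m (~` closure [set x | f x != 0]) f 0 x 0) => //.
- by apply: closed_openC; exact: closed_closure.
- exact: cjet0.
Qed.

Lemma Re_fourier f : re (fourier f) = trigint (re f) (im f).
Proof.
apply/funext => xi; rewrite /fourier /cintegral /=; apply: eq_Rintegral => t _.
by case: (f _) => a b /=; rewrite cosN sinN; ring.
Qed.

Lemma Im_fourier f : im (fourier f) = trigint (im f) (fun x => - complex.Re (f x)).
Proof.
apply/funext => xi; rewrite /fourier /cintegral /=; apply: eq_Rintegral => t _.
by case: (f _) => a b /=; rewrite cosN sinN; ring.
Qed.

Lemma weighted_sup_lty (l : R) a f : (weighted_sup w l a f < +oo)%E <->
  exists C, forall x, expR (l * w (enorm x)) * normc (mpartial a f x) <= C.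
Proof.
split=> [h|[C hC]].
  exists (fine (weighted_sup w l a f)) => x; rewrite -lee_fin.
  have le : ((expR (l * w (enorm x)) * normc (mpartial a f x))%:E <= weighted_sup w l a f)%E.
    by apply: ereal_sup_ubound; exists x.
  apply: le_trans le _; case: (weighted_sup w l a f) h => [//|//|_]; exact: leNye.
apply: (@le_lt_trans _ _ C%:E); last exact: ltry.
by apply: ge_ereal_sup => _ [x _ <-]; rewrite lee_fin.
Qed.

Lemma weighted_sup_decay f :
  (forall (l : R) a, 0 < l -> (weighted_sup w l a f < +oo)%E) <->
  (forall s n, sortedw s -> exists2 C, 0 <= C & forall x,
     `|rderw s (re f) x| <= C * ew n x /\ `|rderw s (im f) x| <= C * ew n x).
Proof.
split=> [h s n ss|h l a l0].
  (* [n.+1] because the hypothesis concerns positive exponents only, while [n] may be 0. *)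
  have /weighted_sup_lty[C hC] := h n.+1%:R [ffun i => count_mem i s] (ltr0Sn _ n).
  have hn x : normc (mpartial [ffun i => count_mem i s] f x) <= `|C| * ew n x.
    apply: (@le_trans _ _ (`|C| * ew n.+1 x)); last first.
      by rewrite ler_wpM2l// (expR_weight_le hw).
    rewrite expRN ler_pdivlMr ?expR_gt0// mulrC.
    exact: le_trans (hC x) (ler_norm C).
  exists `|C| => // x; split.
    by apply: le_trans (hn x); rewrite -[s in leLHS]word_count// -Re_mpartial normRe_le.
  by apply: le_trans (hn x); rewrite -[s in leLHS]word_count// -Im_mpartial normIm_le.
apply/weighted_sup_lty.
pose n := Num.bound l; have ln : l <= n%:R by rewrite ltW// archi_boundP// ltW.
have [C C0 hC] := h (word a) n (sorted_word a); exists (2 * C) => x.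
have [h1 h2] := hC x.
have le : normc (mpartial a f x) <= 2 * C * ew n x.
  apply: le_trans (normc_le _) _.
  have -> : complex.Re (mpartial a f x) = rderw (word a) (re f) x by rewrite -Re_mpartial.
  have -> : complex.Im (mpartial a f x) = rderw (word a) (im f) x by rewrite -Im_mpartial.
  lra.
apply: le_trans (ler_wpM2l (expR_ge0 _) le) _.
have w0 : 0 <= w (enorm x) by apply: (weight_ge0 hw); exact: enorm_ge0.
have le1 : expR (l * w (enorm x)) * ew n x <= 1.
  rewrite -expRD -[leRHS]expR0 ler_expR subr_le0.
  exact: ler_wpM2r w0 _ _ ln.
rewrite mulrCA -[leRHS]mulr1 ler_wpM2l// mulr_ge0//.
Qed.

(** This is the finiteness of the seminorms [seminorm_q] on S. For the converse, derivatives of the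
    transform are transforms of [mulw s], which preserves the class. *)
Lemma in_S_gs f : Defs.space (S_space w N) f <->
  gs_class w (re f) /\ gs_class w (im f).
Proof.
split=> [[_ /smoothE[us vs] _ h]|[hu hv]].
  have /weighted_sup_decay hf : forall (l : R) a, 0 < l -> (weighted_sup w l a f < +oo)%E.
    by move=> l a l0; have [] := h l a l0.
  have /weighted_sup_decay hF : forall (l : R) a, 0 < l ->
      (weighted_sup w l a (fourier f) < +oo)%E.
    by move=> l a l0; have [] := h l a l0.
  have du s n : sortedw s -> exists2 C, 0 <= C & forall x, `|rderw s (re f) x| <= C * ew n x.
    by move=> ss; have [C C0 hC] := hf s n ss; exists C => // x; have [] := hC x.
  have dv s n : sortedw s -> exists2 C, 0 <= C & forall x, `|rderw s (im f) x| <= C * ew n x.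
    by move=> ss; have [C C0 hC] := hf s n ss; exists C => // x; have [] := hC x.
  have dT1 n : exists2 C, 0 <= C & forall xi, `|trigint (re f) (im f) xi| <= C * ew n xi.
    have [C C0 hC] := hF [::] n isT; exists C => // x; have [] := hC x.
    by rewrite Re_fourier.
  have dT2 n : exists2 C, 0 <= C & forall xi,
      `|trigint (im f) (fun x => - complex.Re (f x)) xi| <= C * ew n xi.
    have [C C0 hC] := hF [::] n isT; exists C => // x; have [] := hC x.
    by rewrite Im_fourier.
  have dNu s n : sortedw s -> exists2 C, 0 <= C & forall x,
      `|rderw s (fun x => - complex.Re (f x)) x| <= C * ew n x.
    move=> ss; have [C C0 hC] := du s n ss; exists C => // x.
    by rewrite (rderwN s us) normrN.
  have sch (u : V -> R) : rsmooth u -> (forall s n, sortedw s ->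
      exists2 C, 0 <= C & forall x, `|rderw s u x| <= C * ew n x) -> rapid u.
    move=> su hu; apply: (rapid_weight_decay hw); first exact: rsmooth_continuous.
    by move=> n; exact: (hu [::]).
  split; first exact: (gs_class_of_decay hw N0 us vs du dv dT1 dT2).
  (* The imaginary part is the first component of the pair of - i [f], whose transform has the same
     two parts up to sign. *)
  apply: (gs_class_of_decay hw N0 vs (rsmoothN us) dv dNu dT2) => n.
  have [C C0 hC] := dT1 n; exists C => // xi.
  by rewrite trigintN ?normrN; [exact: hC|exact: sch|exact: sch].
have [us _] := hu; have [vs _] := hv.
have su := schwartz_gs_class hw hu; have sv := schwartz_gs_class hw hv.
have ru : rapid (re f) := su.2 [::] isT; have rv : rapid (im f) := sv.2 [::] isT.
have hNu := gs_classN hu; have rNu := rapidN ru.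
have [C C0 hC] := rapid_dominated ru rv.
split.
- split.
    apply: (@Lint_dominated R N 0 (re f) C ru.1) => x.
    by apply: le_trans (hC x); rewrite lerDl.
  apply: (@Lint_dominated R N 0 (im f) C rv.1) => x.
  by apply: le_trans (hC x); rewrite lerDr.
- by apply/smoothE.
- by apply/smoothE; rewrite Re_fourier Im_fourier; split; exact: rsmooth_trigint.
move=> l a l0; split.
  move: l a l0; apply/weighted_sup_decay => s n ss.
  have [A A0 hA] := gs_class_decay hw n hu ss; have [B B0 hB] := gs_class_decay hw n hv ss.
  exists (A + B); first exact: addr_ge0.
  move=> x; split; [apply: le_trans (hA x) _|apply: le_trans (hB x) _];
    by rewrite ler_wpM2r ?expR_ge0 ?lerDl ?lerDr.
move: l a l0; apply/weighted_sup_decay => s n ss.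
rewrite Re_fourier Im_fourier !rderw_trigint//.
have [g1 g2] := gs_class_mulw hw s hu hv; have [g3 g4] := gs_class_mulw hw s hv hNu.
have [A A0 hA] := gs_class_trigint_decay hw n N0 g1 g2.
have [B B0 hB] := gs_class_trigint_decay hw n N0 g3 g4.
exists (A + B); first exact: addr_ge0.
move=> x; split; [apply: le_trans (hA x) _|apply: le_trans (hB x) _];
  by rewrite ler_wpM2r ?expR_ge0 ?lerDl ?lerDr.
Qed.

Lemma in_S f : Defs.space (S_space w N) f <-> smooth f /\
  forall m n, (0 < m)%N -> exists C, forall x, cjet w m f x (C * ew n x).
Proof.
rewrite in_S_gs; split=> [[[us hu] [vs hv]]|[/smoothE[us vs] h]].
  split; first by apply/smoothE.
  move=> m n m0; have [A hA] := hu m n m0; have [B hB] := hv m n m0.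
  exists (`|A| + `|B|) => x; split.
    apply: (jetbW hw m0 (leqnn m) _ (hA x)); rewrite ler_wpM2r ?expR_ge0//.
    by apply: le_trans (ler_norm A) _; rewrite lerDl.
  apply: (jetbW hw m0 (leqnn m) _ (hB x)); rewrite ler_wpM2r ?expR_ge0//.
  by apply: le_trans (ler_norm B) _; rewrite lerDr.
by split; split=> // m n m0; have [C hC] := h m n m0; exists C => x; have [] := hC x.
Qed.

End spaces.

(** * Linear structure, inclusions and truncations *)

Section density.
Context (R : realType) (w : R -> R) (hw : nonquasianalytic_weight w) (N : nat).
Hypothesis N0 : (0 < N)%N.
Local Notation V := 'rV[R]_N.
Local Notation cf := (cfun R N).
Local Notation W x := (w (enorm x)).
Local Notation ew n x := (expR (- (n%:R * w (enorm x)))).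
Local Notation re f := (fun x => complex.Re (f x)).
Local Notation im f := (fun x => complex.Im (f x)).
Implicit Types (f g : cf) (x xi : V) (m n k l : nat) (r : R) (a : R[i]).

Lemma weight_enorm_ge0 x : 0 <= W x.
Proof. by apply: (weight_ge0 hw); exact: enorm_ge0. Qed.

(** By [weight_log], a bound on [w] at [k + 1] would bound [k + 1] itself. *)
Lemma weight_unbounded (B e : R) : 0 <= B -> 0 < e ->
  exists k0, forall k, (k0 <= k)%N -> B * expR (- w k.+1%:R) <= e.
Proof.
move=> B0 e0; have [p [C [C0 hC]]] := weight_log hw.
pose M := ln (B / e + 1).
have b0 : 0 < B / e + 1 by rewrite ltr_wpDl// divr_ge0// ltW.
exists (Num.bound (C * expR (p%:R * M))) => k hk.
have wM : M <= w k.+1%:R.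
  rewrite leNgt; apply/negP => wk.
  have h1 : C * expR (p%:R * M) < k%:R.
    apply: lt_le_trans (archi_boundP _) _; first by rewrite mulr_ge0 ?expR_ge0// ltW.
    by rewrite ler_nat.
  have h2 := hC k.+1%:R (ler0n _ _).
  have h3 : C * expR (p%:R * w k.+1%:R) <= C * expR (p%:R * M).
    by rewrite ler_wpM2l ?(ltW C0)// ler_expR ler_wpM2l// ltW.
  have := le_lt_trans (le_trans h2 h3) h1.
  by rewrite -natr1; lra.
apply: le_trans (_ : B * expR (- M) <= _); first by rewrite ler_wpM2l// ler_expR lerN2.
rewrite expRN /M lnK// ler_pdivrMr// mulrDr mulr1 mulrCA divff ?gt_eqF// mulr1.
by rewrite lerDl ltW.
Qed.

Definition cut (p : V -> R) f : cf :=
  fun x => (p x * complex.Re (f x) +i* (p x * complex.Im (f x)))%C.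

Lemma smooth_cut p f : rsmooth p -> smooth f -> smooth (cut p f).
Proof. by move=> ps /smoothE[us vs]; apply/smoothE; split; exact: rsmoothM. Qed.

Lemma cut_in_D p r f : rsmooth p -> 0 <= r -> boxed 0 r p ->
  (forall m, (0 < m)%N -> exists2 C, 0 <= C & forall x, jetb w m p x C) ->
  Defs.space (E_space w N) f -> D_space w N (cut p f).
Proof.
move=> ps r0 bp pj /(in_E hw)[fs fE]; have /smoothE[us vs] := fs.
have b1 : boxed 0 r (re (cut p f)) by move=> x i xi; rewrite /= (bp x i xi) mul0r.
have b2 : boxed 0 r (im (cut p f)) by move=> x i xi; rewrite /= (bp x i xi) mul0r.
apply/(in_D hw); split; first exact: smooth_cut.
  by exists r.
move=> m m0; have [l [C [l0 C0 hC]]] := jetb_mul hw N m0.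
have [A A0 hA] := pj l l0; have [B hB] := fE _ l (@compact_box R N r) l0.
exists `|C * A * B| => x.
have [[i xi]|xr] := box_dichotomy 0 r x.
  rewrite mxE subr0 in xi.
  exact: (cjetW hw m0 (leqnn m) (normr_ge0 _) (cjet_boxed hw m0 b1 b2 xi)).
have [j1 j2] : cjet w l f x B.
  by apply: hB => i /=; have := xr i; rewrite mxE subr0.
apply: (cjetW hw m0 (leqnn m) (ler_norm _)).
by split; exact: hC.
Qed.

(** Cut-offs at 0 of radius [k + 1], which is at least 1, so that their jets are bounded uniformly
    in [k]. *)
Lemma cut_family : exists psi : nat -> V -> R,
  [/\ forall k, rsmooth (psi k),
      forall k x, `|x| <= k.+1%:R -> psi k x = 1,
      forall k, boxed 0 (5 * k.+1%:R) (psi k) &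
      forall m, (0 < m)%N -> exists2 C, 0 <= C & forall k x, jetb w m (psi k) x C].
Proof.
have [chi [chis chi1 chi0 chij]] := cutoff_exists hw N.
have k1 k : 1 <= k.+1%:R :> R by rewrite ler1n.
exists (fun k => chi 0 k.+1%:R); split.
- by move=> k; exact: chis.
- move=> k x xk; apply: chi1 => // i; rewrite mxE subr0.
  exact: le_trans (coord_norm_le x i) xk.
- by move=> k x i xi; apply: (chi0 0 _ x i) => //; exact: ltW.
- move=> m m0; have [C hC] := chij m m0; exists `|C| => // k x.
  exact: (jetbW hw m0 (leqnn m) (ler_norm C) (hC _ _ _ (k1 k))).
Qed.

Lemma sub_linear f g : g - f = (-1) *: f + g.
Proof. by rewrite scaleN1r addrC. Qed.

Lemma D_linear a f g : D_space w N f -> D_space w N g -> D_space w N (a *: f + g).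
Proof.
move=> /(in_D hw)[fs [r r0 [f1 f2]] fj] /(in_D hw)[gs [q q0 [g1 g2]] gj].
apply/(in_D hw); split; first exact: smooth_linear.
  exists (r + q); first exact: addr_ge0.
  rewrite Re_linear Im_linear; split=> x i xi.
    have xr : r < `|x 0 i - (0 : V) 0 i| by apply: le_lt_trans xi; rewrite lerDl.
    have xq : q < `|x 0 i - (0 : V) 0 i| by apply: le_lt_trans xi; rewrite lerDr.
    by rewrite (f1 x i xr) (f2 x i xr) (g1 x i xq) !mulr0 !addr0.
  have xr : r < `|x 0 i - (0 : V) 0 i| by apply: le_lt_trans xi; rewrite lerDl.
  have xq : q < `|x 0 i - (0 : V) 0 i| by apply: le_lt_trans xi; rewrite lerDr.
  by rewrite (f1 x i xr) (f2 x i xr) (g2 x i xq) !mulr0 !addr0.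
move=> m m0; have [A hA] := fj m m0; have [B hB] := gj m m0.
by exists (lin_bound a * A + B) => x; exact: cjet_linear.
Qed.

Lemma D0 : D_space w N (0 : cf).
Proof.
apply/(in_D hw); split; first exact: smooth0.
  by exists 0.
by move=> m m0; exists 0 => x; exact: cjet0.
Qed.

Lemma S_linear a f g : Defs.space (S_space w N) f -> Defs.space (S_space w N) g ->
  Defs.space (S_space w N) (a *: f + g).
Proof.
move=> /(in_S hw N0)[fs fj] /(in_S hw N0)[gs gj].
apply/(in_S hw N0); split; first exact: smooth_linear.
move=> m n m0; have [A hA] := fj m n m0; have [B hB] := gj m n m0.
exists (lin_bound a * A + B) => x; rewrite mulrDl -mulrA.
exact: cjet_linear.
Qed.

Lemma expR_weight_natle n k x : (n <= k)%N -> expR (n%:R * W x) <= expR (k%:R * W x).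
Proof. by move=> nk; rewrite ler_expR ler_wpM2r ?ler_nat// weight_enorm_ge0. Qed.

Lemma cjet_grow m n k f x (C : R) : (0 < m)%N -> (n <= k)%N ->
  cjet w m f x (C * expR (n%:R * W x)) -> cjet w m f x (`|C| * expR (k%:R * W x)).
Proof.
move=> m0 nk; apply: (cjetW hw) => //.
apply: le_trans (ler_wpM2r (expR_ge0 _) (ler_norm C)) _.
by rewrite ler_wpM2l// expR_weight_natle.
Qed.

Lemma cjet_linear_grow m n a f g x (A B : R) : smooth f -> smooth g ->
  cjet w m f x (A * expR (n%:R * W x)) -> cjet w m g x (B * expR (n%:R * W x)) ->
  cjet w m (a *: f + g) x ((lin_bound a * A + B) * expR (n%:R * W x)).
Proof. by move=> fs gs jf jg; rewrite mulrDl -mulrA; exact: cjet_linear. Qed.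

Lemma OC_linear a f g : Defs.space (OC_space w N) f -> Defs.space (OC_space w N) g ->
  Defs.space (OC_space w N) (a *: f + g).
Proof.
move=> /(in_OC hw)[n n0 [fs fj]] /(in_OC hw)[k k0 [gs gj]].
apply/(in_OC hw); exists (n + k)%N; first by rewrite addn_gt0 n0.
split; first exact: smooth_linear.
move=> m m0; have [A hA] := fj m m0; have [B hB] := gj m m0.
exists (lin_bound a * `|A| + `|B|) => x; apply: cjet_linear_grow => //.
  exact: cjet_grow m0 (leq_addr _ _) (hA x).
exact: cjet_grow m0 (leq_addl _ _) (hB x).
Qed.

Lemma OM_linear a f g : Defs.space (OM_space w N) f -> Defs.space (OM_space w N) g ->
  Defs.space (OM_space w N) (a *: f + g).
Proof.
move=> /(in_OM hw)[fs fj] /(in_OM hw)[gs gj].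
apply/(in_OM hw); split; first exact: smooth_linear.
move=> m m0; have [n [A [n0 hA]]] := fj m m0; have [k [B [k0 hB]]] := gj m m0.
exists (n + k)%N, (lin_bound a * `|A| + `|B|); split; first by rewrite addn_gt0 n0.
move=> x; apply: cjet_linear_grow => //.
  exact: cjet_grow m0 (leq_addr _ _) (hA x).
exact: cjet_grow m0 (leq_addl _ _) (hB x).
Qed.

Lemma E_linear a f g : Defs.space (E_space w N) f -> Defs.space (E_space w N) g ->
  Defs.space (E_space w N) (a *: f + g).
Proof.
move=> /(in_E hw)[fs fj] /(in_E hw)[gs gj].
apply/(in_E hw); split; first exact: smooth_linear.
move=> K m cK m0; have [A hA] := fj K m cK m0; have [B hB] := gj K m cK m0.
by exists (lin_bound a * A + B) => x Kx; apply: cjet_linear => //; [exact: hA|exact: hB].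
Qed.

Lemma D_sub_S : D_space w N `<=` S_space w N.
Proof.
move=> f /(in_D hw)[/smoothE[us vs] [r r0 [b1 b2]] fj]; apply/(in_S_gs hw N0).
by split; [apply: gs_class_boxed b1 _ => //|apply: gs_class_boxed b2 _ => //] => m m0;
  have [A hA] := fj m m0; exists A => x _; have [] := hA x.
Qed.

Lemma S_sub_OC : S_space w N `<=` OC_space w N.
Proof.
move=> f /(in_S hw N0)[fs fj]; apply/(in_OC hw); exists 1%N => //; split=> // m m0.
have [C hC] := fj m 0%N m0; exists `|C| => x.
apply: (cjetW hw m0 (leqnn m) _ (hC x)); rewrite mul0r oppr0 expR0 mulr1.
apply: le_trans (ler_norm C) _; rewrite ler_peMr// -[leLHS]expR0 ler_expR.
by rewrite mulr_ge0// weight_enorm_ge0.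
Qed.

Lemma OC_sub_OM : OC_space w N `<=` OM_space w N.
Proof.
move=> f /(in_OC hw)[n n0 [fs fj]]; apply/(in_OM hw); split=> // m m0.
by have [C hC] := fj m m0; exists n, C.
Qed.

Lemma compact_norm_le (K : set V) : compact K -> exists2 M : R, 0 <= M & forall x, K x -> `|x| <= M.
Proof.
move=> /compact_bounded[M [_ hM]]; exists (`|M| + 1); first exact: addr_ge0.
by apply: hM; have := ler_norm M; lra.
Qed.

Lemma OM_sub_E : OM_space w N `<=` E_space w N.
Proof.
move=> f /(in_OM hw)[fs fj]; apply/(in_E hw); split=> // K m cK m0.
have [n [C [n0 hC]]] := fj m m0; have [M M0 hM] := compact_norm_le cK.
exists (`|C| * expR (n%:R * w (N%:R * M))) => x Kx.
apply: (cjetW hw m0 (leqnn m) _ (hC x)).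
apply: le_trans (ler_wpM2r (expR_ge0 _) (ler_norm C)) _.
rewrite ler_wpM2l// ler_expR ler_wpM2l//; apply: (weight_le hw); first exact: enorm_ge0.
apply: enorm_le => // i; exact: le_trans (coord_norm_le x i) (hM x Kx).
Qed.

Lemma D_sub_E : D_space w N `<=` E_space w N. Proof. by move=> f []. Qed.

(* All the density statements are witnessed by the same truncations. *)
Section truncations.
Variable psi : nat -> V -> R.
Hypothesis psis : forall k, rsmooth (psi k).
Hypothesis psi1 : forall k x, `|x| <= k.+1%:R -> psi k x = 1.
Hypothesis psi0 : forall k, boxed 0 (5 * k.+1%:R) (psi k).
Hypothesis psij :
  forall m, (0 < m)%N -> exists2 C, 0 <= C & forall k x, jetb w m (psi k) x C.

Let err k f : cf := cut (psi k) f - f.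

Let Re_err k f : re (err k f) = fun x => (psi k x + -1) * complex.Re (f x).
Proof.
apply/funext => x; rewrite /err -[(_ - _) x]/(cut (psi k) f x - f x) /cut.
by case: (f x) => a b /=; ring.
Qed.

Let Im_err k f : im (err k f) = fun x => (psi k x + -1) * complex.Im (f x).
Proof.
apply/funext => x; rewrite /err -[(_ - _) x]/(cut (psi k) f x - f x) /cut.
by case: (f x) => a b /=; ring.
Qed.

Lemma cjet_err0 m k f x : (0 < m)%N -> smooth f -> `|x| < k.+1%:R -> cjet w m (err k f) x 0.
Proof.
move=> m0 fs xk; apply: (@cjet_local R w N m [set x : V | `|x| < k.+1%:R] _ 0) => //.
- apply: (@open_comp _ _ (fun x : V => `|x|) [set t | t < k.+1%:R]); last exact: open_lt.
  by move=> y _; exact: norm_continuous.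
- move=> y /= yk; rewrite /err -[(_ - _) y]/(cut (psi k) f y - f y) /cut psi1 ?ltW//.
  by case: (f y) => a b; rewrite !mul1r subrr.
- exact: cjet0.
Qed.

(** The error is [f] times [psi k - 1], a factor whose jets are bounded uniformly in [k] and [x]. *)
Lemma cjet_err m : (0 < m)%N -> exists l C, [/\ (0 < l)%N, 0 <= C &
  forall f k x A, smooth f -> cjet w l f x A -> cjet w m (err k f) x (C * A)].
Proof.
move=> m0; have [l [C [l0 C0 hC]]] := jetb_mul hw N m0.
have [A A0 hA] := psij l0; exists l, (C * (A + 1)); split=> //.
  by rewrite mulr_ge0// addr_ge0.
move=> f k x B /smoothE[us vs] [j1 j2].
have sm : rsmooth (fun x => psi k x + -1) by apply: rsmoothD => //; exact: rsmooth_cst.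
have jm : jetb w l (fun x => psi k x + -1) x (A + 1).
  apply: (jetbD hw) => //; first exact: rsmooth_cst.
  by have := jetb_cst hw (-1) x l0; rewrite normrN normr1.
by rewrite /cjet Re_err Im_err; split; exact: hC.
Qed.

Lemma trunc_in_D k f : Defs.space (E_space w N) f -> D_space w N (cut (psi k) f).
Proof.
move=> fE; have r0 : 0 <= 5 * k.+1%:R :> R by rewrite mulr_ge0.
apply: (cut_in_D (psis k) r0 (@psi0 k) _ fE) => m m0.
by have [C C0 hC] := psij m0; exists C.
Qed.

(** Inside the ball of radius [k + 1] the error vanishes; outside, the spare factor is at most exp
    (- w (k + 1)). The free weight [sg] covers the decaying seminorms of S as well as the growing
    ones of the other spaces. *)
Lemma cut_approx m : (0 < m)%N -> exists2 l, (0 < l)%N & forall f (sg : V -> R) (A e : R),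
  smooth f -> (forall x, 0 < sg x) -> 0 < e ->
  (forall x, cjet w l f x (A * (expR (- W x) * sg x))) ->
  exists k0, forall k, (k0 <= k)%N -> forall x, cjet w m (err k f) x (e * sg x).
Proof.
move=> m0; have [l [C [l0 C0 hC]]] := cjet_err m0; exists l => // f sg A e fs sg0 e0 fj.
have [k0 hk0] := @weight_unbounded (C * `|A|) e (mulr_ge0 C0 (normr_ge0 A)) e0.
exists k0 => k kk0 x.
have [xk|xk] := ltP (enorm x) k.+1%:R.
  apply: (cjetW hw m0 (leqnn m) _ (@cjet_err0 m k f x m0 fs _)).
    by rewrite mulr_ge0// ltW.
  apply: le_lt_trans xk; apply: mx_norm_le; first exact: enorm_ge0.
  by move=> i; exact: coord_le_enorm.
have fj' : cjet w l f x (`|A| * (expR (- W x) * sg x)).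
  apply: (cjetW hw l0 (leqnn l) _ (fj x)); rewrite ler_wpM2r ?ler_norm//.
  by rewrite mulr_ge0 ?expR_ge0// ltW.
apply: (cjetW hw m0 (leqnn m) _ (hC f k x _ fs fj')).
rewrite !mulrA; apply: ler_wpM2r; first exact: ltW.
apply: le_trans (hk0 k kk0); rewrite ler_wpM2l ?mulr_ge0//.
by rewrite ler_expR lerN2; apply: (weight_le hw).
Qed.

(** The 2 is lost in passing from real and imaginary parts to the modulus; [e / 3] leaves room for
    the strict inequality. *)
Lemma half_lt (e : R) : 0 < e -> ((2 * (e / 3))%:E < e%:E)%E.
Proof. by move=> e0; rewrite lte_fin; lra. Qed.

Lemma dense_DS : D_space w N \dense_subspace_of S_space w N.
Proof.
apply: dense_subspaceI D0 D_linear D_sub_S _ => f U fS [F [e [finF FP e0 FU]]].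
have fE : Defs.space (E_space w N) f by exact/OM_sub_E/OC_sub_OM/S_sub_OC.
have gD k := trunc_in_D k fE; have [fs fj] := (in_S hw N0 f).1 fS.
have [p Fp|k hk] := @finite_threshold _ F
    (fun p k => (p (cut (psi k) f - f)%R < e%:E)%E) finF; last first.
  exists (cut (psi k) f); first exact: gD; apply: FU hk.
  by rewrite sub_linear; apply: S_linear fS _; apply: D_sub_S; exact: gD.
have [[m n] /= [m0 n0] <-] := FP p Fp.
(* One order of decay more than the seminorm asks for provides the spare factor. *)
have [l l0 h] := cut_approx m0; have [A hA] := fj l n.+1 l0.
have [|||k0 hk0] := h f (fun x => ew n x) A (e / 3) fs.
- by move=> x; exact: expR_gt0.
- by rewrite divr_gt0.
- by move=> x; rewrite -expRD -opprD -[X in X + _]mul1r -mulrDl addrC natr1.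
exists k0 => k kk0; apply: le_lt_trans (half_lt e0).
exact: (seminorm_q_le hw m0 (hk0 k kk0)).
Qed.

Lemma dense_SOC : S_space w N \dense_subspace_of OC_space w N.
Proof.
apply: dense_subspaceI _ S_linear S_sub_OC _; first exact/D_sub_S/D0.
move=> f U fC [Y [_ NY YU]]; have fE : Defs.space (E_space w N) f by exact/OM_sub_E/OC_sub_OM.
have gD k := trunc_in_D k fE; have [n n0 [fs fj]] := (in_OC hw f).1 fC.
(* The approximation takes place in the single step [n.+1], where [f], bounded at step [n], has a
   factor exp (- w) to spare; the trace of the neighbourhood on this step suffices. *)
have [F [e [finF FP e0 FO]]] := NY n.+1 isT.
have gC k : Defs.space (OC_space w N) (cut (psi k) f) by exact/S_sub_OC/D_sub_S.
have [p Fp|k hk] := @finite_threshold _ F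
    (fun p k => (p (cut (psi k) f - f)%R < e%:E)%E) finF; last first.
  exists (cut (psi k) f); first exact: D_sub_S.
  apply: YU; split; first by rewrite sub_linear; exact: OC_linear.
  apply: FO hk; apply/(in_OC_step hw).
  have gs : smooth (cut (psi k) f) by have [] := (in_D hw _).1 (gD k).
  rewrite sub_linear; split; first exact: smooth_linear.
  move=> m m0; have [A hA] := fj m m0.
  have [_ _ /(_ m m0)[B hB]] := (in_D hw _).1 (gD k).
  exists (lin_bound (-1) * `|A| + `|B|) => x; apply: cjet_linear_grow => //.
    exact: cjet_grow m0 (leqnSn n) (hA x).
  apply: (@cjet_grow m 0 n.+1) => //; rewrite mul0r expR0 mulr1; exact: hB.
have [m m0 <-] := FP p Fp.
have [l l0 h] := cut_approx m0; have [A hA] := fj l l0.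
have [|||k0 hk0] := h f (fun x => expR (n.+1%:R * W x)) A (e / 3) fs.
- by move=> x; exact: expR_gt0.
- by rewrite divr_gt0.
- by move=> x; rewrite -expRD -natr1 mulrDl mul1r addrCA addNr addr0.
exists k0 => k kk0; apply: le_lt_trans (half_lt e0).
exact: (seminorm_r_le hw m0 (hk0 k kk0)).
Qed.

Lemma dense_OCOM : OC_space w N \dense_subspace_of OM_space w N.
Proof.
apply: dense_subspaceI _ OC_linear OC_sub_OM _; first exact/S_sub_OC/D_sub_S/D0.
move=> f U fM [F [Y [finF FP NY YU]]].
have fE : Defs.space (E_space w N) f by exact/OM_sub_E.
have gD k := trunc_in_D k fE; have [fs fj] := (in_OM hw f).1 fM.
have gC k : Defs.space (OC_space w N) (cut (psi k) f) by exact/S_sub_OC/D_sub_S.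
have [m Fm|k hk] := @finite_threshold _ F (fun m k => Y m (cut (psi k) f - f)) finF; last first.
  exists (cut (psi k) f); first exact: gC; apply: YU; split; last exact: hk.
  by rewrite sub_linear; apply: OM_linear fM _; apply: OC_sub_OM; exact: gC.
have m0 : (0 < m)%N := FP m Fm.
have [P [_ NP PO]] := NY m Fm.
have [l l0 h] := cut_approx m0; have [n [A [n0 hA]]] := fj l l0.
(* For each of the finitely many [m] involved, the step [n] is that of the larger index [l], and the
   approximation again takes place one step further. *)
have [G [e [finG GP e0 GO]]] := NP n.+1 isT.
have [|||k0 hk0] := h f (fun x => expR (n.+1%:R * W x)) A (e / 3) fs.
- by move=> x; exact: expR_gt0.
- by rewrite divr_gt0.
- by move=> x; rewrite -expRD -natr1 mulrDl mul1r addrCA addNr addr0.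
exists k0 => k kk0; have hr := seminorm_r_le hw m0 (hk0 k kk0).
have hO : O_set w m n.+1%:Z (cut (psi k) f - f).
  split; last by apply: le_lt_trans hr _; exact: ltry.
  by rewrite sub_linear; apply: smooth_linear => //; have [] := (in_D hw _).1 (gD k).
apply: PO; split; first by exists n.+1.
apply: GO => // p /GP ->; exact: le_lt_trans hr (half_lt e0).
Qed.

Lemma dense_OME : OM_space w N \dense_subspace_of E_space w N.
Proof.
have D_sub_OM f : D_space w N f -> Defs.space (OM_space w N) f.
  by move=> fD; exact/OC_sub_OM/S_sub_OC/D_sub_S.
apply: dense_subspaceI _ OM_linear OM_sub_E _; first exact/D_sub_OM/D0.
move=> f U fE [F [e [finF FP e0 FU]]].
have gD k := trunc_in_D k fE; have [fs fj] := (in_E hw f).1 fE.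
have [p Fp|k hk] := @finite_threshold _ F
    (fun p k => (p (cut (psi k) f - f)%R < e%:E)%E) finF; last first.
  exists (cut (psi k) f); first exact: D_sub_OM.
  by apply: FU hk; rewrite sub_linear; apply: E_linear fE _; apply: D_sub_E; exact: gD.
have [[K m] /= [cK m0] <-] := FP p Fp.
have [M M0 hM] := compact_norm_le cK.
(* Once the radius exceeds the size of [K], the truncation agrees with [f] near [K], so the seminorm
   of the error is 0. *)
exists (Num.bound M) => k hk; apply: (@le_lt_trans _ _ (2 * 0)%:E); last by rewrite mulr0 lte_fin.
apply: (seminorm_p_le hw m0) => x Kx; apply: cjet_err0 => //.
apply: le_lt_trans (hM x Kx) _; apply: lt_le_trans (archi_boundP M0) _.
by rewrite ler_nat ltnW.
Qed.

End truncations.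

End density.

Theorem theorem3p9 (R : realType) (N : nat) (hN : (0 < N)%N)
    (w : R -> R) (hw : nonquasianalytic_weight w) :
  [/\ D_space w N \dense_subspace_of S_space w N,
      S_space w N \dense_subspace_of OC_space w N,
      OC_space w N \dense_subspace_of OM_space w N
    & OM_space w N \dense_subspace_of E_space w N].
Proof.
have [psi [psis psi1 psi0 psij]] := cut_family hw N.
by split; [exact: (dense_DS hw hN psis psi1 psi0 psij)|
  exact: (dense_SOC hw hN psis psi1 psi0 psij)|
  exact: (dense_OCOM hw hN psis psi1 psi0 psij)|
  exact: (dense_OME hw hN psis psi1 psi0 psij)].
Qed.
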